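(* Let $d\ge1$. If $h\in\mathcal{G}_p(\mathbb{R}^d)$ for some $p>1$, then $|h|\in H_{-1}(\mathbb{R}^d)$. In particular, with $f:=h*\tilde h$, $h\in\bigcup_{p>1}\mathcal{G}_p(\mathbb{R}^d)$ implies that $\int_{\mathbb{R}^d}\boldsymbol v_\lambda(x)|f(x)|\,dx<\infty$ for some, hence all, $\lambda>0$.
   Context: $\mathbb{B}_r:=\{y\in\mathbb{R}^d:\|y\|<r\}$; $\tilde h(x):=h(-x)$. $\omega_1(r):=1$, $\omega_2(r):=r\log_+(1/r)$, $\omega_d(r):=r$ for $d\ge3$, with $\log_+(z):=\log(z\vee e)$. For $p>1$ and $q:=p/(p-1)$, $\mathcal{G}_p(\mathbb{R}^d)$ is the set of real-valued $h\in L^p_{\mathrm{loc}}(\mathbb{R}^d)$ with $\int_0^1(\|h\|_{L^p(\mathbb{B}_r)}\|h\|_{L^q(\mathbb{B}_r^c)}+\|h\|_{L^2(\mathbb{B}_r^c)}^2)\,\omega_d(r)\,dr<\infty$. $H_{-1}(\mathbb{R}^d)$ is the completion of the rapidly decreasing real-valued functions on $\mathbb{R}^d$ in the norm $\|h\|_{H_{-1}(\mathbb{R}^d)}:=\left(\int_{\mathbb{R}^d}\frac{|\widehat h(x)|^2}{1+\|x\|^2}\,dx\right)^{1/2}$, where $\widehat h$ is the Fourier transform. $\boldsymbol v_\lambda(x):=\int_0^\infty e^{-\lambda t}(2\pi t)^{-d/2}e^{-\|x\|^2/(2t)}\,dt$ for $\lambda>0$, $x\in\mathbb{R}^d$. 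*)

(* Defs.v *)
From HB Require Import structures.
From mathcomp Require Import all_boot all_order all_algebra.
From mathcomp Require Import complex.
From mathcomp Require Import all_classical all_reals all_analysis.

Set Implicit Arguments.
Unset Strict Implicit.
Unset Printing Implicit Defensive.

Import Order.TTheory GRing.Theory Num.Theory.
Import numFieldNormedType.Exports.

Local Open Scope classical_set_scope.
Local Open Scope ring_scope.

(* R^d is the normed space 'rV[R]_d with its product sigma-algebra, which is
   the Borel one since R is second countable. *)
Section measurable_rV.
Context {R : realType}.
Variable d : nat.

Let coors : 'I_d -> 'rV[R]_d -> R := fun i x => x ord0 i.

Let rV_set0 : g_sigma_preimage coors set0.
Proof. exact: sigma_algebra0. Qed.

Let rV_setC A : g_sigma_preimage coors A -> g_sigma_preimage coors (~` A).
Proof. exact: sigma_algebraC. Qed.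

Let rV_bigcup (F : _^nat) : (forall i, g_sigma_preimage coors (F i)) ->
  g_sigma_preimage coors (\bigcup_i (F i)).
Proof. exact: sigma_algebra_bigcup. Qed.

HB.instance Definition _ := @isMeasurable.Build default_measure_display
  'rV[R]_d (g_sigma_preimage coors) rV_set0 rV_setC rV_bigcup.

Lemma measurable_coord (i : 'I_d) :
  measurable_fun [set: 'rV[R]_d] (fun x => x ord0 i).
Proof.
move=> _ Y mY; rewrite setTI; apply: sub_sigma_algebra => /=.
rewrite -bigcup_seq/=; exists i => /=; first by rewrite mem_index_enum.
by exists Y => //; rewrite setTI.
Qed.

Lemma measurable_fun_rVP d' (T : measurableType d') (f : T -> 'rV[R]_d) :
  (forall i, measurable_fun [set: T] (fun t => f t ord0 i)) ->
  measurable_fun [set: T] f.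
Proof.
move=> mf; suff : g_sigma_preimage (fun i => coors i \o f) `<=` measurable.
  by rewrite g_sigma_preimage_comp => + _ A mA; apply; exists A.
apply: smallest_sub; first exact: sigma_algebra_measurable.
rewrite -bigcup_seq/=; apply: bigcup_sub => i _ A [B mB <-].
exact: mf.
Qed.

End measurable_rV.

Definition rV_cons {R : realType} n (p : measurableTypeR R * 'rV[R]_n) :
  'rV[R]_n.+1 := row_mx (p.1 : R)%:M p.2.

Section rV_cons_theory.
Context {R : realType}.

Lemma rV_cons0 n p : @rV_cons R n p ord0 ord0 = p.1.
Proof.
rewrite /rV_cons mxE; case: splitP => // j _.
by rewrite mxE !ord1 eqxx mulr1n.
Qed.

Lemma rV_consS n p i : @rV_cons R n p ord0 (lift ord0 i) = p.2 ord0 i.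
Proof.
rewrite /rV_cons mxE; case: splitP => [j|j /= [ij]]; first by rewrite ord1.
by congr (p.2 _ _); exact: val_inj.
Qed.

Lemma measurable_rV_cons n : measurable_fun setT (@rV_cons R n).
Proof.
apply: measurable_fun_rVP => i; case: (unliftP ord0 i) => [j|] ->.
  under eq_fun do rewrite rV_consS.
  exact: measurableT_comp (measurable_coord j) measurable_snd.
under eq_fun do rewrite rV_cons0.
exact: measurable_fst.
Qed.

End rV_cons_theory.

Section lebesgue_cons.
Local Open Scope ereal_scope.
Context {R : realType} (n : nat).
Variable m : {sigma_finite_measure set 'rV[R]_n -> \bar R}.

Definition lebesgue_cons : set 'rV[R]_n.+1 -> \bar R :=
  pushforward (lebesgue_measure \x m) (@rV_cons R n).

Let mcons A : measurable A -> measurable (@rV_cons R n @^-1` A).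
Proof.
by move=> mA; rewrite -[X in measurable X]setTI; exact: measurable_rV_cons.
Qed.

Let lebesgue_cons0 : lebesgue_cons set0 = 0.
Proof. by rewrite /lebesgue_cons /pushforward preimage_set0 measure0. Qed.

Let lebesgue_cons_ge0 A : 0 <= lebesgue_cons A.
Proof. by rewrite /lebesgue_cons /pushforward; exact: measure_ge0. Qed.

Let lebesgue_cons_additive : semi_sigma_additive lebesgue_cons.
Proof.
move=> F mF tF mUF; rewrite /lebesgue_cons /pushforward preimage_bigcup.
apply: measure_semi_sigma_additive.
- by move=> k; exact: mcons.
- apply/trivIsetP => /= i j _ _ ij; rewrite -preimage_setI.
  by move/trivIsetP : tF => /(_ _ _ _ _ ij) ->//; rewrite preimage_set0.
- by rewrite -preimage_bigcup; exact: mcons.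
Qed.

HB.instance Definition _ := isMeasure.Build _ _ _ lebesgue_cons
  lebesgue_cons0 lebesgue_cons_ge0 lebesgue_cons_additive.

Let lebesgue_cons_sigma_finite : sigma_finite setT lebesgue_cons.
Proof.
have /sigma_finiteP[F [UF ndF Foo]] := sigma_finiteT (@lebesgue_measure R).
have /sigma_finiteP[G [UG ndG Goo]] := sigma_finiteT m.
pose g (x : 'rV[R]_n.+1) : measurableTypeR R * 'rV[R]_n :=
  (x ord0 ord0, \row_i x ord0 (lift ord0 i)).
have mg : measurable_fun setT g.
  apply/measurable_fun_pairP; split; first exact: measurable_coord.
  apply: measurable_fun_rVP => i; under eq_fun do rewrite mxE.
  exact: measurable_coord.
have gK : cancel (@rV_cons R n) g.
  move=> [a y]; rewrite /g rV_cons0; congr pair.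
  by apply/rowP => i; rewrite mxE rV_consS.
exists (fun k => g @^-1` (F k `*` G k)).
  rewrite -preimage_bigcup; apply/esym; rewrite -subTset => x _.
  have [k _ Fk] : (\bigcup_i F i) (g x).1 by rewrite -UF.
  have [l _ Gl] : (\bigcup_i G i) (g x).2 by rewrite -UG.
  exists (maxn k l) => //; split.
    by move: Fk; exact/subsetPset/ndF/leq_maxl.
  by move: Gl; exact/subsetPset/ndG/leq_maxr.
move=> k; have [mF Fk] := Foo k; have [mG Gk] := Goo k.
have mFG : measurable (F k `*` G k) by exact: measurableX.
split; first by rewrite -[X in measurable X]setTI; exact: mg.
rewrite /lebesgue_cons /pushforward -comp_preimage.
rewrite (_ : g \o _ = id) ?preimage_id; last first.
  by apply/funext => p /=; rewrite gK.
by rewrite product_measure1E// lte_mul_pinfty// ge0_fin_numE.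
Qed.

HB.instance Definition _ := Measure_isSigmaFinite.Build _ _ _ lebesgue_cons
  lebesgue_cons_sigma_finite.

End lebesgue_cons.

Fixpoint lebesgue_rV {R : realType} (n : nat) :
    {sigma_finite_measure set 'rV[R]_n -> \bar R} :=
  match n with
  | 0 => \d_(0 : 'rV[R]_0)
  | n'.+1 => lebesgue_cons (lebesgue_rV n')
  end.

Lemma measurable_rV_box {R : realType} n (A : 'I_n -> set R) :
  (forall i, measurable (A i)) ->
  measurable [set x : 'rV[R]_n | forall i, A i (x ord0 i)].
Proof.
move=> mA; have -> : [set x : 'rV[R]_n | forall i, A i (x ord0 i)] =
    \big[setI/setT]_i (fun x : 'rV[R]_n => x ord0 i) @^-1` A i.
  rewrite -bigcap_seq; apply/seteqP; split=> x Ax i //=.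
  by apply: (Ax i); rewrite /= mem_index_enum.
apply: bigsetI_measurable => i _; rewrite -[X in measurable X]setTI.
exact: measurable_coord.
Qed.

Lemma lebesgue_rV_box {R : realType} n (A : 'I_n -> set R) :
  (forall i, measurable (A i)) ->
  lebesgue_rV n [set x | forall i, A i (x ord0 i)] =
  (\prod_(i < n) lebesgue_measure (A i))%E.
Proof.
elim: n A => [|n IHn] A mA /=.
  by rewrite big_ord0 diracE mem_set //; case.
rewrite big_ord_recl -IHn //.
have mB := @measurable_rV_box R n _ (fun i => mA (lift ord0 i)).
rewrite -(product_measure1E lebesgue_measure (lebesgue_rV n) (mA ord0) mB).
rewrite /lebesgue_cons /pushforward; congr product_measure1.
apply/seteqP; split=> -[a y] /=.
  move=> Aay; split; first by have := Aay ord0; rewrite rV_cons0.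
  by move=> i; have := Aay (lift ord0 i); rewrite rV_consS.
move=> [Aa Ay] i; case: (unliftP ord0 i) => [j|] ->.
  by rewrite rV_consS; exact: Ay.
by rewrite rV_cons0.
Qed.

Section euclidean.
Context {R : realType} {d : nat}.
Implicit Types (x y : 'rV[R]_d) (r : R).

Definition dotr x y : R := \sum_(i < d) x ord0 i * y ord0 i.

(* The norm `|x| of 'rV[R]_d is the sup norm, hence a separate definition. *)
Definition enorm x : R := Num.sqrt (dotr x x).

Definition eball r : set 'rV[R]_d := [set y | enorm y < r].

End euclidean.

Section class_G.
Context {R : realType} {d : nat}.
Implicit Types (h : 'rV[R]_d -> R) (p r : R) (D : set 'rV[R]_d).

Definition log_plus (z : R) : R := ln (Num.max z (expR 1)).

(* Meant for 0 < n. *)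
Definition omega (n : nat) r : R :=
  match n with
  | 1 => 1
  | 2 => r * log_plus (1 / r)
  | _ => r
  end.

Definition Lp_loc p h : Prop := measurable_fun setT h /\
  forall K, compact K ->
    (\int[lebesgue_rV d]_(x in K) (`|h x| `^ p)%:E < +oo)%E.

Definition Lp_norm p h D : \bar R :=
  ('N[lebesgue_rV d]_p%:E [EFin \o (h \* \1_D)%R])%E.

(* Norms may be +oo; products follow the convention 0 * +oo = 0. *)
Definition class_G p h : Prop := let q := p / (p - 1) in Lp_loc p h /\
  (\int[lebesgue_measure]_(r in `]0%R, 1%R[)
     ((Lp_norm p h (eball r) * Lp_norm q h (~` eball r)
       + Lp_norm 2 h (~` eball r) ^+ 2) * (omega d r)%:E) < +oo)%E.

End class_G.

Section H_minus_one.
Context {R : realType} {d : nat}.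
Implicit Types (g phi psi : 'rV[R]_d -> R) (x y : 'rV[R]_d).

Definition iter_partial (s : seq 'I_d) phi : 'rV[R]_d -> R :=
  foldr (fun i f x => 'D_(delta_mx ord0 i) f x) phi s.

Definition schwartz phi : Prop := forall s : seq 'I_d,
  (forall x, differentiable (iter_partial s phi) x) /\
  (forall k : nat, exists C : R, forall x,
     (1 + enorm x) ^+ k * `|iter_partial s phi x| <= C).

Definition fourier phi x : R[i] :=
  ((\int[lebesgue_rV d]_y (phi y * cos (dotr x y)))
   +i* (\int[lebesgue_rV d]_y (phi y * sin (dotr x y))))%C.

Definition Hm1_norm phi : \bar R :=
  ((\int[lebesgue_rV d]_x
      (Normc.normc (fourier phi x) ^+ 2 / (1 + enorm x ^+ 2))%:E)
   `^ (2^-1))%E.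

Definition Hm1_cauchy (phi : nat -> 'rV[R]_d -> R) : Prop :=
  forall e : R, 0 < e -> exists N : nat, forall m n : nat,
    (N <= m)%N -> (N <= n)%N ->
    (Hm1_norm (fun x => phi m x - phi n x)%R < e%:E)%E.

(* g defines a tempered distribution, which is the limit of phi. *)
Definition tempered_limit (phi : nat -> 'rV[R]_d -> R) g : Prop :=
  forall psi, schwartz psi ->
    (lebesgue_rV d).-integrable setT (fun x => (g x * psi x)%:E) /\
    (fun n => \int[lebesgue_rV d]_x (phi n x * psi x)) @ \oo -->
      (\int[lebesgue_rV d]_x (g x * psi x) : R).

(* A point of the completion is the class of an Hm1_norm-Cauchy sequence of
   rapidly decreasing functions; such a sequence converges in the space of
   tempered distributions, and its limit determines the class. A function is
   in H_{-1} when the distribution that it defines is such a limit. *)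
Definition in_Hm1 g : Prop := exists phi : nat -> 'rV[R]_d -> R,
  [/\ forall n, schwartz (phi n), Hm1_cauchy phi & tempered_limit phi g].

End H_minus_one.

Section convolution.
Context {R : realType} {d : nat}.
Implicit Types (h g : 'rV[R]_d -> R) (x : 'rV[R]_d).

Definition reflection h x : R := h (- x).

(* At a point x where the integrand is not integrable, this value is infinite
   (in the library oo - oo = -oo). *)
Definition convolution h g x : \bar R :=
  \int[lebesgue_rV d]_y (h y * g (x - y))%:E.

Definition resolvent (lambda : R) x : \bar R :=
  \int[lebesgue_measure]_(t in `]0%R, +oo[)
    (expR (- lambda * t) * (2 * pi * t) `^ (- (d%:R / 2))
     * expR (- (enorm x ^+ 2 / (2 * t))))%:E.

End convolution.

(* Main.v *)
Require Import Defs.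
From HB Require Import structures.
From mathcomp Require Import all_boot all_order all_algebra.
From mathcomp Require Import complex.
From mathcomp Require Import all_classical all_reals all_analysis.
From mathcomp Require Import measurable_realfun.
From mathcomp Require Import ring lra.

(** Let [g] be the modulus of [h] and let [autocorr g x] be the integral of
    [g y * g (y - x)] over [y]. Both statements come from one fact: the energy of
    [g], which is the integral of [resolvent lambda * autocorr g], is finite
    ([energy_lty]).

    Finiteness of the energy. If [enorm x >= 2 * s], then [y] and [y - x] cannot
    both lie in the ball of radius [s], and Hoelder's inequality gives
    [autocorr g x <= 2 * hoelder_bound p h s], where [hoelder_bound p h s * omega s]
    is the integrand in the definition of [class_G]
    ([autocorr_le_hoelder_bound]). For [enorm x < 2] this is averaged over [s]
    between [enorm x / 4] and [enorm x / 2]. After exchanging the two integrals,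
    for each [s] the variable [x] ranges over a set of volume at most [(8 * s) ^ d],
    on which the resolvent is at most [C * omega s / s ^ (d - 1)]
    ([resolvent_radial]); with the factor [4 / s] of the average, what is left is a
    constant times the integral that is finite by hypothesis. For [enorm x >= 2], one
    radius [s < 1] at which [hoelder_bound p h s] is finite is enough, because the
    resolvent is integrable.

    The convolution of [h] with its reflection is at most [autocorr g] in modulus,
    which gives the integrability against the resolvent.

    Membership of [g] in the completion. As [(1 + |x| ^ 2)^-1] is half the integral
    over [t > 0] of [exp (- t * (1 + |x| ^ 2) / 2)], and as the Fourier transform of a
    Gaussian is a multiple of a heat kernel, the squared negative norm of an integrable
    function is at most a constant times the energy of its modulus at [lambda = 1 / 2]
    ([Hm1_le_energy]). Let [g_n] be [g] on the part of a box of size [n] where [g <= n],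
    and [0] elsewhere. The energy of [g - g_n] tends to [0] by dominated convergence
    ([energy_tail_cvg0]). Since [g_n] is bounded with bounded support, there is a
    rapidly decreasing [phi_n] at distance at most [1 / (n + 1)] from it in square mean
    ([approximable_bounded]), and the energy is at most the squared norm in square mean
    divided by [lambda] ([energy_le_sqr]). Hence [phi] is a Cauchy sequence
    ([truncated_Hm1_cauchy]). It tends to [g] as tempered distributions because [g] is
    the sum of an integrable function and of a square integrable one
    ([truncated_tempered_limit]).

    The rapidly decreasing functions that are used are products over the coordinates
    of functions [P * exp (- Q)] with [P] and [Q] polynomials. Such functions are stable
    under differentiation, so that all their derivatives are bounded at once, and they
    can be made to converge to the indicator of a box; Dynkin's theorem and simple
    functions do the rest. *)

Set Implicit Arguments.
Unset Strict Implicit.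
Unset Printing Implicit Defensive.

Import Order.TTheory GRing.Theory Num.Theory.
Import numFieldNormedType.Exports.

Local Open Scope classical_set_scope.
Local Open Scope ring_scope.

(** * Integration in coordinates *)

Section integral_rV.
Local Open Scope ereal_scope.
Context {R : realType}.
Local Notation leb := (@lebesgue_measure R).

Lemma ge0_integral_rV0 (f : 'rV[R]_0 -> \bar R) :
  measurable_fun setT f -> \int[lebesgue_rV 0]_x f x = f 0%R.
Proof. by move=> mf; rewrite /= integral_dirac// diracT mul1e. Qed.

Lemma measurable_rV_consl n (a : R) :
  measurable_fun setT (fun y : 'rV[R]_n => rV_cons ((a : measurableTypeR R), y)).
Proof.
by apply: measurableT_comp; [exact: measurable_rV_cons|exact: pair1_measurable].
Qed.

(** The measure is the image by [rV_cons] of a product measure, hence Tonelli splits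
    off the first coordinate. Inductions on the dimension rest on this. *)
Lemma ge0_integral_rVS n (f : 'rV[R]_n.+1 -> \bar R) :
  measurable_fun setT f -> (forall x, 0 <= f x) ->
  \int[lebesgue_rV n.+1]_x f x =
  \int[leb]_a \int[lebesgue_rV n]_y f (rV_cons ((a : measurableTypeR R), y)).
Proof.
move=> mf f0 /=.
rewrite [LHS](ge0_integral_pushforward (@measurable_rV_cons R n) (lebesgue_measure \x lebesgue_rV n))//.
rewrite preimage_setT fubini_tonelli1//; last by move=> x /=.
by apply: measurableT_comp => //; exact: measurable_rV_cons.
Qed.

Lemma measurable_fun_fubini_rV d' (T : measurableType d') n (f : T * 'rV[R]_n -> \bar R) :
  measurable_fun setT f -> (forall x, 0 <= f x) ->
  measurable_fun setT (fun t => \int[lebesgue_rV n]_y f (t, y)).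
Proof. by move=> mf f0; exact: measurable_fun_fubini_tonelli_F. Qed.

(** The image of the Lebesgue measure by a reflection agrees with it on intervals. *)
Lemma ge0_integral_lebesgue_reflect (c : R) (f : R -> \bar R) :
  measurable_fun setT f -> (forall x, 0 <= f x) ->
  \int[leb]_x f (c - x)%R = \int[leb]_x f x.
Proof.
move=> mf f0.
pose phi : R -> measurableTypeR R := fun x => (c - x)%R.
have mphi : measurable_fun setT phi by exact: measurable_funB.
transitivity (\int[pushforward lebesgue_measure phi]_x f x).
  by rewrite ge0_integral_pushforward.
apply: eq_measure_integral => //= A mA _.
apply/esym/lebesgue_measure_unique => //= _ [[a b]] _ <-.
have -> : pushforward (@lebesgue_measure R) phi `]a, b] =
    lebesgue_measure (`[(c - b)%R, (c - a)%R[%classic : set R).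
  rewrite /pushforward; congr (lebesgue_measure _).
  apply/seteqP; split=> x /=; rewrite /phi !in_itv/= => /andP[h1 h2]; apply/andP; split; lra.
rewrite !lebesgue_measure_itv/= !lte_fin -!EFinD.
case: ifPn => [ab|ab].
  by rewrite ifT; [congr EFin; lra|lra].
by rewrite ifF//; apply/negbTE; lra.
Qed.

(** Translation invariance follows, a translation being the composite of two
    reflections. *)
Lemma ge0_integral_rV_reflect n (c : 'rV[R]_n) (f : 'rV[R]_n -> \bar R) :
  measurable_fun setT f -> (forall x, 0 <= f x) ->
  \int[lebesgue_rV n]_x f (c - x)%R = \int[lebesgue_rV n]_x f x.
Proof.
elim: n c f => [|n IH] c f mf f0.
  rewrite !ge0_integral_rV0//; first by congr f; apply/rowP; case.
  rewrite (_ : (fun _ => _) = cst (f 0%R)) //.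
  by apply/funext => x /=; congr f; apply/rowP; case.
have mB : measurable_fun setT (fun x : 'rV[R]_n.+1 => (c - x)%R).
  apply: measurable_fun_rVP => i.
  rewrite (_ : (fun _ => _) = (fun x : 'rV[R]_n.+1 => c ord0 i - x ord0 i)%R); last first.
    by apply/funext => x; rewrite !mxE.
  by apply: measurable_funB => //; exact: measurable_coord.
rewrite !ge0_integral_rVS//; last exact: measurableT_comp mB.
pose c' : 'rV[R]_n := (\row_i c ord0 (lift ord0 i))%R.
have E a y : (c - rV_cons ((a : measurableTypeR R), y) =
    rV_cons (((c ord0 ord0 - a)%R : measurableTypeR R), c' - y))%R.
  apply/rowP => i; rewrite !mxE; case: (unliftP ord0 i) => [j|] ->.
    have := @rV_consS R n (a, y) j; rewrite /rV_cons mxE => ->.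
    have := @rV_consS R n ((c ord0 ord0 - a)%R, (c' - y)%R) j; rewrite /rV_cons mxE => ->.
    by rewrite /= !mxE.
  have := @rV_cons0 R n (a, y); rewrite /rV_cons mxE => ->.
  by have := @rV_cons0 R n ((c ord0 ord0 - a)%R, (c' - y)%R); rewrite /rV_cons mxE => ->.
under eq_integral do under eq_integral do rewrite E.
under eq_integral => a _ .
  rewrite (IH c' (fun y => f (rV_cons (((c ord0 ord0 - a)%R : measurableTypeR R), y))))//; last first.
    by apply: measurableT_comp => //; exact: measurable_rV_consl.
  over.
rewrite (ge0_integral_lebesgue_reflect (c ord0 ord0) (f := fun a => \int[lebesgue_rV n]_y f (rV_cons ((a : measurableTypeR R), y))))//.
- apply: (@measurable_fun_fubini_rV _ (measurableTypeR R) n (fun z => f (rV_cons (z.1, z.2)))) => //=.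
  apply: measurableT_comp => //.
  rewrite (_ : (fun _ => _) = @rV_cons R n); first exact: measurable_rV_cons.
  by apply/funext => -[].
- by move=> a; apply: integral_ge0.
Qed.

End integral_rV.

Section rV_measurability.
Context {R : realType} {d : nat}.
Context d' {T : measurableType d'}.
Implicit Types f g : T -> 'rV[R]_d.

Lemma measurable_coord_comp f i : measurable_fun setT f ->
  measurable_fun setT (fun t => f t ord0 i).
Proof. by move=> mf; exact: measurableT_comp (measurable_coord i) mf. Qed.

Lemma measurable_rVB f g : measurable_fun setT f -> measurable_fun setT g ->
  measurable_fun setT (fun t => f t - g t).
Proof.
move=> mf mg; apply: measurable_fun_rVP => i.
under eq_fun do rewrite !mxE.
by apply: measurable_funB; exact: measurable_coord_comp.
Qed.

Lemma measurable_dotr f g : measurable_fun setT f -> measurable_fun setT g ->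
  measurable_fun setT (fun t => dotr (f t) (g t)).
Proof.
move=> mf mg; apply: measurable_sum => i.
by apply: measurable_funM; exact: measurable_coord_comp.
Qed.

Lemma measurable_enorm f : measurable_fun setT f ->
  measurable_fun setT (fun t => enorm (f t)).
Proof.
move=> mf; apply: (measurableT_comp (@continuous_measurable_fun _ _ (@sqrt_continuous R))).
exact: measurable_dotr.
Qed.

End rV_measurability.

Section euclidean_norm.
Context {R : realType}.

Lemma dotr_rV_cons n a b (x y : 'rV[R]_n) :
  dotr (rV_cons (a, x)) (rV_cons (b, y)) = a * b + dotr x y.
Proof.
rewrite /dotr big_ord_recl !rV_cons0; congr (_ + _).
by apply: eq_bigr => i _; rewrite !rV_consS.
Qed.

Lemma rV_consK n (x : 'rV[R]_n.+1) :
  rV_cons (x ord0 ord0, \row_i x ord0 (lift ord0 i)) = x.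
Proof.
apply/rowP => i; case: (unliftP ord0 i) => [j|] ->.
  by rewrite rV_consS /= mxE.
by rewrite rV_cons0.
Qed.

Context {d : nat}.
Implicit Types x y : 'rV[R]_d.

Lemma dotrr_ge0 x : 0 <= dotr x x.
Proof. by apply: sumr_ge0 => i _; rewrite -expr2 sqr_ge0. Qed.

Lemma enorm_ge0 x : 0 <= enorm x.
Proof. exact: sqrtr_ge0. Qed.

Lemma sqr_enorm x : enorm x ^+ 2 = dotr x x.
Proof. by rewrite sqr_sqrtr ?dotrr_ge0. Qed.

Lemma ler_coord_enorm x i : `|x ord0 i| <= enorm x.
Proof.
rewrite -ler_sqr ?nnegrE ?enorm_ge0// sqr_enorm real_normK ?num_real//.
rewrite /dotr (bigD1 i)//= expr2 lerDl.
by apply: sumr_ge0 => j _; rewrite -expr2 sqr_ge0.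
Qed.

Lemma eball_sub_box r : eball r `<=` [set x : 'rV[R]_d | forall i, `[- r, r]%classic (x ord0 i)].
Proof.
move=> x xr i; rewrite /= in_itv/= -ler_norml.
exact: le_trans (ler_coord_enorm _ _) (ltW xr).
Qed.

(** Two points at distance at least [2 * r] are not both in a ball of radius
    [r]; the parallelogram inequality replaces the triangle inequality. *)
Lemma eballB x y r : 0 <= r -> 2 * r <= enorm x -> eball r y -> ~ eball r (y - x).
Proof.
rewrite /eball/= => r0 rx ry ryx.
have : enorm x ^+ 2 <= 2 * enorm y ^+ 2 + 2 * enorm (y - x) ^+ 2.
  rewrite !sqr_enorm /dotr !mulr_sumr -big_split/=; apply: ler_sum => i _.
  rewrite !mxE -subr_ge0 [leRHS](_ : _ = (2 * y ord0 i - x ord0 i) ^+ 2); first exact: sqr_ge0.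
  by ring.
move: (enorm_ge0 x) (enorm_ge0 y) (enorm_ge0 (y - x)) => *.
nra.
Qed.

Lemma measurable_eball r : measurable (eball r : set 'rV[R]_d).
Proof.
rewrite (_ : eball r = (@enorm R d) @^-1` `]-oo, r[); last first.
  by apply/seteqP; split => x /=; rewrite in_itv.
rewrite -[X in measurable X]setTI.
exact: (@measurable_enorm _ _ _ _ id).
Qed.

End euclidean_norm.

Section tensor_product.
Local Open Scope ereal_scope.
Context {R : realType} d1 d2 (T1 : measurableType d1) (T2 : measurableType d2).
Variables (m1 : {sigma_finite_measure set T1 -> \bar R}).
Variables (m2 : {sigma_finite_measure set T2 -> \bar R}).

Lemma integrable_tensor (f : T1 -> R) (g : T2 -> R) :
  m1.-integrable setT (EFin \o f) -> m2.-integrable setT (EFin \o g) ->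
  (m1 \x m2).-integrable setT (EFin \o (fun z => f z.1 * g z.2)%R) /\
  \int[m1 \x m2]_z (f z.1 * g z.2)%:E = \int[m1]_x (f x)%:E * \int[m2]_y (g y)%:E.
Proof.
move=> iF iG.
have mF : measurable_fun setT f by apply/measurable_EFinP; exact: measurable_int iF.
have mG : measurable_fun setT g by apply/measurable_EFinP; exact: measurable_int iG.
have mFG : measurable_fun setT (EFin \o (fun z : T1 * T2 => f z.1 * g z.2)%R).
  by apply/measurable_EFinP; apply: measurable_funM; exact: measurableT_comp.
have iprod : (m1 \x m2).-integrable setT (EFin \o (fun z => f z.1 * g z.2)%R).
  apply/integrable12ltyP => //.
  under eq_integral => a _.
    under eq_integral => y _ do rewrite /= normrM EFinM.
    rewrite ge0_integralZl//; last first.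
      by apply/measurable_EFinP; exact: measurableT_comp.
    over.
  rewrite /= ge0_integralZr//.
  - move/integrableP : iF => [_ /= iF]; move/integrableP : iG => [_ /= iG].
    by rewrite lte_mul_pinfty//; [exact: integral_ge0|rewrite ge0_fin_numE// integral_ge0].
  - by apply/measurable_EFinP; exact: measurableT_comp.
  - exact: integral_ge0.
split => //; rewrite -integral12_prod_meas1//.
under eq_integral => a _.
  rewrite /fubini_F; under eq_integral => y _ do rewrite /= EFinM.
  rewrite integralZl//.
  over.
have /fineK <- : \int[m2]_y (g y)%:E \is a fin_num by exact: integrable_fin_num.
by rewrite integralZr.
Qed.

End tensor_product.

Section tensor.
Local Open Scope ereal_scope.
Context {R : realType}.
Local Notation leb := (@lebesgue_measure R).

Lemma rV_tensor n (F : R -> R) (G : 'rV[R]_n -> R) :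
  leb.-integrable setT (EFin \o F) ->
  (lebesgue_rV n).-integrable setT (EFin \o G) ->
  let H (x : 'rV[R]_n.+1) := (F (x ord0 ord0) * G (\row_i x ord0 (lift ord0 i)))%R in
  (lebesgue_rV n.+1).-integrable setT (EFin \o H) /\
  \int[lebesgue_rV n.+1]_x (H x)%:E =
    \int[leb]_a (F a)%:E * \int[lebesgue_rV n]_y (G y)%:E.
Proof.
move=> iF iG H.
have mF : measurable_fun setT F by apply/measurable_EFinP; exact: measurable_int iF.
have mG : measurable_fun setT G by apply/measurable_EFinP; exact: measurable_int iG.
have mH : measurable_fun setT (EFin \o H).
  apply/measurable_EFinP; apply: measurable_funM.
    by apply: measurableT_comp => //; exact: measurable_coord.
  apply: measurableT_comp => //; apply: measurable_fun_rVP => i.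
  under eq_fun do rewrite mxE.
  exact: measurable_coord.
have [iFG FG] := @integrable_tensor R _ _ (measurableTypeR R) 'rV[R]_n
  lebesgue_measure (lebesgue_rV n) F G iF iG.
have HE : EFin \o H \o @rV_cons R n = EFin \o (fun z => F z.1 * G z.2)%R.
  apply/funext => -[a y] /=; congr (_ * G _)%:E%R; first by rewrite rV_cons0.
  by apply/rowP => i; rewrite mxE rV_consS.
have iH : (lebesgue_measure \x lebesgue_rV n).-integrable setT (EFin \o H \o @rV_cons R n).
  by rewrite HE.
split; first exact: (integrable_pushforward (@measurable_rV_cons R n)).
rewrite /= [LHS](integral_pushforward (@measurable_rV_cons R n) (mu := lebesgue_measure \x lebesgue_rV n))//.
by rewrite preimage_setT -[RHS]FG; apply: eq_integral => z _; rewrite HE.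
Qed.

End tensor.

(** * Fourier transform of Gaussian functions *)

Section bounded_factor.
Context {R : realType}.

Lemma norm_cos_le1 (x : R) : `|cos x| <= 1.
Proof. by rewrite ler_norml cos_geN1 cos_le1. Qed.

Lemma norm_sin_le1 (x : R) : `|sin x| <= 1.
Proof. by rewrite ler_norml sin_geN1 sin_le1. Qed.

Lemma measurable_cos_comp d' (T : measurableType d') (f : T -> R) :
  measurable_fun setT f -> measurable_fun setT (fun z => cos (f z)).
Proof.
move=> mf; apply: measurableT_comp mf.
by apply: continuous_measurable_fun; exact: continuous_cos.
Qed.

Lemma measurable_sin_comp d' (T : measurableType d') (f : T -> R) :
  measurable_fun setT f -> measurable_fun setT (fun z => sin (f z)).
Proof.
move=> mf; apply: measurableT_comp mf.
by apply: continuous_measurable_fun; exact: continuous_sin.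
Qed.

Lemma integrable_bounded_mul d' (T : measurableType d') (nu : {measure set T -> \bar R})
    (f b : T -> R) : nu.-integrable setT (EFin \o f) -> measurable_fun setT b ->
  (forall z : T, `|b z| <= 1) -> nu.-integrable setT (EFin \o (fun z : T => f z * b z)).
Proof.
move=> fi mb b1; apply: (le_integrable measurableT _ _ fi).
  apply/measurable_EFinP; apply: measurable_funM => //.
  by apply/measurable_EFinP; exact: measurable_int fi.
by move=> z _; rewrite /= lee_fin normrM ler_piMr.
Qed.

End bounded_factor.

Section gauss1.
Context {R : realType}.
Local Notation leb := (@lebesgue_measure R).

Definition gauss (s x : R) : R := expR (- (s * x ^+ 2 / 2)).

Lemma gauss_gt0 s x : 0 < gauss s x. Proof. exact: expR_gt0. Qed.
Lemma gauss_ge0 s x : 0 <= gauss s x. Proof. exact: expR_ge0. Qed.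

Lemma gauss_normal_fun s : 0 < s ->
  gauss s =1 normal_fun 0 (Num.sqrt s^-1).
Proof.
move=> s0 x; rewrite /gauss /normal_fun subr0 sqr_sqrtr ?invr_ge0 ?ltW//.
congr expR; field; lra.
Qed.

Lemma integrable_gauss s : 0 < s -> leb.-integrable setT (EFin \o gauss s).
Proof.
move=> s0; rewrite (_ : gauss s = fun x => (normal_peak (Num.sqrt s^-1))^-1 *
    normal_pdf 0 (Num.sqrt s^-1) x).
  rewrite (_ : _ \o _ = fun x => ((normal_peak (Num.sqrt s^-1))^-1)%:E *
    (normal_pdf 0 (Num.sqrt s^-1) x)%:E)%E//.
  by apply: integrableZl => //; exact: integrable_normal_pdf.
apply/funext => x; rewrite normal_pdfE ?sqrtr_eq0 -?ltNge ?invr_gt0//.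
  by rewrite mulKf ?gauss_normal_fun// gt_eqF// normal_peak_gt0// sqrtr_eq0 -ltNge invr_gt0.
Qed.

Lemma integral_gauss s : 0 < s ->
  (\int[leb]_x (gauss s x)%:E = (Num.sqrt (2 * pi / s))%:E)%E.
Proof.
move=> s0; have sq0 : Num.sqrt s^-1 != 0 by rewrite sqrtr_eq0 -?ltNge ?invr_gt0.
have := integral_normal_pdf 0 (Num.sqrt s^-1).
rewrite normal_pdfE//; under eq_integral do rewrite EFinM -gauss_normal_fun//.
rewrite integralZl//; last exact: integrable_gauss.
have /fineK <- : (\int[leb]_x (gauss s x)%:E)%E \is a fin_num.
  by apply: integrable_fin_num => //; exact: integrable_gauss.
rewrite -EFinM => -[] /(canRL (mulKf (lt0r_neq0 (normal_peak_gt0 sq0)))).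
move=> ->; rewrite mulr1 invrK; congr (Num.sqrt _)%:E.
by rewrite sqr_sqrtr ?invr_ge0 ?ltW// mulr2n; field; lra.
Qed.

Lemma gauss_le s x : 0 < s -> gauss s x <= (1 + s * x ^+ 2 / 2)^-1.
Proof.
move=> s0; rewrite /gauss expRN lef_pV2 ?posrE ?expR_gt0 ?expR_ge1Dx//.
by have := sqr_ge0 x; nra.
Qed.

Lemma continuous_gauss s : continuous (gauss s).
Proof.
move=> x; apply: differentiable_continuous; apply/derivable1_diffP.
exact: ex_derive.
Qed.

Lemma measurable_gauss s : measurable_fun setT (gauss s).
Proof. by apply: continuous_measurable_fun; exact: continuous_gauss. Qed.

(** The integral is the limit of the integrals over [`[- n.+1, n.+1]], to which the
    fundamental theorem of calculus applies. *)
Lemma integral_derive_eq0 (F f : R -> R) :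
  (forall x : R, is_derive x 1 F (f x)) -> continuous f ->
  leb.-integrable setT (EFin \o f) ->
  F n.+1%:R @[n --> \oo] --> 0 -> F (- n.+1%:R) @[n --> \oo] --> 0 ->
  (\int[leb]_x (f x)%:E = 0)%E.
Proof.
move=> dF cf intf Fy FNy.
pose D n : set R := `[- n.+1%:R, n.+1%:R]%classic.
have IE n : (\int[leb]_(x in D n) (f x)%:E = (F n.+1%:R - F (- n.+1%:R))%:E)%E.
  rewrite (@continuous_FTC2 _ f F)//.
  - by rewrite (@lt_trans _ _ 0)// oppr_lt0.
  - exact: continuous_subspaceT.
  - have cF x : {for x, continuous F}.
      by apply: differentiable_continuous; apply/derivable1_diffP; exact: ex_derive.
    split; first by move=> x _; exact: ex_derive.
      by apply: cvg_at_right_filter; exact: cF.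
    by apply: cvg_at_left_filter; exact: cF.
  - by move=> x _; rewrite derive1E; exact: derive_val.
have lim1 : (\int[leb]_(x in D n) (f x)%:E)%E @[n --> \oo] --> 0%E.
  under eq_fun do rewrite IE.
  apply: cvg_EFin; first by apply: nearW.
  rewrite -[X in _ --> X](subr0 0).
  exact: cvgB.
have lim2 : (\int[leb]_(x in D n) (f x)%:E)%E @[n --> \oo] --> (\int[leb]_x (f x)%:E)%E.
  under eq_fun do rewrite integral_mkcond.
  have mf : measurable_fun setT (EFin \o f) by exact: measurable_int intf.
  have [|||||_ _ ] := @dominated_convergence _ _ _ leb setT measurableT
    (fun n => (EFin \o f) \_ (D n)) (EFin \o f) (abse \o (EFin \o f)); last by [].
  - by move=> n; apply/(measurable_restrictT _ _).1; [exact: measurable_itv|exact: measurable_funTS].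
  - exact: mf.
  - apply/aeW => x _.
    apply: cvg_near_cst; near=> n; rewrite patchE ifT// inE /D/= in_itv/= -ler_norml.
    near: n; exists (Num.truncn `|x|) => // n /= xn.
    by apply/ltW/(lt_le_trans (truncnS_gt _)); rewrite ler_nat ltnS.
  - exact: integrable_abse.
  - by apply/aeW => x n _; rewrite patchE; case: ifPn => //= _; rewrite normr0 lee_fin.
exact: cvg_unique lim2 lim1.
Unshelve. all: end_near. Qed.
End gauss1.

Section gauss_fourier1.
Context {R : realType}.
Local Notation leb := (@lebesgue_measure R).
Implicit Types s u : R.

Lemma integral_odd (f : R -> R) : leb.-integrable setT (EFin \o f) ->
  (forall x, f (- x) = - f x) -> (\int[leb]_x (f x)%:E = 0)%E.
Proof.
move=> intf fN; rewrite integralE.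
have mf : measurable_fun setT (EFin \o f) by exact: measurable_int intf.
have -> : (\int[leb]_x ((fun x => (f x)%:E)^\- x) = \int[leb]_x ((fun x => (f x)%:E)^\+ x))%E.
  rewrite -[RHS](ge0_integral_lebesgue_reflect 0)//.
  - apply: eq_integral => x _; rewrite sub0r.
    by rewrite funenegE funeposE fN EFinN.
  - exact: measurable_funepos.
by rewrite subee//; exact: integrable_pos_fin_num.
Qed.

(** One half of the Gaussian absorbs the factor [`|x|]. *)
Lemma integrable_gaussX s : 0 < s ->
  leb.-integrable setT (EFin \o (fun x => `|x| * gauss s x)).
Proof.
move=> s0; have s20 : 0 < s / 2 by rewrite divr_gt0.
have := integrableZl measurableT (1 + 4 / s) (integrable_gauss s20).
apply: le_integrable => //.
  apply/measurable_EFinP; apply: measurable_funM; last exact: measurable_gauss.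
  exact: normr_measurable.
move=> x _; rewrite /= lee_fin normrM normr_id ger0_norm ?gauss_ge0//.
rewrite [leRHS]ger0_norm; last by rewrite mulr_ge0 ?gauss_ge0// addr_ge0// divr_ge0// ltW.
have -> : gauss s x = gauss (s / 2) x * gauss (s / 2) x.
  by rewrite /gauss -expRD; congr expR; field.
rewrite mulrA ler_wpM2r ?gauss_ge0//.
have : s * x ^+ 2 / 4 * gauss (s / 2) x <= 1.
  rewrite /gauss expRN ler_pdivrMr ?expR_gt0// mul1r.
  rewrite (le_trans _ (expR_ge1Dx _))//.
  by have := sqr_ge0 x; nra.
have g1 : gauss (s / 2) x <= 1.
  by rewrite /gauss expR_le1 oppr_le0; have := sqr_ge0 x; nra.
have := gauss_gt0 (s / 2) x; move: g1; set g := gauss _ _ => g1 g0 sx.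
have xg : x ^+ 2 * g <= 4 / s.
  by rewrite ler_pdivlMr//; nra.
have : `|x| <= 1 + x ^+ 2.
  by rewrite -[x ^+ 2]real_normK ?num_real//; have := sqr_ge0 (`|x| - 1 / 2); nra.
nra.
Qed.

Lemma integrable_gauss_cos s u : 0 < s ->
  leb.-integrable setT (EFin \o (fun x => gauss s x * cos (u * x))).
Proof.
move=> s0; apply: integrable_bounded_mul (integrable_gauss s0) _ _.
  by apply: measurable_cos_comp; exact: mulrl_measurable.
by move=> x; exact: norm_cos_le1.
Qed.

Lemma integrable_gauss_sin s u : 0 < s ->
  leb.-integrable setT (EFin \o (fun x => gauss s x * sin (u * x))).
Proof.
move=> s0; apply: integrable_bounded_mul (integrable_gauss s0) _ _.
  by apply: measurable_sin_comp; exact: mulrl_measurable.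
by move=> x; exact: norm_sin_le1.
Qed.

Lemma integral_gauss_sin s u : 0 < s ->
  (\int[leb]_x (gauss s x * sin (u * x))%:E = 0)%E.
Proof.
move=> s0; apply: integral_odd; first exact: integrable_gauss_sin.
by move=> x; rewrite /gauss sqrrN mulrN sinN mulrN.
Qed.

Lemma integrable_xgauss_sin s u : 0 < s ->
  leb.-integrable setT (EFin \o (fun x => x * gauss s x * sin (u * x))).
Proof.
move=> s0; apply: (le_integrable measurableT _ _ (integrable_gaussX s0)).
  apply/measurable_EFinP; apply: measurable_funM; last first.
    by apply: measurable_sin_comp; exact: mulrl_measurable.
  by apply: measurable_funM => //; exact: measurable_gauss.
move=> x _; rewrite /= lee_fin !normrM normr_id (ger0_norm (gauss_ge0 _ _)).
by rewrite ler_piMr// ?norm_sin_le1// mulr_ge0 ?gauss_ge0.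
Qed.

(** Integration by parts, from the primitive [gauss s x * sin (u * x)]. *)
Lemma gauss_fourier_ode s u : 0 < s ->
  \int[leb]_x (x * gauss s x * sin (u * x)) = u / s * \int[leb]_x (gauss s x * cos (u * x)).
Proof.
move=> s0.
pose F x := gauss s x * sin (u * x).
pose f x := (- s) * (x * gauss s x * sin (u * x)) + u * (gauss s x * cos (u * x)).
have dF (x : R) : is_derive x 1 F (f x).
  rewrite /F /f /gauss; apply: is_derive_eq.
  by rewrite /GRing.scale/=; field.
have i1 : leb.-integrable setT (EFin \o (fun x => (- s) * (x * gauss s x * sin (u * x)))).
  have := integrableZl measurableT (- s) (integrable_xgauss_sin u s0).
  by apply: eq_integrable => // x _; rewrite /= EFinM.
have i2 : leb.-integrable setT (EFin \o (fun x => u * (gauss s x * cos (u * x)))).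
  have := integrableZl measurableT u (integrable_gauss_cos u s0).
  by apply: eq_integrable => // x _; rewrite /= EFinM.
have bound n (y : R) : `|y| = n.+1%:R -> `|F y| <= 2 / s * harmonic n.
  move=> yn; rewrite /F normrM ger0_norm ?gauss_ge0// (@le_trans _ _ (gauss s y))//.
    by rewrite ler_piMr ?gauss_ge0 ?norm_sin_le1.
  apply: (le_trans (gauss_le y s0)); rewrite -[y ^+ 2]real_normK ?num_real// yn.
  rewrite /harmonic/= -(invf_div s 2) -invfM lef_pV2 ?posrE//.
  - have : 1 <= n.+1%:R :> R by rewrite ler1n.
    nra.
  - by rewrite addr_gt0// divr_gt0// mulr_gt0// exprn_gt0.
  - by rewrite mulr_gt0// divr_gt0.
have lim0 : 2 / s * @harmonic R n @[n --> \oo] --> 0.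
  rewrite -[X in _ --> X](mulr0 (2 / s)).
  by apply: cvgMr; exact: cvg_harmonic.
have /eqP : (\int[leb]_x (f x)%:E = 0)%E.
  apply: (integral_derive_eq0 dF).
  - move=> x; apply: differentiable_continuous; apply/derivable1_diffP.
    rewrite /f /gauss; exact: ex_derive.
  - by have := integrableD measurableT i1 i2; apply: eq_integrable.
  - apply: norm_cvg0; apply: (squeeze_cvgr _ (cvg_cst 0) lim0).
    by apply: nearW => n; rewrite normr_ge0 bound// ger0_norm.
  - apply: norm_cvg0; apply: (squeeze_cvgr _ (cvg_cst 0) lim0).
    by apply: nearW => n; rewrite normr_ge0 bound// normrN ger0_norm.
rewrite /f; under eq_integral do rewrite EFinD.
rewrite integralD//.
under eq_integral do rewrite EFinM.
rewrite integralZl//; last exact: integrable_xgauss_sin.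
under [X in (_ + X)%E]eq_integral do rewrite EFinM.
rewrite integralZl//; last exact: integrable_gauss_cos.
rewrite -[X in (_ * X + _)%E]fineK; last by apply: integrable_fin_num => //; exact: integrable_xgauss_sin.
rewrite -[X in (_ + _ * X)%E]fineK; last by apply: integrable_fin_num => //; exact: integrable_gauss_cos.
rewrite -!EFinM -EFinD eqe /Rintegral.
set A := fine _; set B := fine _ => /eqP E.
have -> : u / s * B = (u * B) / s by field; lra.
have -> : u * B = s * A by lra.
by field; lra.
Qed.

End gauss_fourier1.

Section gauss_fourier.
Context {R : realType}.
Local Notation leb := (@lebesgue_measure R).
Implicit Types s u : R.

(** Differentiation under the integral brings out the factor [x * sin (u * x)],
    which [gauss_fourier_ode] turns back into the same integral. *)
Lemma is_derive_gauss_cos s u : 0 < s ->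
  is_derive u 1 (fun u => \int[leb]_x (gauss s x * cos (u * x)))
    (- (u / s * \int[leb]_x (gauss s x * cos (u * x)))).
Proof.
move=> s0; pose f v x := gauss s x * cos (v * x).
have df (v x : R) : is_derive v 1 (f ^~ x) (- (x * gauss s x * sin (v * x))).
  rewrite /f; apply: is_derive_eq.
  by rewrite /GRing.scale/=; ring.
have d1f v x : partial1of2 f v x = - (x * gauss s x * sin (v * x)).
  by rewrite partial1of2E derive_val.
have Iu : (`](u - 1), (u + 1)[%classic : set R) u.
  by rewrite /= in_itv/=; apply/andP; split; lra.
have intf v : (`](u - 1), (u + 1)[%classic : set R) v -> leb.-integrable setT (EFin \o f v).
  by move=> _; exact: integrable_gauss_cos.
have derf v x : (`](u - 1), (u + 1)[%classic : set R) v -> setT x -> derivable (f ^~ x) v 1.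
  by move=> _ _; exact: ex_derive.
have G0 x : 0 <= `|x| * gauss s x by rewrite mulr_ge0 ?gauss_ge0.
have bound v x : (`](u - 1), (u + 1)[%classic : set R) v -> setT x ->
    `|partial1of2 f v x| <= `|x| * gauss s x.
  move=> _ _; rewrite d1f normrN !normrM (ger0_norm (gauss_ge0 _ _)).
  by rewrite ler_piMr// ?norm_sin_le1// mulr_ge0 ?gauss_ge0.
have der := derivable_under_integral measurableT Iu intf derf G0 (integrable_gaussX s0) bound.
have val := differentiation_under_integral measurableT Iu intf derf G0 (integrable_gaussX s0) bound.
apply: DeriveDef => //.
rewrite -derive1E val; under eq_Rintegral do rewrite d1f.
rewrite -gauss_fourier_ode// -[RHS]mulN1r -RintegralZl//; last exact: integrable_xgauss_sin.
by apply: eq_Rintegral => x _; rewrite mulN1r.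
Qed.

(** By the differential equation, the product of this integral and of
    [expR (u ^+ 2 / (2 * s))] does not depend on [u]; at [0] it is the Gaussian
    integral. *)
Lemma integral_gauss_cos s u : 0 < s ->
  (\int[leb]_x (gauss s x * cos (u * x))%:E =
   (Num.sqrt (2 * pi / s) * expR (- (u ^+ 2 / (2 * s))))%:E)%E.
Proof.
move=> s0.
pose C v := \int[leb]_x (gauss s x * cos (v * x)).
pose D v := C v * expR (v ^+ 2 / (2 * s)).
have dC (v : R) : is_derive v 1 C (- (v / s * C v)) by exact: is_derive_gauss_cos.
have dD (v : R) : is_derive v 1 D 0.
  rewrite /D; apply: is_derive_eq.
  by rewrite /GRing.scale/=; field; lra.
have : D u = D 0 by exact: is_derive_0_is_cst.
rewrite /D expr0n/= mul0r expR0 mulr1 => DE.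
have C0 : C 0 = Num.sqrt (2 * pi / s).
  rewrite /C /Rintegral.
  under eq_integral do rewrite mul0r cos0 mulr1.
  by rewrite integral_gauss.
rewrite -C0 -DE -mulrA -expRD subrr expR0 mulr1 /C /Rintegral fineK//.
by apply: integrable_fin_num => //; exact: integrable_gauss_cos.
Qed.

Lemma gauss_rV_cons s n (a : R) (y : 'rV[R]_n) :
  expR (- (s * dotr (rV_cons (a, y)) (rV_cons (a, y)) / 2)) =
  gauss s a * expR (- (s * dotr y y / 2)).
Proof. by rewrite dotr_rV_cons -expRD; congr expR; field. Qed.

(** The cosine and the sine go together, because the addition formulas mix them when
    a coordinate is split off. *)
Lemma gauss_fourier_rV s d (u : 'rV[R]_d) : 0 < s ->
  let C x := expR (- (s * dotr x x / 2)) * cos (dotr x u) in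
  let S x := expR (- (s * dotr x x / 2)) * sin (dotr x u) in
  [/\ (lebesgue_rV d).-integrable setT (EFin \o C),
      (lebesgue_rV d).-integrable setT (EFin \o S),
      (\int[lebesgue_rV d]_x (S x)%:E = 0)%E &
      (\int[lebesgue_rV d]_x (C x)%:E =
       (Num.sqrt (2 * pi / s) ^+ d * expR (- (dotr u u / (2 * s))))%:E)%E].
Proof.
move=> s0; elim: d u => [|n IH] u.
  have d0 x : dotr x u = 0 by rewrite /dotr big_ord0.
  have u0 (x : 'rV[R]_0) : dotr x x = 0 by rewrite /dotr big_ord0.
  rewrite /=.
  have -> : (fun x : 'rV[R]_0 => expR (- (s * dotr x x / 2)) * cos (dotr x u)) = cst 1.
    by apply/funext => x; rewrite d0 u0 cos0 mulr0 mul0r oppr0 expR0 mulr1.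
  have -> : (fun x : 'rV[R]_0 => expR (- (s * dotr x x / 2)) * sin (dotr x u)) = cst 0.
    by apply/funext => x; rewrite d0 u0 sin0 mulr0.
  split.
  - exact: finite_measure_integrable_cst.
  - exact: finite_measure_integrable_cst.
  - by rewrite integral0_eq// => x _; rewrite d0 sin0 mulr0.
  - under eq_integral do rewrite d0 u0 cos0 mulr0 mul0r oppr0 expR0 mulr1.
    by rewrite integral_dirac// diracT mul1e u0 mul0r oppr0 expR0 mulr1 expr0.
pose u' := \row_i u ord0 (lift ord0 i) : 'rV[R]_n.
have [iC iS S0 C0] := IH u'.
set Cn := fun x : 'rV[R]_n => _ in iC C0; set Sn := fun x : 'rV[R]_n => _ in iS S0.
pose u0 := u ord0 ord0.
have [iCC CC] := rV_tensor (integrable_gauss_cos u0 s0) iC.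
have [iCS CS] := rV_tensor (integrable_gauss_cos u0 s0) iS.
have [iSC SC] := rV_tensor (integrable_gauss_sin u0 s0) iC.
have [iSS SS] := rV_tensor (integrable_gauss_sin u0 s0) iS.
have dE (x : 'rV[R]_n.+1) : dotr x u = u0 * x ord0 ord0 + dotr (\row_i x ord0 (lift ord0 i)) u'.
  by rewrite -{1}(rV_consK x) -{1}(rV_consK u) dotr_rV_cons mulrC.
have gE (x : 'rV[R]_n.+1) : expR (- (s * dotr x x / 2)) = gauss s (x ord0 ord0) *
   expR (- (s * dotr (\row_i x ord0 (lift ord0 i)) (\row_i x ord0 (lift ord0 i)) / 2)).
  by rewrite -{1 2}(rV_consK x) gauss_rV_cons.
have CE (x : 'rV[R]_n.+1) : expR (- (s * dotr x x / 2)) * cos (dotr x u) =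
    gauss s (x ord0 ord0) * cos (u0 * x ord0 ord0) * Cn (\row_i x ord0 (lift ord0 i)) -
    gauss s (x ord0 ord0) * sin (u0 * x ord0 ord0) * Sn (\row_i x ord0 (lift ord0 i)).
  by rewrite gE dE cosD /Cn /Sn; ring.
have SE (x : 'rV[R]_n.+1) : expR (- (s * dotr x x / 2)) * sin (dotr x u) =
    gauss s (x ord0 ord0) * sin (u0 * x ord0 ord0) * Cn (\row_i x ord0 (lift ord0 i)) +
    gauss s (x ord0 ord0) * cos (u0 * x ord0 ord0) * Sn (\row_i x ord0 (lift ord0 i)).
  by rewrite gE dE sinD /Cn /Sn; ring.
split.
- have := integrableB measurableT iCC iSS; apply: eq_integrable => // x _.
  by rewrite /= CE EFinB.
- have := integrableD measurableT iSC iCS; apply: eq_integrable => // x _.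
  by rewrite /= SE EFinD.
- under eq_integral do rewrite SE EFinD.
  rewrite integralD//.
  by rewrite SC CS S0 mule0 integral_gauss_sin// mul0e adde0.
- under eq_integral do rewrite CE EFinB.
  rewrite integralB//.
  rewrite CC SS S0 mule0 oppe0 adde0 C0 integral_gauss_cos// -EFinM; congr EFin.
  rewrite dE -/u' -/u0.
  rewrite mulrACA -exprS -expRD; congr (_ * expR _).
  by field; lra.
Qed.

End gauss_fourier.

(** * The resolvent kernel *)

Section half_line.
Context {R : realType}.
Local Notation leb := (@lebesgue_measure R).

(** The inverse is [f x] times a real power of [f x ^+ 2], and real powers are
    measurable; where [f x] is [0], so are both sides. *)
Lemma measurable_invr d (T : measurableType d) (f : T -> R) :
  measurable_fun setT f -> measurable_fun setT (fun x => (f x)^-1).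
Proof.
move=> mf; rewrite (_ : (fun _ => _) = fun x => f x * ((f x ^+ 2) `^ (-1))).
  apply: measurable_funM => //.
  apply: (measurableT_comp (@measurable_powR R (-1))).
  exact: measurable_funX.
apply/funext => x; rewrite powRN powRr1 ?sqr_ge0//.
have [->|f0] := eqVneq (f x) 0; first by rewrite invr0 mul0r.
by rewrite expr2 invfM mulrA divff// mul1r.
Qed.

Lemma integral_indic_mkcond d (T : measurableType d) (mu : {measure set T -> \bar R})
    (D : set T) (f : T -> \bar R) :
  (\int[mu]_(x in D) f x = \int[mu]_x (f x * (\1_D x)%:E))%E.
Proof. by rewrite integral_mkcond epatch_indic. Qed.

Lemma bigcup_itv_oy : \bigcup_n `[(n.+1%:R)^-1, n.+1%:R]%classic = `]0, +oo[%classic :> set R.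
Proof.
apply/seteqP; split=> [x [n _]|x] /=; rewrite !in_itv/=.
  by case/andP => + _; rewrite andbT; apply: lt_le_trans; rewrite invr_gt0.
rewrite andbT => x0.
pose m := maxn (Num.truncn x) (Num.truncn x^-1).
have h (y : R) : y < (Num.truncn y).+1%:R by exact: truncnS_gt.
exists m => //=; rewrite in_itv/=; apply/andP; split.
  rewrite invf_ple ?posrE// ltW// (lt_le_trans (h _))//.
  by rewrite ler_nat ltnS leq_maxr.
rewrite ltW// (lt_le_trans (h _))//.
by rewrite ler_nat ltnS leq_maxl.
Qed.

(** Exhausting the half-line by compact intervals avoids any discussion of the limits
    of the primitive at [0] and at infinity: its increments only have to be bounded. *)
Lemma integral_oy_le_primitive (f G : R -> R) (M : R) :
  measurable_fun setT f ->
  (forall x, 0 < x -> 0 <= f x) -> (forall x, 0 < x -> {for x, continuous f}) ->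
  (forall x : R, 0 < x -> is_derive x 1 G (f x)) ->
  (forall a b, 0 < a -> a <= b -> G b - G a <= M) ->
  (\int[leb]_(x in `]0%R, +oo[) (f x)%:E <= M%:E)%E.
Proof.
move=> mf f0 cf dG GM; rewrite -bigcup_itv_oy.
pose D n : set R := `[(n.+1%:R)^-1, n.+1%:R]%classic.
have gt0 n x : D n x -> 0 < x.
  by rewrite /D/= in_itv/= => /andP[+ _]; apply: lt_le_trans; rewrite invr_gt0.
have lim : (\int[leb]_(x in D n) (f x)%:E)%E @[n --> \oo] -->
    (\int[leb]_(x in \bigcup_n D n) (f x)%:E)%E.
  apply: ge0_nondecreasing_set_cvg_integral.
  - move=> n m nm; apply/subsetPset => x; rewrite /D/= !in_itv/= => /andP[nx xn].
    apply/andP; split.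
      by rewrite (le_trans _ nx)// lef_pV2 ?posrE// ler_nat ltnS.
    by rewrite (le_trans xn)// ler_nat ltnS.
  - by move=> n; exact: measurable_itv.
  - by move=> n; apply/measurable_EFinP; exact: measurable_funTS.
  - by move=> n x /gt0 x0; rewrite lee_fin f0.
apply: (cvge_to_le lim).
apply: nearW => n.
have [->|n0] := eqVneq n 0%N.
  rewrite /D invr1 set_itv1 integral_set1 lee_fin.
  by have := GM 1 1 ltr01 (lexx _); rewrite subrr.
have lt1 : 1 < n.+1%:R :> R by rewrite ltr1n ltnS lt0n.
have ltn : (n.+1%:R)^-1 < n.+1%:R :> R.
  by rewrite (@lt_trans _ _ 1)// invf_lt1.
have cG (x : R) : 0 < x -> {for x, continuous G}.
  move=> x0; have := dG _ x0 => d; apply: differentiable_continuous.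
  by apply/derivable1_diffP; exact: ex_derive.
rewrite /D (@continuous_FTC2 _ f G)//.
- by rewrite -EFinD lee_fin GM// ?invr_gt0// ltW.
- apply: continuous_in_subspaceT => x; rewrite inE => /gt0; exact: cf.
- split.
  + move=> x; rewrite in_itv/= => /andP[nx _].
    have := dG x; case=> //; rewrite (lt_trans _ nx)// invr_gt0//.
  + apply: cvg_at_right_filter; apply: cG; by rewrite invr_gt0.
  + by apply: cvg_at_left_filter; exact: cG.
- move=> x; rewrite in_itv/= => /andP[nx _]; rewrite derive1E.
  have x0 : 0 < x by rewrite (lt_trans _ nx)// invr_gt0.
  by have := dG x x0 => d; exact: derive_val.
Qed.

Lemma integral_expRN (l : R) : 0 < l ->
  (\int[leb]_(t in `]0%R, +oo[) (expR (- l * t))%:E = (l^-1)%:E)%E.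
Proof.
move=> l0.
have me : measurable_fun setT (fun t : R => (expR (- l * t))%:E).
  apply/measurable_EFinP; apply: (measurableT_comp (@measurable_expR R)).
  exact: mulrl_measurable.
rewrite integral_itv_obnd_cbnd; last exact: measurable_funTS.
have dF (t : R) : is_derive t 1 (fun t => - (l^-1 * expR (- l * t))) (expR (- l * t)).
  by apply: is_derive_eq; rewrite /GRing.scale/=; field; lra.
rewrite (@ge0_continuous_FTC2y _ _ (fun t => - (l^-1 * expR (- l * t))) 0 0).
- by rewrite mulr0 expR0 mulr1 -EFinD; congr EFin; ring.
- by move=> x _; exact: expR_ge0.
- apply: continuous_subspaceT => x; apply: differentiable_continuous.
  by apply/derivable1_diffP; exact: ex_derive.
- rewrite -oppr0; apply: cvgN; rewrite -(mulr0 l^-1); apply: cvgMr.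
  under eq_fun do rewrite mulNr.
  apply: (cvg_comp (fun x => l * x) (fun x => expR (- x))); last exact: cvgr_expR.
  exact: gt0_cvgMry.
- by move=> x _; exact: ex_derive.
- have cF : {for 0, continuous (fun t => - (l^-1 * expR (- l * t)))}.
    apply: differentiable_continuous; apply/derivable1_diffP; exact: ex_derive.
  exact: cvg_at_right_filter.
- by move=> x _; rewrite derive1E; exact: derive_val.
Qed.

End half_line.

Section resolvent_kernel.
Context {R : realType}.
Local Notation leb := (@lebesgue_measure R).

(** The heat kernel with the damping factor [expR (- l * t)], as a function of the norm
    [e] of the point. *)
Definition heat (d : nat) (l : R) (e t : R) : R :=
  expR (- l * t) * (2 * pi * t) `^ (- (d%:R / 2)) * expR (- (e ^+ 2 / (2 * t))).

Lemma heat_ge0 d l e t : 0 <= heat d l e t.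
Proof. by rewrite /heat !mulr_ge0 ?expR_ge0 ?powR_ge0. Qed.

Lemma powR_half_nat (z : R) (n : nat) : 0 < z -> z `^ (- (n%:R / 2)) = (Num.sqrt z ^+ n)^-1.
Proof.
move=> z0; rewrite powRN; congr (_^-1).
by rewrite mulrC powRrM powR12_sqrt ?ltW// powR_mulrn ?sqrtr_ge0.
Qed.

Lemma measurable_heat dT (T : measurableType dT) d l (e t : T -> R) :
  measurable_fun setT e -> measurable_fun setT t ->
  measurable_fun setT (fun z => heat d l (e z) (t z)).
Proof.
move=> me mt; apply: measurable_funM; first apply: measurable_funM.
- apply: (measurableT_comp (@measurable_expR R)).
  exact: (measurableT_comp (mulrl_measurable _)).
- apply: (measurableT_comp (@measurable_powR R _)).
  exact: (measurableT_comp (mulrl_measurable _)).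
- apply: (measurableT_comp (@measurable_expR R)).
  apply: (measurableT_comp (@oppr_measurable R _)).
  apply: measurable_funM; first exact: measurable_funX.
  apply: measurable_invr.
  exact: (measurableT_comp (mulrl_measurable _)).
Qed.

Context {d : nat}.
Implicit Types (x : 'rV[R]_d) (l : R).

Lemma resolventE l x :
  (resolvent l x = \int[leb]_t ((heat d l (enorm x) t)%:E * (\1_(`]0%R, +oo[%classic : set R) t)%:E))%E.
Proof. exact: integral_indic_mkcond. Qed.

Lemma resolvent_ge0 l x : (0 <= resolvent l x)%E.
Proof. by apply: integral_ge0 => t _; rewrite lee_fin heat_ge0. Qed.

Lemma measurable_heat_indic l : measurable_fun setT (fun z : 'rV[R]_d * measurableTypeR R =>
  ((heat d l (enorm z.1) z.2)%:E * (\1_(`]0%R, +oo[%classic : set R) z.2)%:E)%E).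
Proof.
apply: emeasurable_funM; apply/measurable_EFinP.
  by apply: measurable_heat => //; exact: measurable_enorm.
by apply: measurableT_comp => //; exact: measurable_indic.
Qed.

Lemma measurable_resolvent l : measurable_fun setT (fun x : 'rV[R]_d => resolvent l x).
Proof.
under eq_fun do rewrite resolventE.
apply: (measurable_fun_fubini_tonelli_F (m2 := lebesgue_measure) _ (measurable_heat_indic l)).
by move=> z; rewrite mule_ge0// lee_fin// heat_ge0.
Qed.

Lemma integral_gauss_rV (s : R) (u : 'rV[R]_d) : 0 < s ->
  (\int[lebesgue_rV d]_x (expR (- (s * dotr x x / 2)) * cos (dotr x u))%:E =
   (Num.sqrt (2 * pi / s) ^+ d * expR (- (dotr u u / (2 * s))))%:E)%E.
Proof. by move=> s0; have [] := gauss_fourier_rV u s0. Qed.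

Lemma integrable_gauss_rV (s : R) (u : 'rV[R]_d) : 0 < s ->
  (lebesgue_rV d).-integrable setT
    (EFin \o (fun x => expR (- (s * dotr x x / 2)) * cos (dotr x u))).
Proof. by move=> s0; have [] := gauss_fourier_rV u s0. Qed.

Lemma dotr0 (x : 'rV[R]_d) : dotr x 0 = 0.
Proof. by rewrite /dotr big1// => i _; rewrite mxE mulr0. Qed.

(** At frequency [0], the formula for the Fourier transform of a Gaussian is the value of
    its integral. *)
Lemma integral_heat l t : 0 < t ->
  (\int[lebesgue_rV d]_x (heat d l (enorm x) t)%:E = (expR (- l * t))%:E)%E.
Proof.
move=> t0; have it0 : 0 < t^-1 by rewrite invr_gt0.
have pt0 : 0 < 2 * pi * t by rewrite !mulr_gt0// pi_gt0.
rewrite (_ : (fun _ => _) = fun x => ((expR (- l * t) * (2 * pi * t) `^ (- (d%:R / 2)))%:E *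
    (expR (- (t^-1 * dotr x x / 2)) * cos (dotr x 0))%:E)%E); last first.
  apply/funext => x; rewrite dotr0 cos0 mulr1 -EFinM /heat sqr_enorm; congr (_ * expR _)%:E.
  by field; lra.
rewrite integralZl//; last exact: integrable_gauss_rV.
rewrite integral_gauss_rV// dotr0 mul0r oppr0 expR0 mulr1 -EFinM; congr EFin.
rewrite powR_half_nat// invrK divfK// gt_eqF// exprn_gt0// sqrtr_gt0//.
Qed.

Lemma integral_resolvent_le l : 0 < l ->
  (\int[lebesgue_rV d]_x resolvent l (x : 'rV[R]_d) <= (l^-1)%:E)%E.
Proof.
move=> l0; under eq_integral do rewrite resolventE.
rewrite (fubini_tonelli (m1 := lebesgue_rV d) (m2 := lebesgue_measure) (fun z : 'rV[R]_d * measurableTypeR R =>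
  ((heat d l (enorm z.1) z.2)%:E * (\1_(`]0%R, +oo[%classic : set R) z.2)%:E)%E))/=; last first.
- by move=> z; rewrite mule_ge0// lee_fin// heat_ge0.
- exact: measurable_heat_indic.
rewrite -(integral_expRN l0) [leRHS]integral_indic_mkcond le_eqVlt; apply/orP; left; apply/eqP.
apply: eq_integral => t _.
rewrite ge0_integralZr//.
- rewrite indicE; have [|] := boolP (t \in _); last by rewrite !mule0.
  by rewrite inE/= in_itv/= andbT => t0; rewrite integral_heat.
- apply/measurable_EFinP/measurable_heat => //; exact: measurable_enorm.
- by move=> x _; rewrite lee_fin heat_ge0.
Qed.

Lemma ler_heat l e1 e2 t : 0 <= e1 -> e1 <= e2 -> 0 < t -> heat d l e2 t <= heat d l e1 t.
Proof.
move=> e10 e12 t0; rewrite /heat ler_wpM2l ?mulr_ge0 ?expR_ge0 ?powR_ge0//.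
rewrite ler_expR lerN2 ler_wpM2r//; first by rewrite invr_ge0 mulr_ge0// ltW.
by rewrite ler_sqr ?nnegrE// (le_trans e10).
Qed.

(** The radial bounds below are obtained by choosing a majorant [f] of the heat kernel
    that has an explicit primitive [G]. *)
Lemma resolvent_le l (e : R) x (f G : R -> R) (M : R) : 0 <= e -> e <= enorm x ->
  measurable_fun setT f -> (forall t, 0 < t -> heat d l e t <= f t) ->
  (forall t : R, 0 < t -> {for t, continuous f}) ->
  (forall t : R, 0 < t -> is_derive t 1 G (f t)) ->
  (forall a b, 0 < a -> a <= b -> G b - G a <= M) ->
  (resolvent l x <= M%:E)%E.
Proof.
move=> e0 ex mf hf cf dG GM.
have f0 t : 0 < t -> 0 <= f t by move=> t0; exact: le_trans (heat_ge0 _ _ _ _) (hf t t0).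
apply: le_trans (integral_oy_le_primitive mf f0 cf dG GM).
apply: ge0_le_integral => //.
- by move=> t _; rewrite lee_fin heat_ge0.
- apply/measurable_EFinP; apply: measurable_funTS.
  exact: (@measurable_heat _ _ d l (cst (enorm x)) id).
- by apply/measurable_EFinP; apply: measurable_funTS.
- move=> t; rewrite /= in_itv/= andbT => t0; rewrite lee_fin.
  apply: le_trans (hf t t0).
  exact: (ler_heat l e0 ex t0).
Qed.

End resolvent_kernel.

Section radial_bound.
Context {R : realType}.
Implicit Types s t l : R.

(** From [1 + y <= n.+1 * expR (y / n.+1)], raised to the power [n]. *)
Lemma exprD1_expRN_le (n : nat) (y : R) : 0 <= y ->
  (1 + y) ^+ n * expR (- y) <= n.+1%:R ^+ n.
Proof.
move=> y0; have n0 : 0 < n.+1%:R :> R by [].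
have h : 1 + y <= n.+1%:R * expR (y / n.+1%:R).
  rewrite (@le_trans _ _ (n.+1%:R * (1 + y / n.+1%:R)))//.
    rewrite mulrDr mulr1 mulrCA divff ?gt_eqF// mulr1 lerD2r.
    by rewrite ler1n.
  by rewrite ler_pM2l// expR_ge1Dx.
have h2 : (1 + y) ^+ n <= n.+1%:R ^+ n * expR y.
  rewrite (@le_trans _ _ ((n.+1%:R * expR (y / n.+1%:R)) ^+ n))//.
    by rewrite lerXn2r// nnegrE ?mulr_ge0 ?expR_ge0 ?addr_ge0.
  rewrite exprMn ler_wpM2l ?exprn_ge0// -expRM_natl ler_expR.
  rewrite mulrCA ler_piMr// ler_pdivrMr// mul1r ler_nat//.
by rewrite expRN ler_pdivrMr ?expR_gt0.
Qed.

Lemma expRN_mul_le l (c t : R) : 0 < l -> 0 <= c -> 0 <= t ->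
  expR (- l * t) * (c + t) <= c + l^-1.
Proof.
move=> l0 c0 t0; rewrite mulNr expRN mulrC ler_pdivrMr ?expR_gt0//.
have h := expR_ge1Dx (l * t).
have l10 : 0 < l^-1 by rewrite invr_gt0.
rewrite (@le_trans _ _ ((c + l^-1) * (1 + l * t)))//; last by rewrite ler_wpM2l// addr_ge0// ltW.
have -> : (c + l^-1) * (1 + l * t) = c + t + (c * l * t + l^-1) by field; lra.
by rewrite lerDl addr_ge0 ?mulr_ge0// ltW.
Qed.

(** The derivative of [atan (sqrt t / s)]: it behaves like [t ^ (- 1 / 2)] at [0]
    and like [t ^ (- 3 / 2)] at infinity, and its mass does not depend on [s]. *)
Definition atan_density s t : R := s / (2 * Num.sqrt t * (s ^+ 2 + t)).

Lemma is_derive_atan_density s t : 0 < s -> 0 < t ->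
  is_derive t 1 (fun t => atan (Num.sqrt t / s)) (atan_density s t).
Proof.
move=> s0 t0; have dt := is_derive1_sqrt t0.
have st0 : 0 < Num.sqrt t by rewrite sqrtr_gt0.
have d1 : is_derive t 1 (fun t => Num.sqrt t / s) ((2 * Num.sqrt t)^-1 / s).
  by apply: is_derive_eq; rewrite /GRing.scale/=; ring.
have h := @is_derive1_comp _ atan (fun t => Num.sqrt t / s) t _ _ (is_derive1_atan _) d1.
 apply: (is_derive_eq h).
rewrite /atan_density; have tE := sqr_sqrtr (ltW t0).
move: s0 st0 tE; clear => s0; set r := Num.sqrt t => r0 <-.
have : 0 < s ^+ 2 + r ^+ 2 by rewrite addr_gt0// exprn_gt0.
by move=> ?; field; lra.
Qed.

Lemma continuous_atan_density s t : 0 < s -> 0 < t ->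
  {for t, continuous (atan_density s)}.
Proof.
move=> s0 t0; have st0 : 0 < Num.sqrt t by rewrite sqrtr_gt0.
apply: cvgM; first exact: cvg_cst.
apply: cvgV.
  by rewrite gt_eqF// !mulr_gt0// addr_gt0// exprn_gt0.
apply: cvgM; first (apply: cvgM; [exact: cvg_cst|exact: sqrt_continuous]).
by apply: cvgD; [exact: cvg_cst|exact: cvg_id].
Qed.

Lemma measurable_atan_density s : measurable_fun setT (atan_density s).
Proof.
apply: measurable_funM => //; apply: measurable_invr.
apply: measurable_funM; last exact: measurable_funD.
apply: measurable_funM => //.
by apply: continuous_measurable_fun; exact: sqrt_continuous.
Qed.

Lemma resolvent_le_atan_density (d : nat) l e s K (x : 'rV[R]_d) : 0 < s -> 0 <= K ->
  0 <= e -> e <= enorm x ->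
  (forall t, 0 < t -> heat d l e t <= K * atan_density s t) ->
  (resolvent l x <= (K * pi)%:E)%E.
Proof.
move=> s0 K0 e0 ex h.
apply: (@resolvent_le _ _ l e x (fun t => K * atan_density s t) (fun t => K * atan (Num.sqrt t / s)) _ e0 ex) => //.
- by apply: measurable_funM => //; exact: measurable_atan_density.
- by move=> t t0; apply: cvgM; [exact: cvg_cst|exact: continuous_atan_density].
- move=> t t0; have dt := is_derive_atan_density s0 t0.
  by apply: is_derive_eq.
- move=> a b a0 ab; rewrite -mulrBr ler_wpM2l//.
  have := atan_ltpi2 (Num.sqrt b / s).
  have := atan_gtNpi2 (Num.sqrt a / s).
  lra.
Qed.

Lemma ler_heat_base d l e t : 0 < l -> 0 < t ->
  heat d l e t <= expR (- l * t) * (Num.sqrt t ^+ d)^-1 * expR (- (e ^+ 2 / (2 * t))).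
Proof.
move=> l0 t0; rewrite /heat ler_wpM2r ?expR_ge0// ler_wpM2l ?expR_ge0//.
have p1 : 1 <= 2 * pi :> R by have := pi_ge2 R; lra.
rewrite powR_half_nat; last by rewrite mulr_gt0// (lt_le_trans _ p1).
have st0 : 0 < Num.sqrt t by rewrite sqrtr_gt0.
have le : Num.sqrt t <= Num.sqrt (2 * pi * t).
  by rewrite ler_wsqrtr// ler_peMl// ltW.
rewrite lef_pV2 ?posrE ?exprn_gt0 ?(lt_le_trans st0)//.
by rewrite lerXn2r// nnegrE ltW// (lt_le_trans st0).
Qed.

(** On the line the resolvent is bounded, since the heat kernel behaves like
    [t ^ (- 1 / 2)] at [0] and decays exponentially. *)
Lemma resolvent_radial1 l : 0 < l ->
  exists2 C, 0 < C & forall x : 'rV[R]_1, (resolvent l x <= C%:E)%E.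
Proof.
move=> l0; pose K := 2 * (1 + l^-1).
have K0 : 0 < K by rewrite mulr_gt0// addr_gt0// invr_gt0.
exists (K * pi); first by rewrite mulr_gt0// pi_gt0.
move=> x; apply: (@resolvent_le_atan_density 1 l 0 1 K) => //; [exact: ltW|exact: enorm_ge0|].
move=> t t0; apply: (le_trans (ler_heat_base _ _ _ _)) => //.
rewrite expr1 expr0n/= mul0r oppr0 expR0 mulr1 /atan_density expr1n mul1r.
have st0 : 0 < Num.sqrt t by rewrite sqrtr_gt0.
have t10 : 0 < 1 + t by rewrite addr_gt0.
have h := expRN_mul_le l0 (ler01) (ltW t0).
rewrite (_ : K * _ = (1 + l^-1) / (1 + t) / Num.sqrt t); last first.
  by rewrite /K; field; lra.
by rewrite ler_wpM2r ?invr_ge0 ?(ltW st0)// ler_pdivlMr.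
Qed.

(** The change of scale [z = s / sqrt t] reduces the comparison with [atan_density] to
    the boundedness of a power of [1 + z ^ 2] times a Gaussian in [z]. *)
Lemma resolvent_radial3 l n : 0 < l ->
  exists2 C, 0 < C & forall s (x : 'rV[R]_n.+3), 0 < s -> 2 * s <= enorm x ->
    (resolvent l x <= (C / s ^+ n.+1)%:E)%E.
Proof.
move=> l0; pose Cn : R := n.+2%:R ^+ n.+1.
have Cn0 : 0 < Cn by rewrite exprn_gt0.
exists (2 * Cn * pi); first by rewrite !mulr_gt0// pi_gt0.
move=> s x s0 sx; have sn0 : 0 < s ^+ n.+1 by rewrite exprn_gt0.
rewrite mulrAC.
apply: (@resolvent_le_atan_density n.+3 l (2 * s) s) => //.
- by rewrite divr_ge0 ?mulr_ge0// ltW.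
- by rewrite mulr_ge0// ltW.
move=> t t0; apply: (le_trans (ler_heat_base _ _ _ _)) => //.
have st0 : 0 < Num.sqrt t by rewrite sqrtr_gt0.
have e1 : expR (- l * t) <= 1 by rewrite expR_le1; nra.
have tE := sqr_sqrtr (ltW t0).
move: st0 tE; set r := Num.sqrt t => r0 tE.
rewrite (@le_trans _ _ ((r ^+ n.+3)^-1 * expR (- ((2 * s) ^+ 2 / (2 * t)))))//.
  rewrite ler_wpM2r ?expR_ge0// ler_piMl// invr_ge0 exprn_ge0// ltW//.
pose z := s / r.
have z0 : 0 < z by rewrite divr_gt0.
have -> : (2 * s) ^+ 2 / (2 * t) = 2 * z ^+ 2.
  by rewrite /z -tE; field; lra.
have zz0 : 0 < 1 + z ^+ 2 by rewrite addr_gt0// exprn_gt0.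
have -> : 2 * Cn / s ^+ n.+1 * atan_density s t = (r ^+ n.+3)^-1 * (Cn / (z ^+ n * (1 + z ^+ 2))).
  rewrite /atan_density -/r -tE.
  have -> : s = z * r by rewrite /z; field; lra.
  have p0 : 0 < z ^+ n := exprn_gt0 n z0.
  have p1 : 0 < r ^+ n := exprn_gt0 n r0.
  rewrite exprMn (exprS z n) (exprS r n).
  rewrite (_ : r ^+ n.+3 = r * r * r * r ^+ n); last by rewrite !exprS; ring.
  rewrite (_ : (z * r) ^+ 2 + r ^+ 2 = r ^+ 2 * (1 + z ^+ 2)); last by ring.
  move: p0 p1 zz0.
  set a := z ^+ n; set b := r ^+ n; set w := 1 + _ => p0 p1 p2.
  by field; rewrite !gt_eqF.
rewrite ler_wpM2l//; first by rewrite invr_ge0 exprn_ge0// ltW.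
rewrite ler_pdivlMr; last by rewrite mulr_gt0// exprn_gt0.
have h := exprD1_expRN_le n.+1 (sqr_ge0 z).
apply: le_trans h; rewrite [_ ^+ n.+1]exprSr mulrC; apply: ler_pM.
- by rewrite mulr_ge0 ?exprn_ge0// ltW.
- exact: expR_ge0.
- rewrite ler_wpM2r ?(ltW zz0)// lerXn2r ?nnegrE ?(ltW z0) ?(ltW zz0)//.
  by have := sqr_ge0 (z - 1 / 2); nra.
- by rewrite ler_expR; have := sqr_ge0 z; lra.
Qed.

Lemma is_derive_ln_addl (c t : R) : 0 < c + t ->
  is_derive t 1 (fun t => ln (c + t)) (c + t)^-1.
Proof.
move=> ct0; have d1 : is_derive t 1 (fun t => c + t) 1.
  by apply: is_derive_eq; rewrite add0r mulr1.
rewrite -[X in is_derive _ _ _ X]mulr1.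
exact: (@is_derive1_comp _ (@ln R) (fun t => c + t) t _ _ (is_derive1_ln ct0) d1).
Qed.

(** The majorant [1 / (s ^ 2 + t) - 1 / (2 + t)], whose primitive is a difference of
    logarithms, accounts for the logarithmic singularity. *)
Lemma resolvent_radial2 l : 0 < l ->
  exists2 C, 0 < C & forall s (x : 'rV[R]_2), 0 < s < 1 -> 2 * s <= enorm x ->
    (resolvent l x <= (C * log_plus (1 / s))%:E)%E.
Proof.
move=> l0; have l10 : 0 < l^-1 by rewrite invr_gt0.
have C0 : 0 < 2 + l^-1 by rewrite addr_gt0.
exists (3 * (2 + l^-1)); first by rewrite mulr_gt0.
move=> s x /andP[s0 s1] sx.
have ss0 : 0 < s ^+ 2 by rewrite exprn_gt0.
have ss1 : s ^+ 2 < 1 by rewrite expr_lt1// ltW.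
pose f t := (2 + l^-1) * ((s ^+ 2 + t)^-1 - (2 + t)^-1).
pose G (t : R) := (2 + l^-1) * (ln (s ^+ 2 + t) - ln (2 + t)).
apply: (@resolvent_le _ _ l (2 * s) x f G _ _ sx).
- by rewrite mulr_ge0// ltW.
- apply: measurable_funM => //; apply: measurable_funB; apply: measurable_invr; exact: measurable_funD.
- move=> t t0; apply: (le_trans (ler_heat_base _ _ _ _)) => //.
  rewrite (sqr_sqrtr (ltW t0)).
  have h1 : expR (- l * t) <= (2 + l^-1) / (2 + t).
    by rewrite ler_pdivlMr ?addr_gt0// expRN_mul_le// ltW.
  have h2 : t^-1 * expR (- ((2 * s) ^+ 2 / (2 * t))) <= (s ^+ 2 + t)^-1.
    rewrite expRN -invfM lef_pV2 ?posrE ?mulr_gt0 ?addr_gt0 ?expR_gt0//.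
    have := expR_ge1Dx ((2 * s) ^+ 2 / (2 * t)).
    have -> : (2 * s) ^+ 2 / (2 * t) = 2 * s ^+ 2 / t by field; lra.
    move=> h; have := ler_wpM2l (ltW t0) h.
    have -> : t * (1 + 2 * s ^+ 2 / t) = t + 2 * s ^+ 2 by field; lra.
    lra.
  rewrite -mulrA (le_trans (ler_pM (expR_ge0 _) _ h1 h2))//.
    by rewrite mulr_ge0 ?expR_ge0// invr_ge0 ltW.
  rewrite /f -mulrA ler_wpM2l ?(ltW C0)//.
  have -> : (s ^+ 2 + t)^-1 - (2 + t)^-1 = (2 - s ^+ 2) * ((2 + t)^-1 * (s ^+ 2 + t)^-1).
    by field; lra.
  by rewrite ler_peMl ?mulr_ge0 ?invr_ge0 ?addr_ge0 ?(ltW t0) ?(ltW ss0)//; lra.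
- move=> t t0; apply: cvgM; first exact: cvg_cst.
  apply: cvgB; apply: cvgV; rewrite ?gt_eqF ?addr_gt0//; apply: cvgD; (exact: cvg_cst || exact: cvg_id).
- move=> t t0.
  have p1 : 0 < s ^+ 2 + t by rewrite addr_gt0.
  have p2 : 0 < 2 + t by rewrite addr_gt0.
  have e1 := is_derive_ln_addl p1; have e2 := is_derive_ln_addl p2.
  by apply: is_derive_eq; rewrite /GRing.scale/= /f; ring.
- move=> a b a0 ab; rewrite -mulrBr [leRHS]mulrAC [leRHS]mulrC ler_wpM2l ?(ltW C0)//.
  have b0 := lt_le_trans a0 ab.
  have hb : ln (s ^+ 2 + b) <= ln (2 + b).
    by rewrite ler_ln ?posrE ?addr_gt0//; lra.
  have ha : ln (2 + a) - ln (s ^+ 2 + a) <= ln (2 / s ^+ 2).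
    rewrite -ln_div ?posrE ?addr_gt0// ler_ln ?posrE ?divr_gt0 ?addr_gt0//.
    rewrite ler_pdivrMr ?addr_gt0// mulrAC ler_pdivlMr//; nra.
  have hl : ln (2 / s ^+ 2) <= 1 + 2 * ln (1 / s).
    rewrite ln_div ?posrE// ln_div ?posrE// ln1 lnXn// mulr2n.
    have : ln 2 <= (1 : R).
      by rewrite -[leRHS](expRK 1) ler_ln ?posrE ?expR_gt0//; have := expR_ge1Dx (1 : R); lra.
    lra.
  have p1 : 1 <= log_plus (1 / s).
    rewrite /log_plus -[leLHS](expRK 1) ler_ln ?posrE ?expR_gt0//.
      by rewrite le_max lexx orbT.
    by rewrite lt_max expR_gt0 orbT.
  have p2 : ln (1 / s) <= log_plus (1 / s).
    rewrite /log_plus ler_ln ?posrE ?divr_gt0//.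
      by rewrite le_max lexx.
    by rewrite lt_max expR_gt0 orbT.
  lra.
Qed.

(** Up to constants, the weight [omega] in the definition of the class is the growth of
    the resolvent near the origin, multiplied by the area [s ^ (d - 1)] of a sphere. *)
Lemma resolvent_radial d l : (0 < d)%N -> 0 < l ->
  exists2 C, 0 < C & forall s (x : 'rV[R]_d), 0 < s < 1 -> 2 * s <= enorm x ->
    (resolvent l x <= (C * omega d s / s ^+ d.-1)%:E)%E.
Proof.
case: d => [//|[|[|n]]] _ l0 /=.
- have [C C0 h] := resolvent_radial1 l0; exists C => // s x _ _.
  by rewrite mulr1 expr0 divr1.
- have [C C0 h] := resolvent_radial2 l0; exists C => // s x s01 sx.
  rewrite expr1; have s0 : s != 0 by case/andP: s01 => s0 _; rewrite gt_eqF.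
  by rewrite (mulrC s) mulrA mulfK// h.
- have [C C0 h] := resolvent_radial3 n l0; exists C => // s x /andP[s0 _] sx.
  by rewrite [s ^+ _]exprS invfM mulrA mulfK ?gt_eqF// h.
Qed.

End radial_bound.

(** * Autocorrelation and energy *)

Section autocorrelation.
Local Open Scope ereal_scope.
Context {R : realType} {d : nat}.
Implicit Types (u h : 'rV[R]_d -> R) (x y : 'rV[R]_d) (l p s : R).
Local Notation mu := (@lebesgue_rV R d).

Definition autocorr u x : \bar R := \int[mu]_y (u y * u (y - x)%R)%:E.

Definition energy l u : \bar R := \int[mu]_x (resolvent l x * autocorr u x).

Lemma ge0_integral_rV_shift x (f : 'rV[R]_d -> \bar R) :
  measurable_fun setT f -> (forall y, 0 <= f y) ->
  \int[mu]_y f (y - x)%R = \int[mu]_y f y.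
Proof.
move=> mf f0.
have mN : measurable_fun setT (fun y : 'rV[R]_d => f (0 - y)%R).
  by apply: (measurableT_comp mf); exact: measurable_rVB.
rewrite -(ge0_integral_rV_reflect 0%R mf f0) -(ge0_integral_rV_reflect x mN)//.
by apply: eq_integral => y _; rewrite sub0r opprB.
Qed.

Lemma measurable_shift x u : measurable_fun setT u ->
  measurable_fun setT (fun y => u (y - x)%R).
Proof. by move=> mu_; apply: (measurableT_comp mu_); exact: measurable_rVB. Qed.

Lemma Lnorm_fin d' (T : measurableType d') (nu : {measure set T -> \bar R}) p (f : T -> \bar R) :
  'N[nu]_p%:E[f] = (\int[nu]_x `|f x| `^ p) `^ p^-1.
Proof. by rewrite unlock. Qed.

Lemma Lnorm_shift p x u : measurable_fun setT u ->
  'N[mu]_p%:E[EFin \o (fun y => u (y - x)%R)] = 'N[mu]_p%:E[EFin \o u].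
Proof.
move=> mu_; rewrite !Lnorm_fin.
apply: (congr1 (fun z => z `^ p^-1)).
rewrite -[RHS](@ge0_integral_rV_shift x)//.
  apply: (measurableT_comp (@measurable_poweR R p)).
  by apply: measurableT_comp => //; exact/measurable_EFinP.
by move=> y; exact: poweR_ge0.
Qed.

Lemma autocorr_ge0 u x : (forall y, (0 <= u y)%R) -> 0 <= autocorr u x.
Proof. by move=> u0; apply: integral_ge0 => y _; rewrite lee_fin mulr_ge0. Qed.

Lemma measurable_autocorr2 u : measurable_fun setT u ->
  measurable_fun setT (fun z : 'rV[R]_d * 'rV[R]_d => (u z.2 * u (z.2 - z.1)%R)%:E).
Proof.
move=> mu_; apply/measurable_EFinP; apply: measurable_funM.
  exact: measurableT_comp.
by apply: (measurableT_comp mu_); exact: measurable_rVB.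
Qed.

Lemma measurable_autocorr u : measurable_fun setT u -> (forall y, (0 <= u y)%R) ->
  measurable_fun setT (autocorr u).
Proof.
move=> mu_ u0; apply: (measurable_fun_fubini_rV (measurable_autocorr2 mu_)).
by move=> z; rewrite lee_fin mulr_ge0.
Qed.

(** The integrand in the definition of [class_G], without its weight. *)
Definition hoelder_bound p h s : \bar R :=
  Lp_norm p h (eball s) * Lp_norm (p / (p - 1)) h (~` eball s)
  + Lp_norm 2 h (~` eball s) ^+ 2.

Lemma hoelder_bound_ge0 p h s : 0 <= hoelder_bound p h s.
Proof. by rewrite adde_ge0 ?sqre_ge0// mule_ge0 ?Lnorm_ge0. Qed.

Lemma measurable_restr h D : measurable_fun setT h -> measurable D ->
  measurable_fun setT (h \* \1_D)%R.
Proof. by move=> mh mD; apply: measurable_funM => //; exact: measurable_indic. Qed.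

Lemma hoelder_shift p q h x A B : measurable_fun setT h -> measurable A -> measurable B ->
  (0 < p)%R -> (0 < q)%R -> (p^-1 + q^-1 = 1)%R ->
  \int[mu]_y (`|h y * \1_A y| * `|h (y - x)%R * \1_B (y - x)%R|)%:E <=
  Lp_norm p h A * Lp_norm q h B.
Proof.
move=> mh mA mB p0 q0 pq.
have mhB := measurable_restr mh mB.
have := hoelder mu (measurable_restr mh mA) (measurable_shift x mhB) p0 q0 pq.
rewrite Lnorm1 (Lnorm_shift _ _ mhB); apply: le_trans.
by rewrite le_eqVlt; apply/orP; left; apply/eqP; apply: eq_integral => y _; rewrite /= -normrM.
Qed.

(** At least one of [y] and [y - x] is outside the ball of radius [s]; Hoelder applies to
    each of the three remaining cases, with exponents [p] and [q], [q] and [p], or [2]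
    and [2]. *)
Lemma autocorr_le_hoelder_bound p h x s : measurable_fun setT h -> (1 < p)%R ->
  (0 <= s)%R -> (2 * s <= enorm x)%R ->
  autocorr (fun y => `|h y|%R) x <= 2%:E * hoelder_bound p h s.
Proof.
move=> mh p1 s0 sx.
pose B : set 'rV[R]_d := eball s; pose C := ~` B; pose q := (p / (p - 1))%R.
have mB : measurable B by exact: measurable_eball.
have mC : measurable C by exact: measurableC.
have p0 : (0 < p)%R by rewrite (lt_trans _ p1).
have p10 : (0 < p - 1)%R by rewrite subr_gt0.
have q0 : (0 < q)%R by rewrite divr_gt0.
have pq : (p^-1 + q^-1 = 1)%R by rewrite /q invf_div; field; lra.
have qp : (q^-1 + p^-1 = 1)%R by rewrite addrC.
have h22 : ((2:R)^-1 + 2^-1 = 1)%R by field.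
pose F D E y := (`|h y * \1_D y| * `|h (y - x)%R * \1_E (y - x)%R|)%:E.
have mF D E : measurable D -> measurable E -> measurable_fun setT (F D E).
  move=> mD mE; apply/measurable_EFinP; apply: measurable_funM; apply: measurableT_comp => //.
    exact: measurable_restr.
  exact: (measurable_shift x (measurable_restr mh mE)).
have F0 D E y : 0 <= F D E y by rewrite lee_fin mulr_ge0.
apply: (@le_trans _ _ (\int[mu]_y (F B C y + F C B y + F C C y))).
  apply: ge0_le_integral => //.
  - apply/measurable_EFinP; apply: measurable_funM; apply: measurableT_comp => //.
    exact: measurable_shift.
  - by do !apply: emeasurable_funD; exact: mF.
  - move=> y _; rewrite /F -!EFinD lee_fin !indicE !normrM.
    set a := `|h y|%R; set b := `|h (y - x)|%R.
    have ab0 : (0 <= a * b)%R by rewrite mulr_ge0 ?normr_ge0.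
    have hB : y \in B -> (y - x)%R \in C.
      by rewrite !inE; exact: eballB.
    have cB z : (z \in C) = (z \notin B) by rewrite /C in_setC.
    rewrite !cB in hB *.
    case: (y \in B) hB => /=; case: ((y - x)%R \in B) => /= hB;
      rewrite ?normr1 ?normr0 ?mulr1 ?mulr0 ?mul0r ?addr0 ?add0r//.
    by have := hB isT.
rewrite ge0_integralD//; last first.
- exact: mF.
- by apply: emeasurable_funD; exact: mF.
- by move=> y _; rewrite adde_ge0.
rewrite ge0_integralD//; last first.
- exact: mF.
- exact: mF.
have h1 := hoelder_shift x mh mB mC p0 q0 pq.
have h2 := hoelder_shift x mh mC mB q0 p0 qp.
have h3 := hoelder_shift x mh mC mC (ltr0n _ 2) (ltr0n _ 2) h22.
apply: (le_trans (leeD (leeD h1 h2) h3)).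
rewrite /hoelder_bound -/B -/C -/q [X in _ + X + _]muleC -expe2.
set P := _ * _; set Q := _ ^+ 2.
have P0 : 0 <= P by rewrite mule_ge0 ?Lnorm_ge0.
have Q0 : 0 <= Q by rewrite sqre_ge0.
rewrite ge0_muleDr// leeD//.
  by rewrite (_ : 2%:E = 1 + 1)// ge0_muleDl// mul1e.
by rewrite -{1}[Q]mul1e lee_wpmul2r// lee_fin ler1n.
Qed.

End autocorrelation.

Section energy_finite.
Local Open Scope ereal_scope.
Context {R : realType} {d : nat}.
Implicit Types (u h : 'rV[R]_d -> R) (x y : 'rV[R]_d) (l p s : R).
Local Notation mu := (@lebesgue_rV R d).
Local Notation leb := (@lebesgue_measure R).

Lemma measurable_Lnorm_param d' (T : measurableType d') p (k : T * 'rV[R]_d -> R) :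
  measurable_fun setT k ->
  measurable_fun setT (fun t => 'N[mu]_p%:E[EFin \o (fun y => k (t, y))]).
Proof.
move=> mk; under eq_fun do rewrite Lnorm_fin.
apply: (measurableT_comp (@measurable_poweR R p^-1)).
apply: (@measurable_fun_fubini_rV R d' T d (fun z => `|(k z)%:E| `^ p)).
  apply: (measurableT_comp (@measurable_poweR R p)).
  by apply: measurableT_comp => //; exact/measurable_EFinP.
by move=> z; exact: poweR_ge0.
Qed.

Lemma measurable_lt_enorm : measurable_fun setT
  (fun z : measurableTypeR R * 'rV[R]_d => enorm z.2 < z.1)%R.
Proof.
by apply: measurable_fun_ltr => //; exact: measurable_enorm.
Qed.

Lemma measurable_hoelder_bound p h : measurable_fun setT h ->
  measurable_fun setT (fun s : measurableTypeR R => hoelder_bound p h s).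
Proof.
move=> mh.
have B1 r : measurable_fun setT (fun s : measurableTypeR R => Lp_norm r h (eball s)).
  rewrite (_ : (fun _ => _) = (fun s : measurableTypeR R =>
    'N[mu]_r%:E[EFin \o (fun y => h y * (if enorm y < s then 1 else 0))])%R).
    apply: (measurable_Lnorm_param r (k := fun z : measurableTypeR R * 'rV[R]_d => (h z.2 * (if enorm z.2 < z.1 then 1 else 0))%R)).
    apply: measurable_funM; first exact: measurableT_comp.
    by apply: measurable_fun_ifT => //; exact: measurable_lt_enorm.
  apply/funext => s; congr Lnorm; apply/funext => y /=.
  rewrite indicE; congr (_ * _)%:E; case: ifPn => ys; first by rewrite mem_set.
  by rewrite memNset// /eball/=; apply/negP.
have B2 r : measurable_fun setT (fun s : measurableTypeR R => Lp_norm r h (~` eball s)).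
  rewrite (_ : (fun _ => _) = (fun s : measurableTypeR R =>
    'N[mu]_r%:E[EFin \o (fun y => h y * (if enorm y < s then 0 else 1))])%R).
    apply: (measurable_Lnorm_param r (k := fun z : measurableTypeR R * 'rV[R]_d => (h z.2 * (if enorm z.2 < z.1 then 0 else 1))%R)).
    apply: measurable_funM; first exact: measurableT_comp.
    by apply: measurable_fun_ifT => //; exact: measurable_lt_enorm.
  apply/funext => s; congr Lnorm; apply/funext => y /=.
  rewrite indicE; congr (_ * _)%:E; case: ifPn => ys.
    by rewrite memNset//= => /(_ ys).
  by rewrite mem_set// /eball/=; apply/negP.
apply: emeasurable_funD; first exact: emeasurable_funM.
by under eq_fun do rewrite expe2; exact: emeasurable_funM.
Qed.

Lemma log_plus_gt0 (z : R) : (0 < log_plus z)%R.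
Proof.
rewrite /log_plus (@lt_le_trans _ _ 1%R)// -[leLHS](expRK 1%R) ler_ln ?posrE ?expR_gt0//.
  by rewrite le_max lexx orbT.
by rewrite lt_max expR_gt0 orbT.
Qed.

Lemma omega_gt0 n s : (0 < s)%R -> (0 < omega n s)%R.
Proof.
case: n => [|[|[|n]]] s0 //=.
by rewrite mulr_gt0// log_plus_gt0.
Qed.

Lemma measurable_omega n : measurable_fun setT (@omega R n).
Proof.
case: n => [|[|[|n]]]; [exact: measurable_id|exact: measurable_cst| |exact: measurable_id].
  rewrite (_ : omega 2 = fun r : R => r * log_plus (1 / r))%R//.
  apply: measurable_funM => //.
  apply: (measurableT_comp (@measurable_ln R)).
  apply: measurable_maxr => //; apply: measurable_funM => //.
  exact: measurable_invr.
Qed.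

(** If it were infinite for every [s], so would be the integral, as [omega] is
    positive. *)
Lemma hoelder_bound_fin p h :
  \int[leb]_(r in `]0%R, 1%R[) (hoelder_bound p h r * (omega d r)%:E) < +oo ->
  exists2 s, (0 < s < 1)%R & hoelder_bound p h s < +oo.
Proof.
move=> Goo; apply: contrapT => /forall2NP H.
suff : \int[leb]_(r in `]0%R, 1%R[) (hoelder_bound p h r * (omega d r)%:E) = +oo.
  by move=> E; rewrite E ltxx in Goo.
rewrite (@eq_integral _ _ _ _ _ (cst +oo)).
  have L : lebesgue_measure (`]0%R, 1%R[%classic : set R) = 1.
    by rewrite lebesgue_measure_itv/= lte01 oppr0 adde0.
  by rewrite integral_cst//= L mule1.
move=> r; rewrite inE/= in_itv/= => /andP[r0 r1].
have [/negP|/negP] := H r; first by rewrite r0 r1.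
rewrite -leNgt leye_eq => /eqP ->.
by rewrite gt0_mulye// lte_fin omega_gt0.
Qed.

Lemma lebesgue_rV_cube s : (0 <= s)%R ->
  mu [set x : 'rV[R]_d | forall i, `[(- s)%R, s]%classic (x ord0 i)] = ((2 * s) ^+ d)%:E.
Proof.
move=> s0; rewrite (lebesgue_rV_box (A := fun=> `[(- s)%R, s]%classic))//.
rewrite big_const cardE size_enum_ord.
have -> : lebesgue_measure (`[(- s)%R, s]%classic : set R) = (2 * s)%:E.
  rewrite lebesgue_measure_itv/= lte_fin; case: ltP => [_|ss].
    by rewrite -EFinD; congr EFin; lra.
  by rewrite (_ : s = 0%R) ?mulr0//; lra.
by elim: d => [//|n IH]; rewrite iterS IH exprS EFinM.
Qed.

Lemma measurable_cube s :
  measurable [set x : 'rV[R]_d | forall i, `[(- s)%R, s]%classic (x ord0 i)].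
Proof. by apply: (measurable_rV_box (A := fun=> `[(- s)%R, s]%classic)). Qed.

Lemma ae_enorm_gt0 : (0 < d)%N -> {ae mu, forall x, (0 < enorm x)%R}.
Proof.
(* The origin is a cube of half-side [0], whose volume is [0 ^ d]. *)
move=> d0; exists [set x : 'rV[R]_d | forall i, `[(- 0)%R, 0%R]%classic (x ord0 i)]; split.
- exact: measurable_cube.
- by rewrite lebesgue_rV_cube// mulr0 expr0n/= gtn_eqF.
- move=> x /= /negP; rewrite -leNgt => x0 i; rewrite oppr0 in_itv/=.
  have := le_trans (ler_coord_enorm x i) x0; rewrite normr_le0 => /eqP ->.
  by rewrite lexx.
Qed.

Variables (p l : R) (h : 'rV[R]_d -> R).
Hypotheses (d_gt0 : (0 < d)%N) (mh : measurable_fun setT h).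
Hypotheses (p1 : (1 < p)%R) (l0 : (0 < l)%R).

Let g : 'rV[R]_d -> R := fun y => `|h y|%R.
Let Phi := hoelder_bound p h.

(** The function of two variables to which Tonelli is applied. The [s] such that
    [2 * s <= enorm x <= 4 * s] form an interval of length [enorm x / 4]; averaging
    [2 * Phi s] over it gives the weight [8 / enorm x], which is at most [4 / s]. *)
Let kappa (z : 'rV[R]_d * measurableTypeR R) : \bar R :=
  (if [&& 0 < z.2, z.2 < 1, 2 * z.2 <= enorm z.1 & enorm z.1 <= 4 * z.2]%R then 1 else 0)%R%:E
  * ((4 / z.2)%:E * (resolvent l z.1 * Phi z.2)).

Let kappa_ge0 z : 0 <= kappa z.
Proof.
rewrite /kappa; case: ifPn => [/and4P[z0 _ _ _]|_]; last by rewrite mul0e.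
rewrite mule_ge0//; rewrite mule_ge0 ?lee_fin ?divr_ge0 ?(ltW z0)//.
by rewrite mule_ge0 ?resolvent_ge0 ?hoelder_bound_ge0.
Qed.

Let mkappa : measurable_fun setT kappa.
Proof.
have me : measurable_fun setT (fun z : 'rV[R]_d * measurableTypeR R => enorm z.1).
  exact: measurable_enorm.
have m2 : measurable_fun setT (fun z : 'rV[R]_d * measurableTypeR R => z.2 : R).
  exact: measurable_snd.
apply: emeasurable_funM.
  apply/measurable_EFinP; apply: measurable_fun_ifT => //.
  do !apply: measurable_and.
  - exact: measurable_fun_ltr.
  - exact: measurable_fun_ltr.
  - by apply: measurable_fun_ler => //; exact: measurable_funM.
  - by apply: measurable_fun_ler => //; exact: measurable_funM.
apply: emeasurable_funM.
  by apply/measurable_EFinP; apply: measurable_funM => //; exact: measurable_invr.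
apply: emeasurable_funM.
  exact: measurableT_comp (measurable_resolvent l) _.
exact: (measurableT_comp (measurable_hoelder_bound p mh)).
Qed.

Let mg : measurable_fun setT g.
Proof. exact: measurableT_comp. Qed.

Let F_ge0 x : 0 <= autocorr g x.
Proof. by apply: autocorr_ge0 => y; exact: normr_ge0. Qed.

(** The autocorrelation at [x] is at most [2 * Phi s] for every [s <= enorm x / 2], so
    that this bound may be averaged over [s] between [enorm x / 4] and [enorm x / 2]. *)
Let near_bound x : (0 < enorm x < 2)%R ->
  resolvent l x * autocorr g x <= \int[leb]_s kappa (x, s).
Proof.
move=> /andP[e0 e2]; set e := enorm x in e0 e2.
pose I : set R := `[(e / 4)%R, (e / 2)%R]%classic.
have mI : measurable I by exact: measurable_itv.
have LI : lebesgue_measure I = (e / 4)%:E.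
  rewrite /I lebesgue_measure_itv/= lte_fin ifT; last by lra.
  by rewrite -EFinD; congr EFin; lra.
have vF0 : 0 <= resolvent l x * autocorr g x.
  by rewrite mule_ge0// resolvent_ge0.
apply: (@le_trans _ _ (\int[leb]_(s in I) kappa (x, s))); last first.
  apply: ge0_subset_integral => //.
  exact: measurable_fun_pair2.
apply: (@le_trans _ _ (\int[leb]_(s in I) ((4 / e)%:E * (resolvent l x * autocorr g x)))).
  rewrite integral_cst//=; rewrite [lebesgue_measure _]LI muleAC -EFinM.
  by rewrite (_ : 4 / e * (e / 4) = 1)%R ?mul1e//; field; lra.
apply: ge0_le_integral => //.
- by move=> s _; rewrite mule_ge0// lee_fin divr_ge0// ltW.
- by apply: measurable_funTS; exact: measurable_fun_pair2.
move=> s; rewrite /I/= in_itv/= => /andP[s1 s2].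
rewrite /kappa/= -/e ifT; last by apply/and4P; split; lra.
rewrite mul1e muleCA [leRHS]muleCA lee_wpmul2l ?resolvent_ge0//.
have sF : autocorr g x <= 2%:E * Phi s.
  by apply: autocorr_le_hoelder_bound => //; rewrite -/e; lra.
apply: (@le_trans _ _ ((4 / e)%:E * (2%:E * Phi s))).
  by rewrite lee_wpmul2l// lee_fin divr_ge0// ltW.
rewrite muleA -EFinM lee_wpmul2r ?hoelder_bound_ge0// lee_fin.
rewrite mulrAC ler_pdivrMr// mulrAC ler_pdivlMr//; lra.
Qed.

(** The region [enorm x <= 4 * s] lies in a cube of volume [(8 * s) ^ d]; this cancels
    the factor [1 / s] of the average and the factor [1 / s ^ (d - 1)] of the bound on the
    resolvent. *)
Let kappa_integral C s :
  (forall s x, 0 < s < 1 -> 2 * s <= enorm x ->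
    (resolvent l x <= (C * omega d s / s ^+ d.-1)%:E)%E)%R -> (0 < C)%R ->
  \int[mu]_x kappa (x, s) <=
  (4 * C * 8 ^+ d)%:E * ((Phi s * (omega d s)%:E) * (\1_(`]0%R, 1%R[%classic : set R) s)%:E).
Proof.
move=> HC C0; rewrite indicE; case: (boolP (s \in _)) => [|sI]; last first.
  rewrite !mule0 integral0_eq// => x _; rewrite /kappa/= ifF ?mul0e//.
  apply/negP => /and4P[s0 s1 _ _]; move/negP : sI; apply.
  by rewrite inE/= in_itv/= s0 s1.
rewrite inE/= in_itv/= => /andP[s0 s1]; rewrite mule1.
pose Q := [set x : 'rV[R]_d | forall i, `[(- (4 * s))%R, (4 * s)%R]%classic (x ord0 i)].
have mQ : measurable Q by exact: measurable_cube.
have o0 := omega_gt0 d s0.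
pose k := ((4 / s) * (C * omega d s / s ^+ d.-1))%R.
have k0 : (0 <= k)%R by rewrite !mulr_ge0 ?invr_ge0 ?exprn_ge0// ltW.
have Phi0 : 0 <= Phi s by exact: hoelder_bound_ge0.
apply: (@le_trans _ _ (\int[mu]_x ((\1_Q x)%:E * (k%:E * Phi s)))).
  apply: ge0_le_integral => //.
  - exact: measurable_fun_pair1.
  - apply: emeasurable_funM => //; apply/measurable_EFinP; exact: measurable_indic.
  move=> x _; rewrite /kappa/= indicE.
  case: ifPn => [/and4P[_ _ xs sx]|_]; last first.
    by rewrite mul0e !mule_ge0// lee_fin.
  rewrite mem_set; last first.
    move=> i /=; rewrite in_itv/= -ler_norml.
    exact: le_trans (ler_coord_enorm _ _) sx.
  rewrite mul1e [true%:R%:E]/= mul1e muleA lee_wpmul2r//.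
  rewrite (_ : k%:E = (4 / s)%:E * (C * omega d s / s ^+ d.-1)%:E) ?EFinM// lee_wpmul2l//.
    by rewrite lee_fin divr_ge0// ltW.
  by apply: HC => //; rewrite s0 s1.
rewrite ge0_integralZr//; last 2 first.
- by apply/measurable_EFinP; exact: measurable_indic.
- by rewrite mule_ge0.
have s40 : (0 <= 4 * s)%R by rewrite mulr_ge0// ltW.
rewrite integral_indic// setIT [X in X * _ <= _](_ : _ = ((2 * (4 * s)) ^+ d)%:E); last first.
  exact: lebesgue_rV_cube.
rewrite muleA -EFinM.
rewrite [Phi s * _]muleC muleA -EFinM.
rewrite le_eqVlt; apply/orP; left; apply/eqP; congr (_%:E * _).
have -> : (2 * (4 * s) = 8 * s)%R by lra.
have sn0 : (s ^+ d.-1 != 0)%R by rewrite expf_neq0// gt_eqF.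
rewrite /k exprMn (_ : s ^+ d = s * s ^+ d.-1)%R; last by rewrite -exprS prednK.
by field; rewrite sn0 gt_eqF.
Qed.

(** Near the origin, Tonelli in the variables [x] and [s]; far from it, a single [s] and
    the integrability of the resolvent. *)
Lemma energy_lty :
  \int[leb]_(r in `]0%R, 1%R[) (Phi r * (omega d r)%:E) < +oo ->
  energy l g < +oo.
Proof.
move=> Goo.
have [s0 /andP[s00 s01] Phis0] := hoelder_bound_fin Goo.
have [C C0 HC] := resolvent_radial d_gt0 l0.
have mv := @measurable_resolvent R d l.
have mF : measurable_fun setT (autocorr g).
  by apply: measurable_autocorr => // y; exact: normr_ge0.
have mK : measurable_fun setT (fun x => \int[leb]_s kappa (x, s)).
  exact: (measurable_fun_fubini_tonelli_F (m2 := lebesgue_measure) kappa mkappa).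
have K0 x : 0 <= \int[leb]_s kappa (x, s) by exact: integral_ge0.
have F0 : 0 <= 2%:E * Phi s0 by rewrite mule_ge0// hoelder_bound_ge0.
apply: (@le_lt_trans _ _ (\int[mu]_x (\int[leb]_s kappa (x, s) + resolvent l x * (2%:E * Phi s0)))).
  apply: ae_ge0_le_integral => //.
  - by move=> x _; rewrite mule_ge0// resolvent_ge0.
  - exact: emeasurable_funM.
  - by move=> x _; rewrite adde_ge0// mule_ge0// resolvent_ge0.
  - by apply: emeasurable_funD => //; exact: emeasurable_funM.
  apply: filterS (ae_enorm_gt0 d_gt0) => x x0 _.
  have [x2|x2] := ltP (enorm x) 2%R.
    apply: (@le_trans _ _ (\int[leb]_s kappa (x, s))).
      by apply: near_bound; rewrite x0.
    by rewrite leeDl// mule_ge0// resolvent_ge0.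
  apply: (@le_trans _ _ (resolvent l x * (2%:E * Phi s0))); last by rewrite leeDr.
  rewrite lee_wpmul2l ?resolvent_ge0//; apply: autocorr_le_hoelder_bound => //; lra.
rewrite ge0_integralD//; last 2 first.
- by move=> x _; rewrite mule_ge0// resolvent_ge0.
- exact: emeasurable_funM.
rewrite lte_add_pinfty//; last first.
  rewrite ge0_integralZr//; last by move=> x _; exact: resolvent_ge0.
  rewrite lte_mul_pinfty//.
  - by apply: integral_ge0 => x _; exact: resolvent_ge0.
  - rewrite ge0_fin_numE; last by apply: integral_ge0 => x _; exact: resolvent_ge0.
    exact: le_lt_trans (integral_resolvent_le l0) (ltry _).
  - by rewrite lte_mul_pinfty.
rewrite (fubini_tonelli (m1 := mu) (m2 := lebesgue_measure) kappa mkappa kappa_ge0).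
have mP : measurable_fun setT (fun s : measurableTypeR R =>
    Phi s * (omega d s)%:E * (\1_(`]0%R, 1%R[%classic : set R) s)%:E).
  apply: emeasurable_funM.
    apply: emeasurable_funM; first exact: measurable_hoelder_bound.
    apply/measurable_EFinP; exact: measurable_omega.
  by apply/measurable_EFinP; exact: measurable_indic.
apply: (@le_lt_trans _ _ (\int[leb]_s ((4 * C * 8 ^+ d)%:E *
    ((Phi s * (omega d s)%:E) * (\1_(`]0%R, 1%R[%classic : set R) s)%:E)))).
  apply: ge0_le_integral => //.
  - by move=> s _; exact: integral_ge0.
  - exact: (measurable_fun_fubini_tonelli_G (m1 := mu) kappa mkappa).
  - exact: emeasurable_funM.
  - by move=> s _; exact: kappa_integral.
rewrite ge0_integralZl//.
- have cst0 : (0 <= 4 * C * 8 ^+ d)%R by rewrite !mulr_ge0 ?exprn_ge0// ltW.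
  rewrite lte_mul_pinfty ?lee_fin//.
  by apply: le_lt_trans Goo; rewrite [leRHS]integral_indic_mkcond.
- move=> s _; rewrite indicE; case: (boolP (s \in _)); rewrite ?mule0// inE/= in_itv/= => /andP[? _].
  by rewrite mule1 mule_ge0 ?hoelder_bound_ge0// lee_fin ltW// omega_gt0.
- by rewrite lee_fin !mulr_ge0 ?exprn_ge0// ltW.
Qed.

End energy_finite.

Section convolution_bound.
Local Open Scope ereal_scope.
Context {R : realType} {d : nat}.
Implicit Types (h : 'rV[R]_d -> R) (x y : 'rV[R]_d) (l p : R).
Local Notation mu := (@lebesgue_rV R d).

Lemma class_G_energy_lty p l h : (0 < d)%N -> (1 < p)%R -> (0 < l)%R ->
  class_G p h -> energy l (fun y => `|h y|%R) < +oo.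
Proof. by move=> d0 p1 l0 [[mh _] Goo]; exact: energy_lty Goo. Qed.

Lemma convolutionE h x :
  convolution h (reflection h) x = \int[mu]_y (h y * h (y - x)%R)%:E.
Proof. by apply: eq_integral => y _; rewrite /reflection opprB. Qed.

Lemma measurable_convolution h : measurable_fun setT h ->
  measurable_fun setT (convolution h (reflection h)).
Proof.
move=> mh; have mk := measurable_autocorr2 mh.
rewrite (_ : convolution _ _ = fun x =>
    \int[mu]_y ((fun z : 'rV[R]_d * 'rV[R]_d => (h z.2 * h (z.2 - z.1)%R)%:E)^\+ (x, y)) -
    \int[mu]_y ((fun z : 'rV[R]_d * 'rV[R]_d => (h z.2 * h (z.2 - z.1)%R)%:E)^\- (x, y))).
  by apply: emeasurable_funB; apply: measurable_fun_fubini_rV => //;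
    [exact: measurable_funepos|exact: measurable_funeneg].
apply/funext => x; rewrite convolutionE integralE.
by congr (_ - _); apply: eq_integral => y _; rewrite ?funeposE ?funenegE.
Qed.

Lemma abse_convolution_le h x : measurable_fun setT h ->
  `|convolution h (reflection h) x| <= autocorr (fun y => `|h y|%R) x.
Proof.
move=> mh; rewrite convolutionE; apply: le_trans (le_abse_integral _ _ _) _ => //.
  by apply/measurable_EFinP; apply: measurable_funM => //; exact: measurable_shift.
rewrite le_eqVlt; apply/orP; left; apply/eqP.
by apply: eq_integral => y _; rewrite /= normrM.
Qed.

Lemma resolvent_convolution_lty l p h : (0 < d)%N -> (1 < p)%R -> (0 < l)%R ->
  class_G p h ->
  \int[mu]_x (resolvent l x * `|convolution h (reflection h) x|) < +oo.
Proof.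
move=> d0 p1 l0 Gh; have [[mh _] _] := Gh.
apply: le_lt_trans (class_G_energy_lty d0 p1 l0 Gh).
apply: ge0_le_integral => //.
- by move=> x _; rewrite mule_ge0// resolvent_ge0.
- apply: emeasurable_funM; first exact: measurable_resolvent.
  by apply: measurableT_comp => //; exact: measurable_convolution.
- apply: emeasurable_funM; first exact: measurable_resolvent.
  by apply: measurable_autocorr => [|y]; [exact: measurableT_comp|exact: normr_ge0].
- by move=> x _; rewrite lee_wpmul2l ?resolvent_ge0// abse_convolution_le.
Qed.

End convolution_bound.

(** * The negative norm is bounded by the energy *)

Section lebesgue_pair.
Local Open Scope ereal_scope.
Context {R : realType} {d : nat}.
Local Notation mu := (@lebesgue_rV R d).
Local Notation V2 := ('rV[R]_d * 'rV[R]_d)%type.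

(** The product measure, under a name of its own that carries its
    sigma-finiteness, so that Tonelli applies to it again. *)
Definition lebesgue_pair : set V2 -> \bar R := mu \x mu.

HB.instance Definition _ := Measure.copy lebesgue_pair (mu \x mu).

Lemma sigma_finite_lebesgue_pair : sigma_finite setT lebesgue_pair.
Proof.
pose Q k := [set x : 'rV[R]_d | forall i, `[(- k%:R)%R, k%:R]%classic (x ord0 i)].
have mQ k : measurable (Q k) by exact: measurable_cube.
exists (fun k => Q k `*` Q k).
  apply/esym; rewrite -subTset => -[x y] _.
  pose k := Num.truncn (Num.max (enorm x) (enorm y)).
  have k_gt : (Num.max (enorm x) (enorm y) < k.+1%:R)%R by exact: truncnS_gt.
  move: k_gt; rewrite gt_max => /andP[xk yk].
  by exists k.+1 => //; split; exact: eball_sub_box.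
move=> k; split; first exact: measurableX.
rewrite /lebesgue_pair product_measure1E//.
have E : mu (Q k) = ((2 * k%:R) ^+ d)%:E by rewrite lebesgue_rV_cube.
rewrite (_ : _ * _ = ((2 * k%:R) ^+ d)%:E * ((2 * k%:R) ^+ d)%:E); last first.
  by congr (_ * _); exact: E.
by rewrite -EFinM ltry.
Qed.

HB.instance Definition _ := Measure_isSigmaFinite.Build _ _ _ lebesgue_pair
  sigma_finite_lebesgue_pair.

Lemma integral_lebesgue_pair (f : V2 -> \bar R) : measurable_fun setT f ->
  (forall z, 0 <= f z) ->
  \int[lebesgue_pair]_z f z = \int[mu]_x \int[mu]_y f (x, y).
Proof. exact: fubini_tonelli1. Qed.

Lemma integrable_pair_tensor (f g : 'rV[R]_d -> R) :
  mu.-integrable setT (EFin \o f) -> mu.-integrable setT (EFin \o g) ->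
  lebesgue_pair.-integrable setT (EFin \o (fun z => f z.1 * g z.2)%R) /\
  \int[lebesgue_pair]_z (f z.1 * g z.2)%:E = \int[mu]_x (f x)%:E * \int[mu]_y (g y)%:E.
Proof. exact: integrable_tensor. Qed.

End lebesgue_pair.

Section fourier_bound.
Local Open Scope ereal_scope.
Context {R : realType} {d : nat}.
Implicit Types (u phi : 'rV[R]_d -> R) (x y : 'rV[R]_d) (l s t : R).
Local Notation mu := (@lebesgue_rV R d).
Local Notation leb := (@lebesgue_measure R).
Local Notation mu2 := (@lebesgue_pair R d).
Local Notation V2 := ('rV[R]_d * 'rV[R]_d)%type.

(** The change of variables [x = y - z]. This symmetric form is the one that dominated
    convergence and the Fourier transform can handle. *)
Lemma energyE l u : measurable_fun setT u -> (forall y, (0 <= u y)%R) ->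
  energy l u = \int[mu2]_z (resolvent l (z.1 - z.2)%R * (u z.1 * u z.2)%:E).
Proof.
move=> mu_ u0.
have mv := @measurable_resolvent R d l.
have muu := measurable_autocorr2 mu_.
have mk : measurable_fun setT (fun z : V2 => resolvent l (z.1 - z.2)%R * (u z.1 * u z.2)%:E).
  apply: emeasurable_funM.
    by apply: (measurableT_comp mv); exact: measurable_rVB.
  by apply/measurable_EFinP; apply: measurable_funM; exact: measurableT_comp.
rewrite integral_lebesgue_pair//; last first.
  by move=> z; rewrite mule_ge0 ?resolvent_ge0// lee_fin mulr_ge0.
transitivity (\int[mu]_x \int[mu]_y (resolvent l x * (u y * u (y - x)%R)%:E)).
  apply: eq_integral => x _; rewrite -ge0_integralZl//.
  - exact: measurable_fun_pair2 muu.
  - by move=> y _; rewrite lee_fin mulr_ge0.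
  - exact: resolvent_ge0.
rewrite (fubini_tonelli (m1 := mu) (m2 := mu) (fun z : V2 => resolvent l z.1 * (u z.2 * u (z.2 - z.1)%R)%:E))/=; last first.
- by move=> z; rewrite mule_ge0 ?resolvent_ge0// lee_fin mulr_ge0.
- by apply: emeasurable_funM => //; exact: measurableT_comp.
apply: eq_integral => y _; rewrite /=.
have := @ge0_integral_rV_reflect R d y (fun z => resolvent l (y - z)%R * (u y * u z)%:E).
move=> <-.
- by apply: eq_integral => x _; rewrite subKr.
- exact: (measurable_fun_pair2 y mk).
- by move=> x; rewrite mule_ge0 ?resolvent_ge0// lee_fin mulr_ge0.
Qed.

Lemma dotrBr x y z : dotr x (y - z)%R = (dotr x y - dotr x z)%R.
Proof.
by rewrite /dotr -sumrB; apply: eq_bigr => i _; rewrite !mxE mulrBr.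
Qed.

Variable phi : 'rV[R]_d -> R.
Hypothesis iphi : mu.-integrable setT (EFin \o phi).

Let mphi : measurable_fun setT phi.
Proof. by apply/measurable_EFinP; exact: measurable_int iphi. Qed.

Definition fourier2 x : R := (Normc.normc (fourier phi x) ^+ 2)%R.

Let iphicos x : mu.-integrable setT (EFin \o (fun y => phi y * cos (dotr x y))%R).
Proof.
apply: integrable_bounded_mul => //; last by move=> y; exact: norm_cos_le1.
by apply: measurable_cos_comp; exact: measurable_dotr.
Qed.

Let iphisin x : mu.-integrable setT (EFin \o (fun y => phi y * sin (dotr x y))%R).
Proof.
apply: integrable_bounded_mul => //; last by move=> y; exact: norm_sin_le1.
by apply: measurable_sin_comp; exact: measurable_dotr.
Qed.

(** The product of the cosines and that of the sines add up to the cosine of the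
    difference. *)
Lemma fourier2E x : (fourier2 x)%:E =
  \int[mu2]_z (phi z.1 * phi z.2 * cos (dotr x (z.1 - z.2)%R))%:E.
Proof.
have [i1 E1] := integrable_pair_tensor (iphicos x) (iphicos x).
have [i2 E2] := integrable_pair_tensor (iphisin x) (iphisin x).
transitivity (\int[mu2]_z (((phi z.1 * cos (dotr x z.1)) * (phi z.2 * cos (dotr x z.2)))%:E +
  ((phi z.1 * sin (dotr x z.1)) * (phi z.2 * sin (dotr x z.2)))%:E)); last first.
  by apply: eq_integral => z _; rewrite -EFinD dotrBr cosB; congr EFin; ring.
rewrite integralD// E1 E2 /fourier2 /fourier /Normc.normc sqr_sqrtr ?addr_ge0 ?sqr_ge0//.
rewrite EFinD !expr2 !EFinM /Rintegral.
have fc := integrable_fin_num measurableT (iphicos x).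
have fs := integrable_fin_num measurableT (iphisin x).
by rewrite (fineK fc) (fineK fs).
Qed.

Lemma fourier2_ge0 x : (0 <= fourier2 x)%R.
Proof. by rewrite /fourier2 sqr_ge0. Qed.

Let iphi2 : mu2.-integrable setT (EFin \o (fun z : V2 => phi z.1 * phi z.2)%R).
Proof. by have [] := integrable_pair_tensor iphi iphi. Qed.

Let Psi t (w : 'rV[R]_d * V2) : R :=
  expR (- (t * dotr w.1 w.1 / 2)) * (phi w.2.1 * phi w.2.2) *
  cos (dotr w.1 (w.2.1 - w.2.2)%R).

Let iPsi t : (0 < t)%R -> (mu \x mu2).-integrable setT (EFin \o Psi t).
Proof.
move=> t0.
have ig : mu.-integrable setT (EFin \o (fun x : 'rV[R]_d => expR (- (t * dotr x x / 2))%R)).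
  have := @integrable_gauss_rV R d t 0 t0; apply: eq_integrable => // x _.
  by rewrite /= dotr0 cos0 mulr1.
have [i _] := integrable_tensor ig iphi2.
apply: integrable_bounded_mul i _ _.
- apply: measurable_cos_comp; apply: measurable_dotr => //.
  by apply: measurable_rVB; apply: measurableT_comp => //.
- by move=> w; exact: norm_cos_le1.
Qed.

Lemma measurable_fourier2 : measurable_fun setT fourier2.
Proof.
apply/measurable_EFinP; rewrite (_ : EFin \o _ = fun x => \int[mu2]_z
    ((fun w : 'rV[R]_d * V2 => (phi w.2.1 * phi w.2.2 * cos (dotr w.1 (w.2.1 - w.2.2)%R))%:E)^\+ (x, z)) -
  \int[mu2]_z
    ((fun w : 'rV[R]_d * V2 => (phi w.2.1 * phi w.2.2 * cos (dotr w.1 (w.2.1 - w.2.2)%R))%:E)^\- (x, z))); last first.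
  apply/funext => x; rewrite /= fourier2E integralE.
  by congr (_ - _); apply: eq_integral => z _; rewrite ?funeposE ?funenegE.
have mk : measurable_fun setT (fun w : 'rV[R]_d * V2 =>
    (phi w.2.1 * phi w.2.2 * cos (dotr w.1 (w.2.1 - w.2.2)%R))%:E).
  apply/measurable_EFinP; apply: measurable_funM.
    by apply: measurable_funM; apply: (measurableT_comp mphi); apply: measurableT_comp.
  apply: measurable_cos_comp; apply: measurable_dotr => //.
  by apply: measurable_rVB; apply: measurableT_comp => //.
apply: emeasurable_funB.
- apply: (measurable_fun_fubini_tonelli_F (m2 := mu2) _ (measurable_funepos mk)) => //.
- apply: (measurable_fun_fubini_tonelli_F (m2 := mu2) _ (measurable_funeneg mk)) => //.
Qed.

(** The Gaussian factor makes the triple integral absolutely convergent, so Fubini lets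
    the integral over the frequency be computed. *)
Lemma gauss_fourier_le t : (0 < t)%R ->
  \int[mu]_x (fourier2 x * expR (- (t * dotr x x / 2)))%:E <=
  \int[mu2]_z (`|phi z.1 * phi z.2| * (Num.sqrt (2 * pi / t) ^+ d *
    expR (- (dotr (z.1 - z.2) (z.1 - z.2) / (2 * t)))))%:E.
Proof.
move=> t0; pose w (z : V2) := (z.1 - z.2)%R.
have mw : measurable_fun setT w by exact: measurable_rVB.
have mdw : measurable_fun setT (fun z => dotr (w z) (w z)) by exact: measurable_dotr.
have mphi2 : measurable_fun setT (fun z : V2 => phi z.1 * phi z.2)%R.
  by apply: measurable_funM; apply: (measurableT_comp mphi).
have iphi2cos x : mu2.-integrable setT (EFin \o (fun z : V2 => phi z.1 * phi z.2 * cos (dotr x (w z)))%R).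
  apply: integrable_bounded_mul => //; last by move=> z; exact: norm_cos_le1.
  by apply: measurable_cos_comp; exact: measurable_dotr.
pose G z := (Num.sqrt (2 * pi / t) ^+ d * expR (- (dotr (w z) (w z) / (2 * t))))%R.
have G0 z : (0 <= G z)%R by rewrite mulr_ge0 ?exprn_ge0 ?sqrtr_ge0 ?expR_ge0.
have mG : measurable_fun setT G.
  apply: measurable_funM => //; apply: (measurableT_comp (@measurable_expR R)).
  by apply: (measurableT_comp (@oppr_measurable R _)); exact: measurable_funM.
have -> : \int[mu]_x (fourier2 x * expR (- (t * dotr x x / 2)))%:E =
    \int[mu2]_z (phi z.1 * phi z.2 * G z)%:E.
  transitivity (\int[mu]_x \int[mu2]_z (EFin \o Psi t) (x, z)).
    apply: eq_integral => x _; rewrite EFinM muleC fourier2E -integralZl//; last exact: iphi2cos.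
    by apply: eq_integral => z _; rewrite /Psi/= -EFinM; congr EFin; ring.
  apply: (etrans (Fubini (iPsi t0))); apply: eq_integral => z _.
  transitivity (\int[mu]_x ((phi z.1 * phi z.2)%:E *
      (expR (- (t * dotr x x / 2)) * cos (dotr x (w z)))%:E)).
    by apply: eq_integral => x _; rewrite /Psi/= -EFinM; congr EFin; rewrite /w; ring.
  rewrite integralZl//; last exact: integrable_gauss_rV.
  by rewrite integral_gauss_rV// -EFinM.
apply: (le_trans (lee_abs _)); apply: (le_trans (le_abse_integral _ _ _)) => //.
  by apply/measurable_EFinP; exact: measurable_funM.
rewrite le_eqVlt; apply/orP; left; apply/eqP; apply: eq_integral => z _.
by rewrite /= normrM (ger0_norm (G0 z)).
Qed.

Lemma heat_gaussE (e t : R) : (0 < t)%R ->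
  (2^-1 * expR (- 2^-1 * t) * (Num.sqrt (2 * pi / t) ^+ d * expR (- (e ^+ 2 / (2 * t)))) =
   2^-1 * (2 * pi) ^+ d * heat d 2^-1 e t)%R.
Proof.
move=> t0; have p0 := pi_gt0 R.
rewrite /heat powR_half_nat ?mulr_gt0//.
have -> : (Num.sqrt (2 * pi / t) = 2 * pi / Num.sqrt (2 * pi * t))%R.
  have -> : (2 * pi / t = (2 * pi) ^+ 2 / (2 * pi * t) :> R)%R by field; lra.
  rewrite sqrtrM ?sqr_ge0// sqrtr_sqr ger0_norm ?mulr_ge0 ?(ltW p0)//.
  by rewrite sqrtrV// mulr_ge0 ?mulr_ge0 ?(ltW p0) ?(ltW t0).
by rewrite expr_div_n; ring.
Qed.

(** [(1 + |x| ^ 2)^-1] is an average of Gaussians, whose Fourier transforms are heat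
    kernels, and the heat kernels average to the resolvent at [1 / 2]. *)
Lemma Hm1_le_energy :
  \int[mu]_x (fourier2 x / (1 + enorm x ^+ 2))%:E <=
  (2^-1 * (2 * pi) ^+ d)%:E * energy 2^-1 (fun y => `|phi y|%R).
Proof.
pose D : set R := `]0%R, +oo[%classic.
have mD : measurable_fun setT (fun t : measurableTypeR R => (\1_D t)%:E : \bar R).
  by apply/measurable_EFinP; apply: measurable_indic; exact: measurable_itv.
have D_gt0 t : t \in D -> (0 < t)%R by rewrite inE /D/= in_itv/= andbT.
pose c : R := (2^-1 * (2 * pi) ^+ d)%R.
have c0 : (0 <= c)%R by rewrite mulr_ge0 ?invr_ge0// exprn_ge0// mulr_ge0// pi_ge0.
pose k (z : 'rV[R]_d * measurableTypeR R) := (fourier2 z.1 * (2^-1 * expR (- 2^-1 * z.2)) *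
  expR (- (z.2 * dotr z.1 z.1 / 2)))%:E * (\1_D z.2)%:E.
pose K (z : measurableTypeR R * V2) := (`|phi z.2.1 * phi z.2.2| * c)%:E *
  ((heat d 2^-1 (enorm (z.2.1 - z.2.2)) z.1)%:E * (\1_D z.1)%:E).
have k0 z : 0 <= k z.
  rewrite mule_ge0// lee_fin; apply: mulr_ge0; last exact: expR_ge0.
  by apply: mulr_ge0; [exact: fourier2_ge0|rewrite mulr_ge0 ?expR_ge0 ?invr_ge0].
have K0 z : 0 <= K z by rewrite !mule_ge0// lee_fin ?heat_ge0// mulr_ge0.
have mk : measurable_fun setT k.
  apply: emeasurable_funM; last exact: (measurableT_comp mD).
  apply/measurable_EFinP; apply: measurable_funM; first apply: measurable_funM.
  - by apply: (measurableT_comp measurable_fourier2).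
  - apply: measurable_funM => //; apply: (measurableT_comp (@measurable_expR R)).
    exact: (measurableT_comp (mulrl_measurable _)).
  - apply: (measurableT_comp (@measurable_expR R)).
    apply: (measurableT_comp (@oppr_measurable R _)).
    by apply: measurable_funM => //; apply: measurable_funM => //; exact: measurable_dotr.
have mK : measurable_fun setT K.
  apply: emeasurable_funM.
    apply/measurable_EFinP; apply: measurable_funM => //; apply: measurableT_comp => //.
    by apply: measurable_funM; apply: (measurableT_comp mphi); apply: measurableT_comp.
  apply: emeasurable_funM; last exact: (measurableT_comp mD).
  apply/measurable_EFinP; apply: measurable_heat => //.
  by apply: measurable_enorm; apply: measurable_rVB; apply: measurableT_comp => //.
have -> : \int[mu]_x (fourier2 x / (1 + enorm x ^+ 2))%:E = \int[mu]_x \int[leb]_t k (x, t).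
  apply: eq_integral => x _.
  have l0 : (0 < (1 + enorm x ^+ 2) / 2)%R by rewrite divr_gt0// ltr_wpDr// sqr_ge0.
  transitivity (\int[leb]_t ((fourier2 x / 2)%:E * ((expR (- ((1 + enorm x ^+ 2) / 2) * t))%:E * (\1_D t)%:E))).
    rewrite ge0_integralZl//.
    - rewrite -integral_indic_mkcond integral_expRN// -EFinM; congr EFin.
      by field; rewrite gt_eqF//; lra.
    - apply: emeasurable_funM => //; apply/measurable_EFinP.
      apply: (measurableT_comp (@measurable_expR R)); exact: mulrl_measurable.
    - by rewrite lee_fin mulr_ge0//; exact: fourier2_ge0.
  apply: eq_integral => t _; rewrite /k -!EFinM; congr EFin.
  have -> : expR (- ((1 + enorm x ^+ 2) / 2) * t) =
      (expR (- 2^-1 * t) * expR (- (t * dotr x x / 2)))%R.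
    by rewrite -expRD sqr_enorm; congr expR; field.
  by move: (fourier2 x) (expR (- 2^-1 * t)) (expR (- (t * dotr x x / 2))) => *; ring.
rewrite (fubini_tonelli (m1 := mu) (m2 := lebesgue_measure) k mk k0).
have -> : (2^-1 * (2 * pi) ^+ d)%:E * energy 2^-1 (fun y => `|phi y|%R) =
    \int[leb]_t \int[mu2]_z K (t, z).
  rewrite (fubini_tonelli (m1 := lebesgue_measure) (m2 := mu2) K mK K0).
  rewrite energyE//; [|exact: measurableT_comp].
  rewrite -ge0_integralZl//; last 2 first.
  - apply: emeasurable_funM.
      apply: (measurableT_comp (measurable_resolvent _)); exact: measurable_rVB.
    apply/measurable_EFinP.
    by apply: measurable_funM; apply: measurableT_comp => //; exact: measurableT_comp.
  - by move=> z _; rewrite mule_ge0 ?resolvent_ge0// lee_fin mulr_ge0.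
  apply: eq_integral => z _; rewrite /K/= ge0_integralZl//.
  - by rewrite -resolventE normrM muleCA -EFinM muleC -/c; congr (_%:E * _); rewrite mulrC.
  - apply: emeasurable_funM => //; apply/measurable_EFinP; exact: measurable_heat.
  - by move=> t _; rewrite mule_ge0// lee_fin// heat_ge0.
  - by rewrite lee_fin mulr_ge0.
apply: ge0_le_integral => //.
- by move=> t _; apply: integral_ge0.
- exact: (measurable_fun_fubini_tonelli_G (m1 := mu) k mk k0).
- exact: (measurable_fun_fubini_tonelli_F (m2 := mu2) K mK K0).
move=> t _; rewrite /k /K/= indicE; case: (boolP (t \in D)) => [/D_gt0 t0|_]; last first.
  by rewrite !integral0_eq// => *; rewrite !mule0.
have e0 : (0 <= 2^-1 * expR (- 2^-1 * t) :> R)%R by rewrite mulr_ge0 ?invr_ge0 ?expR_ge0.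
apply: (@le_trans _ _ ((2^-1 * expR (- 2^-1 * t))%:E * \int[mu]_x (fourier2 x * expR (- (t * dotr x x / 2)))%:E)).
  rewrite -ge0_integralZl//.
  - rewrite le_eqVlt; apply/orP; left; apply/eqP; apply: eq_integral => x _.
    by rewrite mule1 -EFinM; congr EFin; ring.
  - apply/measurable_EFinP; apply: measurable_funM; first exact: measurable_fourier2.
    apply: (measurableT_comp (@measurable_expR R)); apply: (measurableT_comp (@oppr_measurable R _)).
    by do 2!apply: measurable_funM => //; exact: measurable_dotr.
  - by move=> x _; rewrite lee_fin mulr_ge0 ?fourier2_ge0 ?expR_ge0.
apply: (@le_trans _ _ ((2^-1 * expR (- 2^-1 * t))%:E * \int[mu2]_z (`|phi z.1 * phi z.2| * (Num.sqrt (2 * pi / t) ^+ d *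
    expR (- (dotr (z.1 - z.2) (z.1 - z.2) / (2 * t)))))%:E)).
  by rewrite lee_wpmul2l ?lee_fin// gauss_fourier_le.
rewrite -ge0_integralZl//.
- rewrite le_eqVlt; apply/orP; left; apply/eqP; apply: eq_integral => z _.
  rewrite mule1 -!EFinM; congr EFin; rewrite mulrCA -sqr_enorm heat_gaussE//.
  by rewrite -/c; ring.
- apply/measurable_EFinP; apply: measurable_funM.
    by apply: measurableT_comp => //; apply: measurable_funM; exact: (measurableT_comp mphi).
  apply: measurable_funM => //; apply: (measurableT_comp (@measurable_expR R)).
  apply: (measurableT_comp (@oppr_measurable R _)); apply: measurable_funM => //.
  by apply: measurable_dotr; exact: measurable_rVB.
Qed.

End fourier_bound.

(** * Rapidly decreasing functions *)

Section schwartz_linear.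
Context {R : realType} {d : nat}.
Implicit Types (f g : 'rV[R]_d -> R) (s : seq 'I_d).

Lemma schwartz_iter_linear f g (a : R) : schwartz f -> schwartz g -> forall s,
  iter_partial s (fun x => a * f x + g x) =
  fun x => a * iter_partial s f x + iter_partial s g x.
Proof.
move=> Sf Sg; elim=> [//|i s IH]; rewrite [LHS]/= -/(iter_partial s _) IH.
apply/funext => x.
have df : derivable (iter_partial s f) x (delta_mx ord0 i).
  by apply: diff_derivable; exact: (Sf s).1.
have dg : derivable (iter_partial s g) x (delta_mx ord0 i).
  by apply: diff_derivable; exact: (Sg s).1.
have da : derivable (a \*: iter_partial s f) x (delta_mx ord0 i) by exact: derivableZ.
by have := deriveD da dg; rewrite deriveZ.
Qed.

Lemma schwartz_linear f g (a : R) : schwartz f -> schwartz g ->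
  schwartz (fun x => a * f x + g x).
Proof.
move=> Sf Sg s; rewrite schwartz_iter_linear//; split=> [x|k].
  apply: differentiableD; last exact: (Sg s).1.
  by apply: differentiableZ; exact: (Sf s).1.
have [Cf hf] := (Sf s).2 k; have [Cg hg] := (Sg s).2 k.
exists (`|a| * Cf + Cg) => x.
have e0 : 0 <= (1 + enorm x) ^+ k by rewrite exprn_ge0// addr_ge0// enorm_ge0.
apply: (le_trans (ler_wpM2l e0 (ler_normD _ _))); rewrite mulrDr lerD// normrM mulrCA.
by rewrite ler_wpM2l.
Qed.

Lemma iter_partial0 s : iter_partial s (fun _ : 'rV[R]_d => 0) = (fun _ => 0).
Proof.
elim: s => [//|i s IH]; rewrite [LHS]/= -/(iter_partial s _) IH.
by apply/funext => x; rewrite (derive_cst (0:R)).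
Qed.

Lemma schwartz0 : schwartz (fun _ : 'rV[R]_d => 0).
Proof.
move=> s; rewrite iter_partial0; split=> [x|k]; first exact: differentiable_cst.
by exists 0 => x; rewrite normr0 mulr0.
Qed.

End schwartz_linear.

Section rVbump.
Context {R : realType}.

(** Functions of this form are stable under differentiation, with the same [q]. *)
Definition polyexp (p q : {poly R}) (t : R) : R := p.[t] * expR (- q.[t]).

Lemma is_derive_polyexp p q (t : R) :
  is_derive t 1 (polyexp p q) (polyexp (p^`() - p * q^`()) q t).
Proof.
rewrite /polyexp.
have dp := is_derive_poly p t; have dq := is_derive_poly q t.
have de := @is_derive1_comp _ expR (fun t => - q.[t]) t _ _ (is_derive_expR _) _.
apply: is_derive_eq.
rewrite hornerD hornerN hornerM /GRing.scale/=.
by move: p.[t] q^`().[t] p^`().[t] (expR _) => a b c e; ring.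
Qed.

Lemma ler_norm_horner (p : {poly R}) : exists C : R, forall t : R,
  `|p.[t]| <= C * (1 + `|t|) ^+ (size p).
Proof.
exists (\sum_(i < size p) `|p`_i|) => t; rewrite horner_coef mulr_suml.
apply: (le_trans (ler_norm_sum _ _ _)); apply: ler_sum => i _.
rewrite normrM ler_wpM2l// normrX.
have t1 : 1 <= 1 + `|t| by rewrite lerDl.
apply: (@le_trans _ _ ((1 + `|t|) ^+ i)).
  by rewrite lerXn2r ?nnegrE ?addr_ge0// lerDr.
by apply: ler_weXn2l => //; exact: ltnW.
Qed.

Definition rapid (q : {poly R}) := forall N : nat, exists C : R, forall t : R,
  (1 + `|t|) ^+ N * expR (- q.[t]) <= C.

Lemma rapid_polyexp p q : rapid q -> forall N : nat, exists C : R, forall t : R,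
  (1 + `|t|) ^+ N * `|polyexp p q t| <= C.
Proof.
move=> rq N; have [A hA] := ler_norm_horner p; have [C hC] := rq (N + size p)%N.
exists (`|A| * C) => t; rewrite /polyexp normrM (ger0_norm (expR_ge0 _)).
have t0 n : 0 <= (1 + `|t|) ^+ n by rewrite exprn_ge0// addr_ge0.
have h : `|p.[t]| <= `|A| * (1 + `|t|) ^+ (size p).
  by apply: (le_trans (hA t)); rewrite ler_wpM2r// ler_norm.
apply: (@le_trans _ _ (`|A| * ((1 + `|t|) ^+ (N + size p) * expR (- q.[t])))); last first.
  by rewrite ler_wpM2l.
rewrite exprD -!mulrA [leRHS]mulrCA ler_wpM2l// mulrA ler_wpM2r// expR_ge0//.
Qed.

Context {d : nat}.
Implicit Types (p q : 'I_d -> {poly R}) (x : 'rV[R]_d).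

Definition rVbump p q x : R := \prod_(i < d) polyexp (p i) (q i) (x ord0 i).

Lemma differentiable_polyexp_coord (a b : {poly R}) i x :
  differentiable (fun y : 'rV[R]_d => polyexp a b (y ord0 i)) x.
Proof.
apply: (@differentiable_comp _ _ _ _ (fun y : 'rV[R]_d => y ord0 i) (polyexp a b)).
  exact: differentiable_coord.
apply/derivable1_diffP; have := is_derive_polyexp a b (x ord0 i) => h.
exact: ex_derive.
Qed.

Lemma differentiable_rVbump p q x : differentiable (rVbump p q) x.
Proof.
rewrite /rVbump; elim: (index_enum _) => [|i s IH].
  by under eq_fun do rewrite big_nil; exact: differentiable_cst.
under eq_fun do rewrite big_cons.
apply: differentiableM IH; exact: differentiable_polyexp_coord.
Qed.

(** The polynomial factors of the derivative along the coordinate [i]: only one of them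
    changes. *)
Definition rVbump_partial p q (i : 'I_d) : 'I_d -> {poly R} :=
  fun j => if j == i then (p i)^`() - p i * (q i)^`() else p j.

Lemma derive_rVbump p q i x :
  'D_(delta_mx ord0 i) (rVbump p q) x = rVbump (rVbump_partial p q i) q x.
Proof.
pose C := \prod_(j < d | j != i) polyexp (p j) (q j) (x ord0 j).
have dpi := is_derive_polyexp (p i) (q i) (x ord0 i).
have -> : rVbump (rVbump_partial p q i) q x =
    C * 'D_1 (polyexp (p i) (q i)) (x ord0 i).
  rewrite (@derive_val _ _ _ _ _ _ _ dpi) /rVbump (bigD1 i)//= /rVbump_partial eqxx mulrC.
  by congr (_ * _); apply: eq_bigr => j /negPf ->.
rewrite /derive.
have E (h : R) : h^-1 *: ((rVbump p q \o shift x) (h *: delta_mx ord0 i) - rVbump p q x) =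
  C *: (h^-1 *: ((polyexp (p i) (q i) \o shift (x ord0 i)) (h *: 1) - polyexp (p i) (q i) (x ord0 i))).
  rewrite /= /rVbump (bigD1 i)//= [in X in _ - X](bigD1 i)//=.
  have -> : \prod_(j < d | j != i) polyexp (p j) (q j) ((h *: delta_mx ord0 i + x) ord0 j) = C.
    by apply: eq_bigr => j ji; rewrite !mxE eqxx/= (negPf ji) mulr0 add0r.
  by rewrite -/C !mxE !eqxx/= /GRing.scale/=; ring.
under eq_fun do rewrite E.
apply: cvg_lim => //; apply: cvgZr.
exact: (@ex_derive _ _ _ _ _ _ _ dpi).
Qed.

Lemma iter_partial_rVbump p q s : exists p', iter_partial s (rVbump p q) = rVbump p' q.
Proof.
elim: s => [|i s [p' IH]]; first by exists p.
exists (rVbump_partial p' q i); rewrite [LHS]/= -/(iter_partial s _) IH.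
by apply/funext => x; exact: derive_rVbump.
Qed.

Lemma prodr1D_ge (a : 'I_d -> R) : (forall i, 0 <= a i) ->
  1 + \sum_(i < d) a i <= \prod_(i < d) (1 + a i).
Proof.
move=> a0; pose P (u v : R) := [/\ 0 <= u & 1 + u <= v].
suff [] : P (\sum_(i < d) a i) (\prod_(i < d) (1 + a i)) by [].
apply: (big_ind2 P).
- by split => //; rewrite addr0.
- move=> u v u' v' [u0 uv] [u'0 u'v']; split; first exact: addr_ge0.
  have v0 : 0 <= v by rewrite (le_trans _ uv)// addr_ge0.
  by have := ler_pM (addr_ge0 ler01 u0) (addr_ge0 ler01 u'0) uv u'v'; nra.
- by move=> i _; split.
Qed.

Lemma enorm_le_sum x : enorm x <= \sum_(i < d) `|x ord0 i|.
Proof.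
have s0 : 0 <= \sum_(i < d) `|x ord0 i| by exact: sumr_ge0.
rewrite -ler_sqr ?nnegrE ?enorm_ge0// sqr_enorm expr2 mulr_sumr.
rewrite /dotr; apply: ler_sum => i _.
rewrite -expr2 -[_ ^+ 2]real_normK ?num_real// expr2 ler_wpM2r//.
by rewrite (bigD1 i)//= lerDl sumr_ge0.
Qed.

Lemma enorm1D_le_prod x : 1 + enorm x <= \prod_(i < d) (1 + `|x ord0 i|).
Proof.
apply: le_trans (prodr1D_ge _) => [|i]; last exact: normr_ge0.
by rewrite lerD2l enorm_le_sum.
Qed.

(** Every iterated derivative is again a product of the same form, so that only its
    values have to be bounded, one coordinate at a time. *)
Lemma schwartz_rVbump p q : (forall i, rapid (q i)) -> schwartz (rVbump p q).
Proof.
move=> rq s; have [p' ->] := iter_partial_rVbump p q s; split=> [x|k].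
  exact: differentiable_rVbump.
have /choice [C hC] : forall i, exists C : R, forall t : R,
    (1 + `|t|) ^+ k * `|polyexp (p' i) (q i) t| <= C.
  by move=> i; exact: rapid_polyexp.
exists (\prod_(i < d) C i) => x.
apply: (@le_trans _ _ (\prod_(i < d) ((1 + `|x ord0 i|) ^+ k * `|polyexp (p' i) (q i) (x ord0 i)|))).
  rewrite big_split/= prodrXl normr_prod ler_wpM2r//.
    by apply: prodr_ge0.
  rewrite lerXn2r ?nnegrE ?addr_ge0 ?enorm_ge0 ?enorm1D_le_prod//.
  by apply: prodr_ge0 => i _; rewrite addr_ge0.
by apply: ler_prod => i _; rewrite hC mulr_ge0// exprn_ge0// addr_ge0.
Qed.

End rVbump.

Section continuous_rV.
Context {R : realType} {d : nat}.

(** The point whose coordinates are rounded down to multiples of [1 / (n + 1)]. *)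
Definition grid (n : nat) (x : 'rV[R]_d) : 'rV[R]_d :=
  \row_i ((Num.floor (x ord0 i * n.+1%:R))%:~R / n.+1%:R).

Lemma measurable_grid_comp n (f : 'rV[R]_d -> R) :
  measurable_fun setT (fun x => f (grid n x)).
Proof.
move=> _ Y mY; rewrite setTI.
pose c (m : 'rV[int]_d) : 'rV[R]_d := \row_i ((m ord0 i)%:~R / n.+1%:R).
pose A (m : 'rV[int]_d) := [set x : 'rV[R]_d |
  forall i, `[(m ord0 i)%:~R / n.+1%:R, ((m ord0 i)%:~R + 1) / n.+1%:R[%classic (x ord0 i)].
have n0 : 0 < n.+1%:R :> R by [].
have Ac m x : A m x -> grid n x = c m.
  move=> Ax; apply/rowP => i; rewrite !mxE; congr (_%:~R / _).
  apply: floor_def; have := Ax i; rewrite /= in_itv/= => /andP[h1 h2].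
  by rewrite -ler_pdivrMr// h1 -ltr_pdivlMr// intrD h2.
rewrite (_ : _ @^-1` _ = \bigcup_(m : 'rV[int]_d) (if f (c m) \in Y then A m else set0)).
  apply: countable_bigcupT_measurable; first exact: countableP.
  move=> m; case: ifPn => _; last exact: measurable0.
  apply: (measurable_rV_box (A := fun i => `[(m ord0 i)%:~R / n.+1%:R, ((m ord0 i)%:~R + 1) / n.+1%:R[%classic)).
  by move=> i; exact: measurable_itv.
apply/seteqP; split=> [x Yx|x [m _]] /=.
  pose m : 'rV[int]_d := \row_i Num.floor (x ord0 i * n.+1%:R).
  have Amx : A m x.
    move=> i /=; rewrite in_itv/= !mxE ler_pdivrMr// ltr_pdivlMr//.
    by rewrite floor_le -(intrD _ _ 1) floorD1_gt.
  exists m => //; rewrite mem_set//= -(Ac _ _ Amx)//.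
case: ifPn => // /set_mem Yc Ax; rewrite (Ac _ _ Ax)//.
Qed.

Lemma cvg_grid (x : 'rV[R]_d) : grid n x @[n --> \oo] --> x.
Proof.
apply/cvg_ballP => e e0; near=> n; split=> // i j.
rewrite ord1 !mxE /ball/=.
have n0 : 0 < n.+1%:R :> R by [].
have h1 := floor_le (x ord0 j * n.+1%:R).
have h2 := floorD1_gt (x ord0 j * n.+1%:R).
have ne : n.+1%:R^-1 < e.
  near: n; exact: near_infty_natSinv_lt (PosNum e0).
set a := (Num.floor _)%:~R in h1 *.
have ha : a / n.+1%:R <= x ord0 j by rewrite ler_pdivrMr.
rewrite ger0_norm ?subr_ge0//; apply: le_lt_trans ne.
rewrite lerBlDl -[X in _ + X]mul1r -mulrDl ler_pdivlMr//.
by rewrite intrD in h2; exact: ltW.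
Unshelve. all: end_near. Qed.

(** The product sigma-algebra contains the preimages by continuous functions,
    because such a function is the limit of its values on finer and finer grids. *)
Lemma continuous_measurable_rV (f : 'rV[R]_d -> R) : continuous f ->
  measurable_fun setT f.
Proof.
move=> cf; apply/measurable_EFinP.
apply: (emeasurable_fun_cvg (fun n x => (f (grid n x))%:E)) => //.
  by move=> n; apply/measurable_EFinP; exact: measurable_grid_comp.
move=> x _; apply: cvg_EFin; first by apply: nearW.
apply: (cvg_comp (fun n => grid n x) f); last exact: cf.
exact: cvg_grid.
Qed.

End continuous_rV.

Section schwartz_integrable.
Local Open Scope ereal_scope.
Context {R : realType}.
Local Notation leb := (@lebesgue_measure R).

Lemma integrable_prod_coord n (f : 'I_n -> R -> R) :
  (forall i, leb.-integrable setT (EFin \o f i)) ->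
  (lebesgue_rV n).-integrable setT (EFin \o (fun x => \prod_(i < n) f i (x ord0 i))%R).
Proof.
elim: n f => [|n IH] f fi.
  rewrite (_ : _ \o _ = EFin \o cst 1%R); first exact: finite_measure_integrable_cst.
  by apply/funext => x; rewrite /= big_ord0.
have [+ _] := rV_tensor (fi ord0) (IH (fun i => f (lift ord0 i)) (fun i => fi _)).
apply: eq_integrable => // x _; rewrite /= big_ord_recl; congr (_ * _)%:E.
by apply: eq_bigr => i _; rewrite mxE.
Qed.

Lemma integrable_inv_oneDsqr : leb.-integrable setT (EFin \o (fun t => (1 + t ^+ 2)^-1)%R).
Proof.
have c : continuous (fun t : R => (1 + t ^+ 2)^-1)%R by exact: continuous_oneDsqrV.
have pos t : (0 <= (1 + t ^+ 2)^-1 :> R)%R by rewrite invr_ge0 addr_ge0// sqr_ge0.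
apply/integrableP; split.
  by apply/measurable_EFinP; exact: continuous_measurable_fun.
under eq_integral do rewrite /= ger0_norm//.
rewrite ge0_symfun_integralT//; last by move=> t /=; rewrite sqrrN.
rewrite lte_mul_pinfty//.
have := @integral0y_oneDsqr R.
rewrite (_ : [set x | (0 <= x)%R] = `[0%R, +oo[%classic); last first.
  by apply/seteqP; split => x /=; rewrite in_itv/= andbT.
by move=> ->; rewrite ltry.
Qed.

Context {d : nat}.
Local Notation mu := (@lebesgue_rV R d).
Implicit Types psi : 'rV[R]_d -> R.

(** An integrable function that is a product over the coordinates, and dominates every
    rapidly decreasing function up to a constant. *)
Definition weight (x : 'rV[R]_d) : R := (\prod_(i < d) (1 + x ord0 i ^+ 2)^-1)%R.

Lemma weight_ge0 x : (0 <= weight x)%R.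
Proof. by apply: prodr_ge0 => i _; rewrite invr_ge0 addr_ge0// sqr_ge0. Qed.

Lemma weight_le1 x : (weight x <= 1)%R.
Proof.
rewrite /weight; apply: prodr_ile1 => i _.
rewrite invr_ge0 addr_ge0 ?sqr_ge0//= invf_le1 ?lerDl ?sqr_ge0//.
by rewrite ltr_wpDr// sqr_ge0.
Qed.

Lemma integrable_weight : mu.-integrable setT (EFin \o weight).
Proof.
exact: (@integrable_prod_coord d (fun=> fun t => (1 + t ^+ 2)^-1)%R (fun=> integrable_inv_oneDsqr)).
Qed.

Lemma schwartz_measurable psi : schwartz psi -> measurable_fun setT psi.
Proof.
move=> S; apply: continuous_measurable_rV => x.
by apply: differentiable_continuous; exact: (S [::]).1.
Qed.

Lemma schwartz_le_weight psi : schwartz psi ->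
  exists2 C, (0 <= C)%R & forall x, (`|psi x| <= C * weight x)%R.
Proof.
move=> S; have [C hC] := (S [::]).2 (2 * d)%N.
have hC' x : ((1 + enorm x) ^+ (2 * d) * `|psi x| <= C)%R by exact: hC.
exists `|C|%R => // x.
have w0 : (0 < \prod_(i < d) (1 + x ord0 i ^+ 2))%R.
  by apply: prodr_gt0 => i _; rewrite ltr_wpDr// sqr_ge0.
rewrite /weight prodfV ler_pdivlMr// (le_trans _ (le_trans (hC' x) (ler_norm _)))//.
rewrite mulrC ler_wpM2r// exprM -[X in (_ <= _ ^+ X)%R](card_ord d) -prodr_const.
apply: ler_prod => i _; rewrite addr_ge0 ?sqr_ge0//=.
have := ler_coord_enorm x i; have := enorm_ge0 x.
by rewrite -[(x ord0 i ^+ 2)%R]real_normK ?num_real//; have := normr_ge0 (x ord0 i); nra.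
Qed.

Lemma schwartz_bounded psi : schwartz psi ->
  exists2 C, (0 <= C)%R & forall x, (`|psi x| <= C)%R.
Proof.
move=> /schwartz_le_weight[C C0 h]; exists C => // x.
by apply: (le_trans (h x)); rewrite ler_piMr ?weight_le1.
Qed.

Lemma integrable_le_weight (f : 'rV[R]_d -> R) (C : R) : measurable_fun setT f ->
  (forall x, `|f x| <= C * weight x)%R -> mu.-integrable setT (EFin \o f).
Proof.
move=> mf fC; have := integrableZl measurableT C integrable_weight.
apply: le_integrable => //; first exact/measurable_EFinP.
by move=> x _; rewrite /= lee_fin (le_trans (fC x))// ler_norm.
Qed.

Lemma schwartz_integrable psi : schwartz psi -> mu.-integrable setT (EFin \o psi).
Proof.
move=> S; have [C _ h] := schwartz_le_weight S.
exact: integrable_le_weight (schwartz_measurable S) h.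
Qed.

End schwartz_integrable.

(** * Approximation in square mean *)

Section schwartz_approximable.
Local Open Scope ereal_scope.
Context {R : realType} {d : nat}.
Local Notation mu := (@lebesgue_rV R d).
Implicit Types (u v phi : 'rV[R]_d -> R).

Definition sqdist u v : \bar R := \int[mu]_x ((u x - v x) ^+ 2)%:E.

(** The closure of the rapidly decreasing functions in square mean. *)
Definition approximable u := forall e : R, (0 < e)%R ->
  exists2 phi, schwartz phi & sqdist phi u <= e%:E.

Lemma sqdist_ge0 u v : 0 <= sqdist u v.
Proof. by apply: integral_ge0 => x _; rewrite lee_fin sqr_ge0. Qed.

Lemma measurable_sqdist u v : measurable_fun setT u -> measurable_fun setT v ->
  measurable_fun setT (fun x => ((u x - v x) ^+ 2)%:E).
Proof.
move=> mu_ mv; apply/measurable_EFinP; apply: measurable_funX.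
exact: measurable_funB.
Qed.

Lemma sqdist_linear a u u' v v' : measurable_fun setT u -> measurable_fun setT v ->
  measurable_fun setT u' -> measurable_fun setT v' ->
  sqdist (fun x => a * u x + v x)%R (fun x => a * u' x + v' x)%R <=
  (2 * a ^+ 2)%:E * sqdist u u' + 2%:E * sqdist v v'.
Proof.
move=> mu1 mv mu' mv'.
have a0 : (0 <= 2 * a ^+ 2)%R by rewrite mulr_ge0// sqr_ge0.
rewrite -!ge0_integralZl//; last 4 first.
- exact: measurable_sqdist.
- by move=> x _; rewrite lee_fin sqr_ge0.
- exact: measurable_sqdist.
- by move=> x _; rewrite lee_fin sqr_ge0.
rewrite -ge0_integralD//; last 4 first.
- by move=> x _; rewrite mule_ge0 ?lee_fin// sqr_ge0.
- by apply: emeasurable_funM => //; exact: measurable_sqdist.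
- by move=> x _; rewrite mule_ge0 ?lee_fin// sqr_ge0.
- by apply: emeasurable_funM => //; exact: measurable_sqdist.
apply: ge0_le_integral => //.
- by move=> x _; rewrite lee_fin sqr_ge0.
- by apply: measurable_sqdist; apply: measurable_funD => //; exact: measurable_funM.
- by apply: emeasurable_funD; apply: emeasurable_funM => //; exact: measurable_sqdist.
move=> x _; rewrite -!EFinM -EFinD lee_fin -subr_ge0.
rewrite [leRHS](_ : _ = (a * (u x - u' x) - (v x - v' x)) ^+ 2)%R ?sqr_ge0//.
by ring.
Qed.

Lemma schwartz_approximable phi : schwartz phi -> approximable phi.
Proof.
move=> S e e0; exists phi => //; rewrite /sqdist integral0_eq ?lee_fin ?ltW//.
by move=> x _; rewrite subrr expr0n.
Qed.

Lemma approximable_linear a u v : measurable_fun setT u -> measurable_fun setT v ->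
  approximable u -> approximable v -> approximable (fun x => a * u x + v x)%R.
Proof.
move=> mu_ mv Au Av e e0.
have k0 : (0 < 2 * a ^+ 2 + 2)%R by rewrite ltr_wpDl// mulr_ge0// sqr_ge0.
have e'0 : (0 < e / (2 * a ^+ 2 + 2))%R by rewrite divr_gt0.
have [phi Sphi hphi] := Au _ e'0; have [psi Spsi hpsi] := Av _ e'0.
exists (fun x => a * phi x + psi x)%R; first exact: schwartz_linear.
have a0 : (0 <= 2 * a ^+ 2)%R by rewrite mulr_ge0// sqr_ge0.
apply: le_trans (sqdist_linear _ _ _ _ _) _ => //; try exact: schwartz_measurable.
have h1 : (2 * a ^+ 2)%:E * sqdist phi u <= (2 * a ^+ 2)%:E * (e / (2 * a ^+ 2 + 2))%:E.
  by rewrite lee_wpmul2l// lee_fin.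
have h2 : 2%:E * sqdist psi v <= 2%:E * (e / (2 * a ^+ 2 + 2))%:E.
  by rewrite lee_wpmul2l// lee_fin.
apply: (le_trans (leeD h1 h2)); rewrite -!EFinM -EFinD lee_fin -mulrDl.
by rewrite mulrCA divff ?mulr1// gt_eqF.
Qed.

Lemma approximable0 : approximable (fun=> 0%R).
Proof. exact/schwartz_approximable/schwartz0. Qed.

Lemma approximable_sum n (a : 'I_n -> R) (u : 'I_n -> 'rV[R]_d -> R) :
  (forall i, measurable_fun setT (u i)) -> (forall i, approximable (u i)) ->
  approximable (fun x => \sum_(i < n) a i * u i x)%R.
Proof.
move=> mu_ Au; elim: (index_enum _) => [|i s IH].
  by under eq_fun do rewrite big_nil; exact: approximable0.
under eq_fun do rewrite big_cons.
apply: approximable_linear => //.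
by apply: measurable_sum => j; exact: measurable_funM.
Qed.

Lemma approximable_closure u : measurable_fun setT u ->
  (forall e : R, (0 < e)%R -> exists v,
    [/\ measurable_fun setT v, approximable v & sqdist v u <= e%:E]) ->
  approximable u.
Proof.
move=> mu_ H e e0; have e40 : (0 < e / 4)%R by rewrite divr_gt0.
have [v [mv Av hv]] := H _ e40; have [phi S hphi] := Av _ e40; exists phi => //.
have mphi := schwartz_measurable S.
apply: (@le_trans _ _ (2%:E * sqdist phi v + 2%:E * sqdist v u)).
  rewrite -!ge0_integralZl//; last 4 first.
  - exact: measurable_sqdist.
  - by move=> x _; rewrite lee_fin sqr_ge0.
  - exact: measurable_sqdist.
  - by move=> x _; rewrite lee_fin sqr_ge0.
  rewrite -ge0_integralD//; last 4 first.
  - by move=> x _; rewrite mule_ge0 ?lee_fin// sqr_ge0.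
  - by apply: emeasurable_funM => //; exact: measurable_sqdist.
  - by move=> x _; rewrite mule_ge0 ?lee_fin// sqr_ge0.
  - by apply: emeasurable_funM => //; exact: measurable_sqdist.
  apply: ge0_le_integral => //.
  - by move=> x _; rewrite lee_fin sqr_ge0.
  - exact: measurable_sqdist.
  - by apply: emeasurable_funD; apply: emeasurable_funM => //; exact: measurable_sqdist.
  move=> x _; rewrite -!EFinM -EFinD lee_fin -subr_ge0.
  rewrite [leRHS](_ : _ = ((phi x - v x) - (v x - u x)) ^+ 2)%R ?sqr_ge0//.
  by ring.
apply: (@le_trans _ _ (2%:E * (e / 4)%:E + 2%:E * (e / 4)%:E)).
  by apply: leeD; rewrite lee_wpmul2l.
by rewrite -!EFinM -EFinD lee_fin; lra.
Qed.

Lemma approximable_dominated (u_ : nat -> 'rV[R]_d -> R) u (G : 'rV[R]_d -> R) :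
  measurable_fun setT u -> (forall n, measurable_fun setT (u_ n)) ->
  (forall n, approximable (u_ n)) ->
  (forall x, u_ n x @[n --> \oo] --> u x) ->
  mu.-integrable setT (EFin \o G) -> (forall n x, ((u_ n x - u x) ^+ 2 <= G x)%R) ->
  approximable u.
Proof.
move=> mu_ mun Aun cu iG uG; apply: approximable_closure => // e e0.
suff : sqdist (u_ n) u @[n --> \oo] --> 0.
  move/fine_cvgP => [fin /cvgr0_norm_le /(_ _ e0)] lim.
  have [n _ /(_ n (leqnn _))[h1 h2]] := filterI fin lim.
  exists (u_ n); split => //; rewrite -(fineK h1) lee_fin.
  exact: le_trans (ler_norm _) h2.
have [|||||_ _ ] := @dominated_convergence _ _ _ mu setT measurableT
    (fun n x => ((u_ n x - u x) ^+ 2)%:E) (cst 0) (EFin \o G).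
- by move=> n; exact: measurable_sqdist.
- exact: measurable_cst.
- apply/aeW => x _; apply: cvg_EFin; first by apply: nearW.
  have h : (u_ n x - u x)%R @[n --> \oo] --> (0 : R)%R.
    by rewrite -(subrr (u x)); apply: cvgB => //; exact: cvg_cst.
  have := cvgM h h; rewrite mulr0; exact.
- exact: iG.
- by apply/aeW => x n _; rewrite /= ger0_norm ?sqr_ge0// lee_fin.
by rewrite integral0.
Qed.

End schwartz_approximable.

Section box_profile.
Context {R : realType}.
Implicit Types a b c h l t w : R.

Lemma bernoulli_ge h n : 0 <= h -> 1 + n%:R * h <= (1 + h) ^+ n.
Proof.
move=> h0; elim: n => [|n IH]; first by rewrite mul0r addr0 expr0.
rewrite exprS -natr1; have := ler_wpM2l (addr_ge0 ler01 h0) IH.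
have : 0 <= n%:R * h ^+ 2 :> R by rewrite mulr_ge0// sqr_ge0.
nra.
Qed.

(** The profile [expR (- profile_exp n w)] tends to [1] if [w < 1] and to [0] if
    [1 <= w]. The coefficient takes care of [w = 1], and the exponent grows faster than
    the coefficient so as to keep the limit equal to [1] for [w < 1]. *)
Definition profile_exp n w : R := n.+1%:R * w ^+ (n.+1 ^ 2).

Lemma profile_exp_ge n w : 0 <= w -> 1 <= w -> w <= profile_exp n w.
Proof.
move=> w0 w1; rewrite /profile_exp.
apply: (@le_trans _ _ (w ^+ (n.+1 ^ 2))).
  by rewrite -[leLHS]expr1; apply: ler_weXn2l => //; rewrite expn_gt0.
by rewrite ler_peMl ?exprn_ge0// ler1n.
Qed.

Lemma profile_exp_ge0 n w : 0 <= w -> 0 <= profile_exp n w.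
Proof. by move=> w0; rewrite mulr_ge0// exprn_ge0. Qed.

Lemma profile_le n w : 0 <= w -> expR (- profile_exp n w) <= 2 / (1 + w).
Proof.
move=> w0; have w10 : 0 < 1 + w by rewrite ltr_wpDr.
have [w1|w1] := leP 1 w.
  apply: (@le_trans _ _ (expR (- w))); first by rewrite ler_expR lerN2 profile_exp_ge.
  rewrite expRN ler_pdivlMr// mulrC ler_pdivrMr ?expR_gt0//.
  by have := expR_ge1Dx w; have := expR_ge0 w; lra.
apply: (@le_trans _ _ 1); first by rewrite expR_le1 oppr_le0 profile_exp_ge0.
by rewrite ler_pdivlMr//; lra.
Qed.

Lemma cvg_profile w : 0 <= w ->
  expR (- profile_exp n w) @[n --> \oo] --> ((w < 1)%R%:R : R).
Proof.
move=> w0; have [w1|w1] := ltP w 1; last first.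
  apply: norm_cvg0.
  apply: (@squeeze_cvgr _ _ _ _ (cst 0) (@harmonic R)); [|exact: cvg_cst|exact: cvg_harmonic].
  apply: nearW => n; rewrite normr_ge0 ger0_norm ?expR_ge0//= expRN.
  rewrite lef_pV2 ?posrE ?expR_gt0//.
  apply: le_trans (expR_ge1Dx _).
  have : n.+1%:R <= profile_exp n w by rewrite /profile_exp ler_peMr// exprn_ege1.
  lra.
suff h : profile_exp n w @[n --> \oo] --> (0 : R).
  rewrite [X in _ --> X](_ : _ = expR (- 0)); last by rewrite oppr0 expR0.
  apply: (cvg_comp (fun n => - profile_exp n w) expR); last exact: continuous_expR.
  exact: cvgN.
have [->|wn0] := eqVneq w 0.
  rewrite (_ : (fun n => _) = cst 0); first exact: cvg_cst.
  by apply/funext => n; rewrite /profile_exp expr0n expn_eq0/= mulr0.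
have wp : 0 < w by rewrite lt_neqAle eq_sym wn0.
pose h := w^-1 - 1.
have h0 : 0 < h by rewrite subr_gt0 invf_gt1.
have lim : h^-1 * @harmonic R n @[n --> \oo] --> (0 : R).
  by rewrite -(mulr0 h^-1); apply: cvgMr; exact: cvg_harmonic.
apply: norm_cvg0; apply: (squeeze_cvgr _ (cvg_cst 0) lim).
apply: nearW => n; rewrite normr_ge0 ger0_norm ?profile_exp_ge0//=.
have n0 : 0 < n.+1%:R :> R by [].
have := bernoulli_ge (n.+1 ^ 2) (ltW h0); rewrite [1 + h]addrC subrK exprVn natrX => H.
have H2 : w ^+ (n.+1 ^ 2) * (1 + n.+1%:R ^+ 2 * h) <= 1.
  by rewrite mulrC -ler_pdivlMr ?mul1r// exprn_gt0.
rewrite /profile_exp /harmonic/= -invfM -[leRHS]mul1r ler_pdivlMr ?mulr_gt0//.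
apply: le_trans H2; rewrite [leLHS]mulrC.
have wge : 0 <= w ^+ (n.+1 ^ 2) by rewrite exprn_ge0.
rewrite (_ : h * n.+1%:R * _ = w ^+ (n.+1 ^ 2) * (n.+1%:R ^+ 2 * h)); last by ring.
by rewrite ler_wpM2l// lerDr.
Qed.

Definition profile_poly n c l : {poly R} :=
  n.+1%:R *: (((l^-1)%:P * ('X - c%:P)) ^+ 2) ^+ (n.+1 ^ 2).

Lemma horner_profile_poly n c l t :
  (profile_poly n c l).[t] = profile_exp n (((t - c) / l) ^+ 2).
Proof.
rewrite /profile_poly /profile_exp hornerZ !horner_exp hornerM !hornerC.
by rewrite hornerXsubC [l^-1 * _]mulrC.
Qed.

Lemma oneDsqr_le_profile c l t : l != 0 ->
  1 + t ^+ 2 <= (1 + 2 * c ^+ 2 + 2 * l ^+ 2) * (1 + ((t - c) / l) ^+ 2).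
Proof.
move=> l0; set y := (t - c) / l.
have -> : t = c + l * y by rewrite /y mulrC divfK// addrC subrK.
have h1 := sqr_ge0 (c - l * y); have h2 := sqr_ge0 (c * y); have h3 := sqr_ge0 l.
by have h4 := sqr_ge0 y; nra.
Qed.

Lemma rapid_profile n c l : l != 0 -> rapid (profile_poly n c l).
Proof.
move=> l0 N; pose A := 1 + 2 * c ^+ 2 + 2 * l ^+ 2.
have A1 : 1 <= A by rewrite /A; have := sqr_ge0 c; have := sqr_ge0 l; lra.
exists ((2 * A) ^+ N * (expR 1 * N.+1%:R ^+ N)) => t.
rewrite horner_profile_poly; set w := (_ / _) ^+ 2.
have w0 : 0 <= w by exact: sqr_ge0.
have h : 1 + `|t| <= 2 * A * (1 + w).
  have := oneDsqr_le_profile c t l0; rewrite -/A -/w => h.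
  have := sqr_ge0 (`|t| - 1); rewrite -[t ^+ 2]real_normK ?num_real// in h; nra.
have he : expR (- profile_exp n w) <= expR 1 * expR (- w).
  rewrite -expRD ler_expR; have [w1|w1] := leP 1 w.
    by have := profile_exp_ge n w0 w1; lra.
  by have := profile_exp_ge0 n w0; lra.
apply: (@le_trans _ _ ((2 * A * (1 + w)) ^+ N * (expR 1 * expR (- w)))).
  apply: ler_pM => //; rewrite ?exprn_ge0 ?expR_ge0 ?addr_ge0//.
  by rewrite lerXn2r// nnegrE ?addr_ge0// (le_trans _ h)// addr_ge0.
have p0 : 0 <= (2 * A) ^+ N by rewrite exprn_ge0// mulr_ge0// (le_trans _ A1).
rewrite exprMn -mulrA ler_wpM2l// mulrCA ler_wpM2l ?expR_ge0//.
exact: exprD1_expRN_le.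
Qed.

Lemma in_itv_profile a b t : a < b ->
  (t \in `]a, b[) = (((t - (a + b) / 2) / ((b - a) / 2)) ^+ 2 < 1).
Proof.
move=> ab; rewrite in_itv/=.
have l0 : 0 < (b - a) / 2 by lra.
rewrite expr_div_n ltr_pdivrMr ?exprn_gt0// mul1r.
apply/andP/idP => [[h1 h2]|h]; first by nra.
split; nra.
Qed.

End box_profile.

Section approximable_indic.
Context {R : realType} {d : nat}.
Local Notation mu := (@lebesgue_rV R d).
Implicit Types (a b : 'I_d -> R) (A : set 'rV[R]_d).

Definition obox a b : set 'rV[R]_d := [set x | forall i, `]a i, b i[%classic (x ord0 i)].

Lemma measurable_obox a b : measurable (obox a b).
Proof. by apply: (measurable_rV_box (A := fun i => `]a i, b i[%classic)) => i; exact: measurable_itv. Qed.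

Lemma indic_oboxE a b x : \1_(obox a b) x = \prod_(i < d) (x ord0 i \in `]a i, b i[)%:R :> R.
Proof.
rewrite indicE; have [xB|xB] := boolP (x \in obox a b).
  by rewrite big1// => i _; have := set_mem xB i; rewrite /= => ->.
have [i /negPf xi] : exists i, x ord0 i \notin `]a i, b i[.
  apply: contrapT => /forallNP H; move/negP : xB; apply; rewrite inE => i /=.
  by have := H i; case: (x ord0 i \in _) => // /(_ isT).
by rewrite (bigD1 i)//= xi mul0r.
Qed.

Lemma cvg_prod_seq (I : Type) (s : seq I) (f : I -> nat -> R) (l : I -> R) :
  (forall i, f i n @[n --> \oo] --> l i) ->
  \prod_(i <- s) f i n @[n --> \oo] --> \prod_(i <- s) l i.
Proof.
move=> fl; elim: s => [|i s IH].
  by rewrite big_nil; under eq_fun do rewrite big_nil; exact: cvg_cst.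
by rewrite big_cons; under eq_fun do rewrite big_cons; exact: cvgM.
Qed.

Lemma norm_sqrB_le (u v g : R) : 0 <= u <= 1 -> 0 <= v <= 1 -> u <= g -> v <= g ->
  (u - v) ^+ 2 <= g.
Proof. by move=> /andP[? ?] /andP[? ?] ? ?; nra. Qed.

(** A product over the coordinates of profiles in [((x - c) / l) ^ 2], where [c] is the
    centre and [l] the half-length of the side, converges to the indicator of the box. The
    profiles are at most [2 / (1 + w)], hence dominated by [weight]. *)
Lemma approximable_obox a b : approximable (\1_(obox a b)).
Proof.
have [ab|] := pselect (forall i, a i < b i); last first.
  move=> /existsNP[i /negP]; rewrite -leNgt => ba.
  rewrite (_ : \1__ = fun=> 0); first exact: approximable0.
  apply/funext => x; rewrite indic_oboxE (bigD1 i)//= (_ : _ \in _ = false) ?mul0r//.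
  by apply/negP; rewrite in_itv/= => /andP[h1 h2]; have := lt_trans h1 h2; rewrite ltNge ba.
pose c i := (a i + b i) / 2; pose l i := (b i - a i) / 2.
have l0 i : l i != 0 by rewrite /l gt_eqF// divr_gt0// subr_gt0.
pose phi n := rVbump (fun=> 1%:P) (fun i => profile_poly n (c i) (l i)) : 'rV[R]_d -> R.
have Sphi n : schwartz (phi n) by apply: schwartz_rVbump => i; exact: rapid_profile.
pose w (x : 'rV[R]_d) i := ((x ord0 i - c i) / l i) ^+ 2.
have w0 x i : 0 <= w x i by exact: sqr_ge0.
have phiE n x : phi n x = \prod_(i < d) expR (- profile_exp n (w x i)).
  by apply: eq_bigr => i _; rewrite /polyexp hornerC mul1r horner_profile_poly.
have indE x : \1_(obox a b) x = \prod_(i < d) (w x i < 1)%R%:R :> R.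
  by rewrite indic_oboxE; apply: eq_bigr => i _; rewrite in_itv_profile.
pose K i := 2 * (1 + 2 * c i ^+ 2 + 2 * l i ^+ 2).
pose C := \prod_(i < d) K i.
have wle x i : 2 / (1 + w x i) <= K i * (1 + x ord0 i ^+ 2)^-1.
  rewrite ler_pdivrMr ?ltr_wpDr// mulrAC ler_pdivlMr; last by rewrite ltr_wpDr// sqr_ge0.
  by have := oneDsqr_le_profile (c i) (x ord0 i) (l0 i); rewrite /K -/(w x i); lra.
apply: (@approximable_dominated _ _ phi _ (fun x => C * weight x)).
- by apply: measurable_indic; exact: measurable_obox.
- by move=> n; exact: schwartz_measurable.
- by move=> n; exact: schwartz_approximable.
- move=> x; rewrite indE; under eq_fun do rewrite phiE.
  by apply: cvg_prod_seq => i; exact: cvg_profile.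
- have := integrableZl measurableT C (@integrable_weight R d).
  by apply: eq_integrable.
- move=> n x; apply: norm_sqrB_le.
  + rewrite phiE; apply/andP; split; first by apply: prodr_ge0 => i _; exact: expR_ge0.
    by apply: prodr_ile1 => i _; rewrite expR_ge0 expR_le1 oppr_le0 profile_exp_ge0.
  + by rewrite indicE; case: (_ \in _); rewrite lexx ler01.
  + rewrite phiE /C /weight -big_split/=; apply: ler_prod => i _.
    by rewrite expR_ge0 (le_trans _ (wle x i))// profile_le.
  + rewrite indE /C /weight -big_split/=; apply: ler_prod => i _.
    rewrite ler0n/= (le_trans _ (wle x i))//.
    case: ltP => [w1|_]; last by rewrite divr_ge0// addr_ge0.
    by rewrite mulr1n ler_pdivlMr ?ltr_wpDr//; lra.
Qed.

(** The upper orthants form a pi-system that generates the sigma-algebra. *)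
Definition orthant a : set 'rV[R]_d := [set x | forall i, `]a i, +oo[%classic (x ord0 i)].

Lemma measurable_orthant a : measurable (orthant a).
Proof. by apply: (measurable_rV_box (A := fun i => `]a i, +oo[%classic)) => i; exact: measurable_itv. Qed.

Lemma orthantI a b : orthant a `&` orthant b = orthant (fun i => Num.max (a i) (b i)).
Proof.
apply/seteqP; split=> [x [xa xb] i|x xab].
  by have := xa i; have := xb i; rewrite /= !in_itv/= !andbT gt_max => -> ->.
by split=> i; have := xab i; rewrite /= !in_itv/= !andbT gt_max => /andP[].
Qed.

Lemma orthant_obox a (L : R) : orthant a `&` obox (fun=> - L) (fun=> L) =
  obox (fun i => Num.max (a i) (- L)) (fun=> L).
Proof.
apply/seteqP; split=> [x [xa xb] i|x xab].
  have := xa i; have := xb i; rewrite /= !in_itv/= !andbT gt_max.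
  by move=> /andP[-> ->] ->.
by split=> i; have := xab i; rewrite /= !in_itv/= ?andbT gt_max => /andP[/andP[h1 h2] h3]; rewrite ?h1 ?h2 ?h3.
Qed.

Lemma measurable_rVE : @measurable _ 'rV[R]_d = <<s range orthant >>.
Proof.
apply/seteqP; split; last first.
  apply: smallest_sub; first exact: sigma_algebra_measurable.
  by move=> _ [a _ <-]; exact: measurable_orthant.
apply: smallest_sub; first exact: smallest_sigma_algebra.
rewrite -bigcup_seq/=; apply: bigcup_sub => i _ _ [B mB <-]; rewrite setTI.
pose D := [set B : set R | <<s range orthant >> ((fun x : 'rV[R]_d => x ord0 i) @^-1` B)].
suff : @measurable _ (measurableTypeR R) `<=` D by apply.
rewrite (_ : @measurable _ (measurableTypeR R) = <<s @RGenOInfty.G R >>); last exact: RGenOInfty.measurableE.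
apply: smallest_sub.
  split => [|C DC|F DF].
  - by rewrite /D/= preimage_set0; exact: sigma_algebra0.
  - have [_ /(_ _ DC) + _] := @smallest_sigma_algebra _ [set: 'rV[R]_d] (range orthant).
    by rewrite !setTD.
  - rewrite /D/= preimage_bigcup; exact: sigma_algebra_bigcup.
move=> _ [c ->]; rewrite /D/=.
rewrite (_ : _ @^-1` _ = \bigcup_n orthant (fun j => if j == i then c else - n%:R)); last first.
  apply/seteqP; split=> [x|x [n _ /(_ i)]] /=; rewrite ?eqxx//.
  rewrite !in_itv/= andbT => xc; exists (Num.truncn (enorm x)).+1 => // j /=.
  case: eqVneq => [->|_]; rewrite in_itv/= andbT//.
  have := ler_coord_enorm x j; have := truncnS_gt (enorm x).
  by rewrite ler_norml => h1 /andP[h2 _]; lra.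
apply: sigma_algebra_bigcup => n; apply: sub_sigma_algebra; by eexists.
Qed.

Lemma integrable_indic_obox (L : R) :
  mu.-integrable setT (EFin \o \1_(obox (fun=> - L) (fun=> L))).
Proof.
set Q := obox _ _; have mQ : measurable Q by exact: measurable_obox.
apply/integrableP; split; first by apply/measurable_EFinP; exact: measurable_indic.
rewrite (eq_integral (EFin \o \1_Q)); last by move=> x _; rewrite /= ger0_norm.
rewrite integral_indic// setIT.
apply: (@le_lt_trans _ _ (mu [set x : 'rV[R]_d | forall i, `[(- `|L|)%R, `|L|%R]%classic (x ord0 i)])).
  apply: le_measure; rewrite ?inE//; first exact: measurable_cube.
  move=> x Qx i; have := Qx i; rewrite /= !in_itv/= => /andP[h1 h2].
  by have LL := ler_norm L; apply/andP; split; lra.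
by rewrite lebesgue_rV_cube// ltry.
Qed.

(** Dynkin's theorem reduces the indicators of all bounded measurable sets to
    those of boxes. *)
Lemma approximable_indic A (L : R) : measurable A ->
  approximable (\1_(A `&` obox (fun=> - L) (fun=> L))).
Proof.
set Q := obox _ _; have mQ : measurable Q by exact: measurable_obox.
have iQ := integrable_indic_obox L; rewrite -/Q in iQ.
rewrite {1}measurable_rVE => mA; pattern A.
apply: (dynkin_induction measurable_rVE) mA.
- by move=> _ _ [a _ <-] [b _ <-]; rewrite orthantI; eexists.
- by rewrite setTI; exact: approximable_obox.
- by move=> _ [a _ <-]; rewrite orthant_obox; exact: approximable_obox.
- move=> S mS AS.
  rewrite (_ : \1_(~` S `&` Q) = fun x => -1 * \1_(S `&` Q) x + \1_Q x).
    apply: approximable_linear => //; try exact: approximable_obox.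
    by apply: measurable_indic; exact: measurableI.
  apply/funext => x; rewrite !indicE !in_setI in_setC.
  by case: (x \in S); case: (x \in Q); rewrite /=; ring.
- move=> F mF tF AF.
  (* The sets are disjoint, so the indicators add up. *)
  have Fle n x : \sum_(i < n) \1_(F i `&` Q) x = \1_((\big[setU/set0]_(i < n) F i) `&` Q) x :> R.
    elim: n => [|n IH]; first by rewrite !big_ord0 set0I indic0.
    rewrite !big_ord_recr/= IH !indicE !in_setI in_setU.
    have [Fn|_] := boolP (x \in F n); last by rewrite orbF addr0.
    rewrite memNset ?add0r// -bigcup_mkord => -[k /= kn Fk].
    have := tF k n I I (ex_intro _ x (conj Fk (set_mem Fn))).
    by apply/eqP; rewrite ltn_eqF.
  have mS n : measurable (\big[setU/set0]_(i < n) F i `&` Q).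
    by apply: measurableI => //; exact: bigsetU_measurable.
  apply: (@approximable_dominated _ _
    (fun n => \1_((\big[setU/set0]_(i < n) F i) `&` Q)) _ (\1_Q)) => //.
  + by apply: measurable_indic; apply: measurableI => //; exact: bigcup_measurable.
  + move=> n.
    rewrite (_ : \1__ = fun x => \sum_(i < n) 1 * \1_(F i `&` Q) x); last first.
      by apply/funext => x; rewrite -Fle; apply: eq_bigr => i _; rewrite mul1r.
    apply: approximable_sum => i //.
    by apply: measurable_indic; exact: measurableI.
  + move=> x; have [[[k _ Fk] Qx]|nFx] := pselect ((\bigcup_k F k `&` Q) x).
      apply: cvg_near_cst; exists k.+1 => // n /= kn.
      rewrite !indicE !mem_set//; first by split => //; exists k.
      by split => //; rewrite -bigcup_mkord; exists k.
    apply: cvg_near_cst; apply: nearW => n.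
    rewrite !indicE !memNset// => -[+ Qx]; rewrite -bigcup_mkord => -[k _ Fk].
    by apply: nFx; split => //; exists k.
  + move=> n x; apply: norm_sqrB_le.
    * by rewrite indicE; case: (_ \in _); rewrite ?lexx ?ler01.
    * by rewrite indicE; case: (_ \in _); rewrite ?lexx ?ler01.
    * by rewrite !indicE in_setI; case: (x \in Q); case: (_ \in _).
    * by rewrite !indicE in_setI; case: (x \in Q); case: (_ \in _).
Qed.

Import HBNNSimple.

(** Such a function is the increasing limit of simple functions, which are linear
    combinations of indicators; outside the box all of them vanish. *)
Lemma approximable_bounded (u : 'rV[R]_d -> R) (M L : R) : measurable_fun setT u ->
  (forall x, 0 <= u x <= M) -> (forall x, ~ obox (fun=> - L) (fun=> L) x -> u x = 0) ->
  approximable u.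
Proof.
set Q := obox _ _ => mu_ u0 uQ; have mQ : measurable Q by exact: measurable_obox.
have mEu : measurable_fun setT (EFin \o u) by exact/measurable_EFinP.
have Eu0 x : [set: 'rV[R]_d] x -> (0 <= (EFin \o u) x)%E.
  by move=> _; rewrite lee_fin; have /andP[] := u0 x.
pose g := nnsfun_approx measurableT mEu.
have cg x : g n x @[n --> \oo] --> u x.
  have := @cvg_nnsfun_approx _ _ _ _ measurableT _ mEu Eu0 x I.
  by move/fine_cvgP => [_]; exact.
have ndg x : nondecreasing_seq (fun n => g n x).
  by move=> m n mn; have /lefP := nd_nnsfun_approx measurableT mEu mn; exact.
have gle n x : g n x <= u x.
  have := nondecreasing_cvgn_le (ndg x) (cvgP _ (cg x)) n.
  by rewrite (cvg_lim _ (cg x)).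
apply: (@approximable_dominated _ _ (fun n x => g n x * \1_Q x) _
  (fun x => M ^+ 2 * \1_Q x)) => //.
- by move=> n; apply: measurable_funM.
- move=> n.
  pose s : seq R := finmap.enum_fset (fset_set (g n @` setT)).
  rewrite (_ : (fun x => _) = fun x =>
      \sum_(i < size s) s`_i * \1_(g n @^-1` [set s`_i] `&` Q) x); last first.
    apply/funext => x; rewrite fimfunEord mulr_suml; apply: eq_bigr => i _.
    by rewrite indicI/= mulrA.
  apply: approximable_sum => i.
    by apply: measurable_indic; exact: measurableI.
  exact: approximable_indic.
- move=> x; have [Qx|Qx] := pselect (Q x).
    by rewrite indicE mem_set//; under eq_fun do rewrite mulr1; exact: cg.
  rewrite indicE memNset// uQ//; under eq_fun do rewrite mulr0; exact: cvg_cst.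
- have := integrableZl measurableT (M ^+ 2) (integrable_indic_obox L).
  by apply: eq_integrable.
- move=> n x; have [Qx|Qx] := pselect (Q x).
    rewrite indicE mem_set// !mulr1; have := gle n x; have /andP[] := u0 x.
    have : 0 <= g n x by [].
    by move=> ? ? ? ?; nra.
  by rewrite indicE memNset// uQ// !mulr0 subrr expr0n.
Qed.

End approximable_indic.

(** * Truncation and convergence in the negative norm *)

Section energy_theory.
Local Open Scope ereal_scope.
Context {R : realType} {d : nat}.
Implicit Types (u v g : 'rV[R]_d -> R) (l : R).
Local Notation mu := (@lebesgue_rV R d).
Local Notation mu2 := (@lebesgue_pair R d).

Lemma measurable_resolvent_autocorr l u : measurable_fun setT u -> (forall y, 0 <= u y)%R ->
  measurable_fun setT (fun x => resolvent l x * autocorr u x).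
Proof.
by move=> mu_ u0; apply: emeasurable_funM; [exact: measurable_resolvent|exact: measurable_autocorr].
Qed.

(** [autocorr u x] is at most the integral of [u ^ 2], from
    [2 * a * b <= a ^ 2 + b ^ 2] and invariance by translation; the resolvent has mass at
    most [l^-1]. *)
Lemma energy_le_sqr l u : (0 < l)%R -> measurable_fun setT u -> (forall y, 0 <= u y)%R ->
  energy l u <= l^-1%:E * \int[mu]_x (u x ^+ 2)%:E.
Proof.
move=> l0 mu_ u0; set I := \int[mu]_x _.
have I0 : 0 <= I by apply: integral_ge0 => x _; rewrite lee_fin sqr_ge0.
have mu2_ : measurable_fun setT (fun y => (u y ^+ 2)%:E).
  by apply/measurable_EFinP; exact: measurable_funX.
have h0 : (0 <= 2^-1 :> R)%R by [].
have acI x : autocorr u x <= I.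
  have mh (f : 'rV[R]_d -> \bar R) : measurable_fun setT f ->
      measurable_fun setT (fun y => 2^-1%:E * f y).
    by move=> mf; apply: emeasurable_funM.
  have ms : measurable_fun setT (fun y : 'rV[R]_d => (u (y - x)%R ^+ 2)%:E).
    by apply/measurable_EFinP/measurable_funX; exact: measurable_shift.
  apply: (@le_trans _ _
    (\int[mu]_y (2^-1%:E * (u y ^+ 2)%:E + 2^-1%:E * (u (y - x) ^+ 2)%:E))).
    apply: ge0_le_integral => //.
    - by move=> y _; rewrite lee_fin mulr_ge0.
    - by apply/measurable_EFinP; apply: measurable_funM => //; exact: measurable_shift.
    - by apply: emeasurable_funD; exact: mh.
    move=> y _; rewrite -!EFinM -EFinD lee_fin.
    by have := sqr_ge0 (u y - u (y - x))%R; nra.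
  rewrite ge0_integralD//; last 4 first.
  - by move=> y _; rewrite mule_ge0 ?lee_fin// sqr_ge0.
  - exact: mh.
  - by move=> y _; rewrite mule_ge0 ?lee_fin// sqr_ge0.
  - exact: mh.
  rewrite !ge0_integralZl//; last 2 first.
  - by move=> y _; rewrite lee_fin sqr_ge0.
  - by move=> y _; rewrite lee_fin sqr_ge0.
  rewrite (@ge0_integral_rV_shift R d x (fun y => (u y ^+ 2)%:E))//; last first.
    by move=> y; rewrite lee_fin sqr_ge0.
  rewrite -/I -ge0_muleDl// -EFinD (_ : 2^-1 + 2^-1 = 1)%R; last by lra.
  by rewrite mul1e.
apply: (@le_trans _ _ (\int[mu]_x (resolvent l x * I))).
  apply: ge0_le_integral => //.
  - by move=> x _; rewrite mule_ge0 ?resolvent_ge0// autocorr_ge0.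
  - exact: measurable_resolvent_autocorr.
  - by apply: emeasurable_funM => //; exact: measurable_resolvent.
  by move=> x _; rewrite lee_wpmul2l ?resolvent_ge0.
rewrite ge0_integralZr//; last 2 first.
- exact: measurable_resolvent.
- by move=> x _; exact: resolvent_ge0.
by rewrite lee_wpmul2r// integral_resolvent_le.
Qed.

Lemma le_energy l u v : measurable_fun setT u -> measurable_fun setT v ->
  (forall y, 0 <= u y)%R -> (forall y, u y <= v y)%R -> energy l u <= energy l v.
Proof.
move=> mu_ mv u0 uv; have v0 y : (0 <= v y)%R := le_trans (u0 y) (uv y).
apply: ge0_le_integral => //.
- by move=> x _; rewrite mule_ge0 ?resolvent_ge0// autocorr_ge0.
- exact: measurable_resolvent_autocorr.
- exact: measurable_resolvent_autocorr.
move=> x _; rewrite lee_wpmul2l ?resolvent_ge0//; apply: ge0_le_integral => //.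
- by move=> y _; rewrite lee_fin mulr_ge0.
- by apply/measurable_EFinP; apply: measurable_funM => //; exact: measurable_shift.
- by apply/measurable_EFinP; apply: measurable_funM => //; exact: measurable_shift.
by move=> y _; rewrite lee_fin ler_pM.
Qed.

(** Dominated convergence for the double integral of [energyE]: the integrand at
    [(y, z)] vanishes as soon as [y] has left [D n]. *)
Lemma energy_tail_cvg0 l g (D : (set 'rV[R]_d)^nat) : measurable_fun setT g ->
  (forall y, 0 <= g y)%R -> energy l g < +oo -> (forall n, measurable (D n)) ->
  (forall x, \forall n \near \oo, ~ D n x) ->
  energy l (g \* \1_(D n))%R @[n --> \oo] --> 0.
Proof.
move=> mg g0 goo mD Dx.
have gD0 n y : (0 <= (g \* \1_(D n)) y)%R by rewrite mulr_ge0.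
have mgD n : measurable_fun setT (g \* \1_(D n))%R by exact: measurable_restr.
pose F u (z : 'rV[R]_d * 'rV[R]_d) := resolvent l (z.1 - z.2)%R * (u z.1 * u z.2)%:E.
have mF u : measurable_fun setT u -> measurable_fun setT (F u).
  move=> mu_; apply: emeasurable_funM.
    by apply: (measurableT_comp (measurable_resolvent l)); exact: measurable_rVB.
  by apply/measurable_EFinP; apply: measurable_funM; exact: measurableT_comp.
have F0 u z : (forall y, 0 <= u y)%R -> 0 <= F u z.
  by move=> u0; rewrite mule_ge0 ?resolvent_ge0// lee_fin mulr_ge0.
under eq_fun do rewrite energyE//.
have [|||||_ _ ] := @dominated_convergence _ _ _ mu2 setT measurableT
    (fun n => F (g \* \1_(D n))%R) (cst 0) (F g).
- by move=> n; exact: mF.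
- exact: measurable_cst.
- apply/aeW => z _; apply: cvg_near_cst.
  apply: filterS (Dx z.1) => n nD.
  by rewrite /F/= indicE memNset// mulr0 mul0r mule0.
- apply/integrableP; split; first exact: mF.
  rewrite (eq_integral (F g)); first by rewrite -energyE.
  by move=> z _; rewrite gee0_abs// F0.
- apply/aeW => z n _; rewrite gee0_abs ?F0// lee_wpmul2l ?resolvent_ge0// lee_fin.
  have le1 y : ((g \* \1_(D n)) y <= g y)%R.
    by rewrite /= indicE; case: (_ \in _); rewrite ?mulr1 ?mulr0.
  by rewrite ler_pM.
by rewrite integral0.
Qed.

End energy_theory.

Section negative_norm.
Local Open Scope ereal_scope.
Context {R : realType} {d : nat}.
Implicit Types (u v w phi psi : 'rV[R]_d -> R).
Local Notation mu := (@lebesgue_rV R d).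

Lemma integrable_addr u v : mu.-integrable setT (EFin \o u) ->
  mu.-integrable setT (EFin \o v) -> mu.-integrable setT (EFin \o (fun x => u x + v x)%R).
Proof. by move=> iu iv; exact: (integrableD measurableT iu iv). Qed.

Lemma integrable_subr u v : mu.-integrable setT (EFin \o u) ->
  mu.-integrable setT (EFin \o v) -> mu.-integrable setT (EFin \o (fun x => u x - v x)%R).
Proof. by move=> iu iv; exact: (integrableB measurableT iu iv). Qed.

Lemma fourier2_add3_le u v w x : mu.-integrable setT (EFin \o u) ->
  mu.-integrable setT (EFin \o v) -> mu.-integrable setT (EFin \o w) ->
  (fourier2 (fun y => u y + v y + w y) x <= 3 * (fourier2 u x + fourier2 v x + fourier2 w x))%R.
Proof.
move=> iu iv iw.
have lin (b : 'rV[R]_d -> R) : measurable_fun setT b -> (forall y, `|b y| <= 1)%R ->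
    (\int[mu]_y ((u y + v y + w y) * b y) =
    \int[mu]_y (u y * b y) + \int[mu]_y (v y * b y) + \int[mu]_y (w y * b y))%R.
  move=> mb b1.
  have iub := integrable_bounded_mul iu mb b1.
  have ivb := integrable_bounded_mul iv mb b1.
  have iwb := integrable_bounded_mul iw mb b1.
  rewrite -(RintegralD measurableT iub ivb).
  have iuvb : mu.-integrable setT (EFin \o (fun y => u y * b y + v y * b y)%R).
    exact: integrable_addr.
  rewrite -(RintegralD measurableT iuvb iwb).
  by apply: eq_Rintegral => y _; rewrite !mulrDl.
have mdot : measurable_fun setT (fun y : 'rV[R]_d => dotr x y) by exact: measurable_dotr.
rewrite /fourier2 /fourier /Normc.normc !sqr_sqrtr ?addr_ge0 ?sqr_ge0//.
rewrite (lin (fun y => cos (dotr x y))); last 2 first.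
- exact: measurable_cos_comp.
- by move=> y; exact: norm_cos_le1.
rewrite (lin (fun y => sin (dotr x y))); last 2 first.
- exact: measurable_sin_comp.
- by move=> y; exact: norm_sin_le1.
have h (a b c : R) : ((a + b + c) ^+ 2 <= 3 * (a ^+ 2 + b ^+ 2 + c ^+ 2))%R.
  by have := sqr_ge0 (a - b)%R; have := sqr_ge0 (b - c)%R; have := sqr_ge0 (a - c)%R; nra.
by apply: le_trans (lerD (h _ _ _) (h _ _ _)) _; rewrite -mulrDr ler_wpM2l//; lra.
Qed.

Definition Hm1_sqr u : \bar R := \int[mu]_x (fourier2 u x / (1 + enorm x ^+ 2))%:E.

Lemma measurable_Hm1_sqr u : mu.-integrable setT (EFin \o u) ->
  measurable_fun setT (fun x => (fourier2 u x / (1 + enorm x ^+ 2))%:E).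
Proof.
move=> iu; apply/measurable_EFinP; apply: measurable_funM; first exact: measurable_fourier2.
apply: measurable_invr.
by apply: measurable_funD => //; apply: measurable_funX; exact: measurable_enorm.
Qed.

Lemma Hm1_sqr_ge0 u x : 0 <= (fourier2 u x / (1 + enorm x ^+ 2))%:E.
Proof. by rewrite lee_fin divr_ge0 ?fourier2_ge0// addr_ge0// sqr_ge0. Qed.

Lemma Hm1_sqr_add3_le u v w : mu.-integrable setT (EFin \o u) ->
  mu.-integrable setT (EFin \o v) -> mu.-integrable setT (EFin \o w) ->
  Hm1_sqr (fun y => u y + v y + w y)%R <= 3%:E * (Hm1_sqr u + Hm1_sqr v + Hm1_sqr w).
Proof.
move=> iu iv iw; have mu1 := measurable_Hm1_sqr iu; have mv1 := measurable_Hm1_sqr iv.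
have mw1 := measurable_Hm1_sqr iw.
rewrite -ge0_integralD//; [|by move=> x _; exact: Hm1_sqr_ge0..].
rewrite -ge0_integralD//; last 3 first.
- by move=> x _; rewrite adde_ge0// Hm1_sqr_ge0.
- exact: emeasurable_funD.
- by move=> x _; exact: Hm1_sqr_ge0.
have muvw := emeasurable_funD (emeasurable_funD mu1 mv1) mw1.
rewrite -ge0_integralZl//; last by move=> x _; rewrite !adde_ge0// Hm1_sqr_ge0.
apply: ge0_le_integral => //.
- by move=> x _; exact: Hm1_sqr_ge0.
- by apply: measurable_Hm1_sqr; apply: integrable_addr => //; exact: integrable_addr.
- exact: emeasurable_funM.
move=> x _; rewrite -!EFinD -EFinM lee_fin -!mulrDl mulrA ler_wpM2r//.
  by rewrite invr_ge0 addr_ge0// sqr_ge0.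
exact: fourier2_add3_le.
Qed.

(** The triangle inequality for [phi - psi = (phi - u) + (v - psi) + (u - v)],
    in which the first two terms are small in square mean and the last one is
    controlled by its energy. *)
Lemma Hm1_sqr_sub_le phi psi u v w :
  mu.-integrable setT (EFin \o phi) -> mu.-integrable setT (EFin \o psi) ->
  mu.-integrable setT (EFin \o u) -> mu.-integrable setT (EFin \o v) ->
  measurable_fun setT w -> (forall x, `|u x - v x| <= w x)%R ->
  Hm1_sqr (fun x => phi x - psi x)%R <=
  (6 * (2^-1 * (2 * pi) ^+ d))%:E * (sqdist phi u + sqdist psi v + energy 2^-1 w).
Proof.
move=> iphi ipsi iu iv mw uvw.
have msr (a : 'rV[R]_d -> R) : mu.-integrable setT (EFin \o a) -> measurable_fun setT a.
  by move=> /measurable_int /measurable_EFinP.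
set K : R := (2^-1 * (2 * pi) ^+ d)%R.
have K0 : (0 <= K)%R by rewrite mulr_ge0// exprn_ge0// mulr_ge0// pi_ge0.
have HL (a b : 'rV[R]_d -> R) : mu.-integrable setT (EFin \o a) ->
    mu.-integrable setT (EFin \o b) -> Hm1_sqr (fun x => a x - b x)%R <= K%:E * (2%:E * sqdist a b).
  move=> ia ib; apply: (le_trans (Hm1_le_energy (integrable_subr ia ib))).
  rewrite lee_wpmul2l//.
  have h2 : (0 < 2^-1 :> R)%R by [].
  have mab : measurable_fun setT (fun x => `|a x - b x|)%R.
    by apply: measurableT_comp => //; apply: measurable_funB; exact: msr.
  apply: le_trans (energy_le_sqr h2 mab _) _ => //.
  rewrite invrK lee_wpmul2l// le_eqVlt; apply/orP; left; apply/eqP.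
  by apply: eq_integral => x _; rewrite real_normK// num_real.
have -> : Hm1_sqr (fun x => phi x - psi x)%R =
    Hm1_sqr (fun x => (phi x - u x) + (v x - psi x) + (u x - v x))%R.
  by congr Hm1_sqr; apply/funext => x; ring.
apply: (le_trans (Hm1_sqr_add3_le (integrable_subr iphi iu) (integrable_subr iv ipsi) (integrable_subr iu iv))).
have h1 := HL _ _ iphi iu; have h2 := HL _ _ iv ipsi.
have h3 : Hm1_sqr (fun x => u x - v x)%R <= K%:E * (2%:E * energy 2^-1 w).
  apply: (le_trans (Hm1_le_energy (integrable_subr iu iv))); rewrite lee_wpmul2l//.
  have w0 y : (0 <= w y)%R by exact: le_trans (uvw y).
  have e0 : 0 <= energy 2^-1 w.
    by apply: integral_ge0 => x _; rewrite mule_ge0 ?resolvent_ge0// autocorr_ge0.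
  apply: (@le_trans _ _ (energy 2^-1 w)); last first.
    by rewrite -{1}[energy _ _]mul1e lee_wpmul2r// lee_fin ler1n.
  apply: le_energy => //; apply: measurableT_comp => //.
  by apply: measurable_funB; exact: msr.
have sC : sqdist v psi = sqdist psi v.
  by apply: eq_integral => x _; congr EFin; ring.
rewrite sC in h2.
apply: (@le_trans _ _ (3%:E * (K%:E * (2%:E * sqdist phi u) + K%:E * (2%:E * sqdist psi v) +
  K%:E * (2%:E * energy 2^-1 w)))).
  by rewrite lee_wpmul2l// leeD// leeD.
have e0 : 0 <= energy 2^-1 w.
  apply: integral_ge0 => x _; rewrite mule_ge0 ?resolvent_ge0// autocorr_ge0// => y.
  exact: le_trans (uvw y).
have alg (X Y Z : \bar R) : 0 <= X -> 0 <= Y -> 0 <= Z ->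
    3%:E * (K%:E * (2%:E * X) + K%:E * (2%:E * Y) + K%:E * (2%:E * Z)) =
    (6 * K)%:E * (X + Y + Z).
  move=> X0 Y0 Z0; rewrite !muleA -!ge0_muleDr ?(adde_ge0 X0 Y0)//.
  by rewrite !muleA -!EFinM; congr (_%:E * _); ring.
by rewrite alg ?sqdist_ge0.
Qed.

End negative_norm.

Section class_G_locally_integrable.
Local Open Scope ereal_scope.
Context {R : realType} {d : nat}.
Implicit Types (x : 'rV[R]_d) (s : R).
Local Notation mu := (@lebesgue_rV R d).
Variables (p : R) (h : 'rV[R]_d -> R).
Hypotheses (p1 : (1 < p)%R) (Gh : class_G p h).

Let mh : measurable_fun setT h.
Proof. by have [[]] := Gh. Qed.

Let Q : set 'rV[R]_d := [set x | forall i, `[(- 1)%R, 1%R]%classic (x ord0 i)].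

Let mQ : measurable Q.
Proof. exact: measurable_cube. Qed.

(** On the cube, [t <= 1 + t ^ p] makes the local integrability of order [p] imply the
    one of order [1]. *)
Lemma integral_cube_norm_lty : \int[mu]_(x in Q) `|h x|%:E < +oo.
Proof.
have [[_ Lh] _] := Gh.
have cQ : compact Q.
  have := @rV_compact R d (fun=> `[(- 1)%R, 1%R]%classic).
  by apply=> i; exact: segment_compact.
have mp : measurable_fun setT (fun x => (`|h x| `^ p)%:E).
  apply/measurable_EFinP; apply: (measurableT_comp (@measurable_powR R p)).
  exact: measurableT_comp.
apply: (@le_lt_trans _ _ (\int[mu]_(x in Q) (1 + (`|h x| `^ p)%:E))).
  apply: ge0_le_integral => //.
  - by apply/measurable_EFinP; apply: measurableT_comp => //; exact: measurable_funTS.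
  - by apply: emeasurable_funD => //; exact: measurable_funTS.
  move=> x _; rewrite -EFinD lee_fin; have [h1|h1] := leP `|h x|%R 1%R.
    by apply: le_trans h1 _; rewrite lerDl powR_ge0.
  apply: (@le_trans _ _ (`|h x| `^ p)%R); last by rewrite lerDr.
  by rewrite -[leLHS]powRr1// ler_powR// ltW.
rewrite ge0_integralD//; last exact: measurable_funTS.
rewrite integral_cst// mul1e lte_add_pinfty//; last exact: Lh.
apply: (@le_lt_trans _ _ ((2 * 1) ^+ d)%:E); last exact: ltry.
by rewrite le_eqVlt; apply/orP; left; apply/eqP; exact: lebesgue_rV_cube.
Qed.

Lemma integral_compl_sqr_lty s : hoelder_bound p h s < +oo ->
  \int[mu]_x (((h \* \1_(~` eball s)) x)%R ^+ 2)%:E < +oo.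
Proof.
move=> Hs; set I := \int[mu]_x _.
have NE : Lp_norm 2 h (~` eball s) = I `^ 2^-1.
  rewrite /Lp_norm Lnorm_fin; congr (_ `^ _); apply: eq_integral => x _.
  rewrite /=; congr EFin.
  by rewrite powR_mulrn// real_normK// num_real.
have P0 : 0 <= Lp_norm p h (eball s) * Lp_norm (p / (p - 1)) h (~` eball s).
  by rewrite mule_ge0 ?Lnorm_ge0.
have : Lp_norm 2 h (~` eball s) ^+ 2 < +oo.
  by apply: le_lt_trans Hs; rewrite /hoelder_bound leeDr.
rewrite NE => Ioo; apply: (@lty_poweRy _ _ 2^-1); first by rewrite invr_neq0.
rewrite ltey; apply: contraPneq Ioo => ->.
by rewrite expe2 mulyy ltxx.
Qed.

(** Near the origin [h] is integrable and [weight] is bounded; away from it both are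
    square integrable. *)
Lemma class_G_integrable_weight : mu.-integrable setT (EFin \o (fun x => h x * weight x)%R).
Proof.
have [s /andP[s0 s1] Hs] := hoelder_bound_fin (proj2 Gh).
have mw : measurable_fun setT (@weight R d).
  by apply/measurable_EFinP; exact: measurable_int integrable_weight.
have mB : measurable (eball s : set 'rV[R]_d) by exact: measurable_eball.
have mC : measurable (~` eball s : set 'rV[R]_d) by exact: measurableC.
have mhC := measurable_restr mh mC.
apply/integrableP; split; first by apply/measurable_EFinP; exact: measurable_funM.
have m1 : measurable_fun setT (fun x => `|h x|%:E * (\1_Q x)%:E).
  apply: emeasurable_funM; apply/measurable_EFinP; first exact: measurableT_comp.
  exact: measurable_indic.
have m2 : measurable_fun setT (fun x => (((h \* \1_(~` eball s)) x)%R ^+ 2)%:E).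
  by apply/measurable_EFinP; exact: measurable_funX.
have m3 : measurable_fun setT (fun x => (weight x)%:E) by exact/measurable_EFinP.
have m10 x : 0 <= `|h x|%:E * (\1_Q x)%:E by rewrite mule_ge0 ?lee_fin.
have m20 x : 0 <= (((h \* \1_(~` eball s)) x)%R ^+ 2)%:E by rewrite lee_fin sqr_ge0.
have m30 x : 0 <= (weight x)%:E by rewrite lee_fin weight_ge0.
apply: (@le_lt_trans _ _ (\int[mu]_x (`|h x|%:E * (\1_Q x)%:E +
    (((h \* \1_(~` eball s)) x)%R ^+ 2)%:E + (weight x)%:E))).
  apply: ge0_le_integral => //.
  - by apply/measurable_EFinP; apply: measurableT_comp => //; exact: measurable_funM.
  - by do 2 apply: emeasurable_funD => //.
  move=> x _; rewrite /= -EFinM -!EFinD lee_fin normrM (ger0_norm (weight_ge0 x)).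
  have w0 := weight_ge0 x; have w1 := weight_le1 x.
  have [xQ|xQ] := boolP (x \in Q).
    rewrite [\1_Q x]indicE xQ mulr1 -addrA.
    apply: (@le_trans _ _ `|h x|%R); first by rewrite ler_piMr.
    by rewrite lerDl addr_ge0// sqr_ge0.
  (* Outside the cube of half-side [1], hence outside the ball of radius [s < 1]. *)
  have xB : x \in ~` (eball s : set 'rV[R]_d).
    rewrite in_setC; apply: contra xQ; rewrite !inE => xs i /=.
    rewrite in_itv/= -ler_norml; apply: le_trans (ler_coord_enorm x i) _.
    by apply: ltW; apply: lt_trans s1.
  rewrite [\1_Q x]indicE (negPf xQ) mulr0 add0r indicE xB mulr1.
  rewrite -[(h x ^+ 2)%R]real_normK ?num_real//; set a := `|h x|%R.
  have a0 : (0 <= a)%R by exact: normr_ge0.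
  by have := sqr_ge0 (a - weight x)%R; nra.
rewrite ge0_integralD//; last 2 first.
- by move=> x _; rewrite adde_ge0.
- exact: emeasurable_funD.
rewrite ge0_integralD//; apply: lte_add_pinfty; first apply: lte_add_pinfty.
- rewrite -integral_indic_mkcond; exact: integral_cube_norm_lty.
- exact: integral_compl_sqr_lty.
- exact: integrable_lty integrable_weight.
Qed.

Lemma class_G_integrable_schwartz psi : schwartz psi ->
  mu.-integrable setT (EFin \o (fun x => `|h x| * psi x)%R).
Proof.
move=> S; have [C C0 psiC] := schwartz_le_weight S.
have i1 := integrableZl measurableT C class_G_integrable_weight.
apply: (le_integrable measurableT _ _ i1).
  apply/measurable_EFinP; apply: measurable_funM; first exact: measurableT_comp.
  exact: schwartz_measurable.
move=> x _ /=; rewrite lee_fin !normrM normr_id (ger0_norm C0) (ger0_norm (weight_ge0 x)).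
by rewrite [leRHS]mulrCA ler_wpM2l.
Qed.

End class_G_locally_integrable.

Section class_G_Hm1.
Local Open Scope ereal_scope.
Context {R : realType} {d : nat}.
Implicit Types (x : 'rV[R]_d) (e : R) (n : nat).
Local Notation mu := (@lebesgue_rV R d).

Lemma cvg0_near_le (u : (\bar R)^nat) e : (0 < e)%R -> u n @[n --> \oo] --> 0 ->
  \forall n \near \oo, u n <= e%:E.
Proof.
move=> e0 /fine_cvgP[fin /cvgr0_norm_le /(_ _ e0)].
apply: filterS2 fin => n h1 h2; rewrite -(fineK h1) lee_fin.
exact: le_trans (ler_norm _) h2.
Qed.

Lemma mulr_le_sqrD (c a b : R) : (0 < c)%R -> (0 <= a)%R -> (0 <= b)%R ->
  (a * b <= c * a ^+ 2 + c^-1 * b ^+ 2)%R.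
Proof.
move=> c0 a0 b0; rewrite -subr_ge0.
rewrite [leRHS](_ : _ = c^-1 * (c * a - b) ^+ 2 + a * b)%R; last by field; rewrite gt_eqF.
apply: addr_ge0; last exact: mulr_ge0.
by apply: mulr_ge0 (sqr_ge0 _); rewrite invr_ge0 ltW.
Qed.

Variable g : 'rV[R]_d -> R.
Hypotheses (mg : measurable_fun setT g) (g0 : forall x, (0 <= g x)%R).

Definition cutoff n : set 'rV[R]_d :=
  [set x | (g x <= n%:R)%R] `&` obox (fun=> - n%:R)%R (fun=> n%:R).

Lemma measurable_cutoff n : measurable (cutoff n).
Proof.
apply: measurableI; last exact: measurable_obox.
have -> : [set x | (g x <= n%:R)%R] = setT `&` g @^-1` `]-oo, (n%:R : R)]%classic.
  by rewrite setTI; apply/seteqP; split => x; rewrite /= in_itv.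
by apply: mg => //; exact: measurable_itv.
Qed.

Lemma cutoff_near x : \forall n \near \oo, cutoff n x.
Proof.
exists (maxn (Num.truncn (g x)).+1 (Num.truncn (enorm x)).+1) => //= n.
rewrite /= geq_max => /andP[n1 n2]; split.
  apply: le_trans (ltW (truncnS_gt (g x))) _; by rewrite ler_nat.
move=> i /=; rewrite in_itv/= -ltr_norml; apply: le_lt_trans (ler_coord_enorm x i) _.
by apply: lt_le_trans (truncnS_gt _) _; rewrite ler_nat.
Qed.

Lemma cutoff_mono m n : (m <= n)%N -> cutoff m `<=` cutoff n.
Proof.
move=> mn x [/= h1 h2]; have h : (m%:R <= n%:R :> R)%R by rewrite ler_nat.
split; first exact: le_trans h1 h.
by move=> i; have := h2 i; rewrite /= !in_itv/= => /andP[h3 h4]; apply/andP; split; lra.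
Qed.

Definition truncated n : 'rV[R]_d -> R := (g \* \1_(cutoff n))%R.

Lemma measurable_truncated n : measurable_fun setT (truncated n).
Proof. by apply: measurable_restr => //; exact: measurable_cutoff. Qed.

Lemma truncated_bounds n x : (0 <= truncated n x <= n%:R)%R.
Proof.
rewrite /truncated/= indicE; case: (boolP (x \in _)) => [/set_mem[/= h _]|_].
  by rewrite mulr1 g0.
by rewrite mulr0 lexx ler0n.
Qed.

Lemma truncated_eq0 n x : ~ obox (fun=> - n%:R)%R (fun=> n%:R) x -> truncated n x = 0%R.
Proof. by move=> nx; rewrite /truncated/= indicE memNset ?mulr0// => -[]. Qed.

Lemma approximable_truncated n : approximable (truncated n).
Proof.
apply: (approximable_bounded (measurable_truncated n) (truncated_bounds n)).
exact: truncated_eq0.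
Qed.

Lemma integrable_truncated n : mu.-integrable setT (EFin \o truncated n).
Proof.
have := integrableZl measurableT n%:R (@integrable_indic_obox R d n%:R).
apply: le_integrable => //.
  by apply/measurable_EFinP; exact: measurable_truncated.
move=> x _; rewrite /= lee_fin; have /andP[t0 tn] := truncated_bounds n x.
rewrite (ger0_norm t0).
have [xQ|xQ] := pselect (obox (fun=> - n%:R)%R (fun=> n%:R) x).
  by rewrite indicE mem_set// mulr1 ger0_norm.
by rewrite truncated_eq0.
Qed.

(** Two truncations beyond [N] agree where [g] has already been reached at [N], and
    otherwise both lie between [0] and [g]. *)
Lemma truncated_sub N m n x : (N <= m)%N -> (N <= n)%N ->
  (`|truncated m x - truncated n x| <= (g \* \1_(~` cutoff N)) x)%R.
Proof.
move=> Nm Nn; rewrite /truncated/= !indicE.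
have [xN|xN] := pselect (cutoff N x).
  rewrite (mem_set (cutoff_mono Nm xN)) (mem_set (cutoff_mono Nn xN)).
  by rewrite subrr normr0 mulr_ge0.
rewrite (mem_set (_ : (~` cutoff N) x))// mulr1 -mulrBr normrM ger0_norm//.
by rewrite ler_piMr//; case: (_ \in _); case: (_ \in _);
  rewrite ?subrr ?subr0 ?sub0r ?normrN ?normr0 ?normr1.
Qed.

Lemma cutoff_compl_near x : \forall n \near \oo, ~ (~` cutoff n) x.
Proof. by apply: filterS (cutoff_near x) => n xn; exact. Qed.

Lemma measurable_cutoffC n : measurable (~` cutoff n).
Proof. by apply: measurableC; exact: measurable_cutoff. Qed.

Variable phi : nat -> 'rV[R]_d -> R.
Hypotheses (Sphi : forall n, schwartz (phi n))
  (phi_near : forall n, sqdist (phi n) (truncated n) <= ((n.+1%:R^-1) ^+ 2)%:E).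

(** In the norm of the completion, the distance from [phi m] to [phi n] is controlled by
    the distances from each to its truncation, in square mean, and by the energy of the
    part of [g] that the smaller of the two truncations leaves out. *)
Lemma truncated_Hm1_cauchy : energy 2^-1 g < +oo -> Hm1_cauchy phi.
Proof.
move=> goo e e0; pose K : R := (6 * (2^-1 * (2 * pi) ^+ d))%R.
have K0 : (0 < K)%R by rewrite !mulr_gt0// exprn_gt0// mulr_gt0// pi_gt0.
(* Three terms that are at most [h] are multiplied by [K]; the norm is the square root. *)
pose h : R := ((e / 2) ^+ 2 / (3 * K))%R.
have e2 : (0 < e / 2)%R by rewrite divr_gt0.
have h0 : (0 < h)%R by apply: divr_gt0; [exact: exprn_gt0|exact: mulr_gt0].
have tail := energy_tail_cvg0 mg g0 goo measurable_cutoffC cutoff_compl_near.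
have near2 := near_infty_natSinv_lt (PosNum h0).
have [N _ /(_ N (leqnn N))[E1 E2]] := filterI (cvg0_near_le h0 tail) near2.
exists N => m n Nm Nn.
have sq k : (N <= k)%N -> sqdist (phi k) (truncated k) <= h%:E.
  move=> Nk; apply: (le_trans (phi_near k)); rewrite lee_fin.
  apply: (@le_trans _ _ (k.+1%:R^-1)%R).
    rewrite expr2 ler_piMr ?invr_ge0// invf_le1// ler1n//.
  apply: le_trans (ltW E2); rewrite /= lef_pV2 ?posrE// ler_nat ltnS//.
have H : Hm1_sqr (fun x => phi m x - phi n x)%R <= ((e / 2) ^+ 2)%:E.
  have mw : measurable_fun setT (g \* \1_(~` cutoff N))%R.
    by apply: measurable_restr => //; exact: measurable_cutoffC.
  apply: (le_trans (Hm1_sqr_sub_le (schwartz_integrable (Sphi m))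
    (schwartz_integrable (Sphi n)) (integrable_truncated m) (integrable_truncated n)
    mw (fun x => truncated_sub x Nm Nn))).
  apply: (@le_trans _ _ (K%:E * (h%:E + h%:E + h%:E))).
    apply: lee_wpmul2l; first by rewrite lee_fin ltW.
    by apply: leeD E1; apply: leeD; exact: sq.
  rewrite -!EFinD -EFinM lee_fin /h le_eqVlt; apply/orP; left; apply/eqP.
  by field; rewrite gt_eqF.
have -> : Hm1_norm (fun x => phi m x - phi n x)%R = Hm1_sqr (fun x => phi m x - phi n x)%R `^ 2^-1 by [].
apply: (@le_lt_trans _ _ (((e / 2) ^+ 2)%:E `^ 2^-1)).
  apply: gt0_ler_poweR => //; rewrite ?in_itv/= ?leey ?andbT//.
    by apply: integral_ge0 => x _; exact: Hm1_sqr_ge0.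
  by rewrite lee_fin sqr_ge0.
have e20 : (0 <= e / 2)%R by rewrite divr_ge0// ltW.
rewrite poweR_EFin -powR_mulrn// -powRrM mulfV// powRr1// lte_fin.
by lra.
Qed.

(** Against a test function [psi], replacing [phi n] by the truncation of [g] costs at most
    [c * (phi n - truncated n) ^ 2 + psi ^ 2 / c] for every [c]; the choice [c = n.+1]
    makes both terms small. Truncating [g] is dominated convergence. *)
Lemma truncated_tempered_limit :
  (forall psi, schwartz psi -> mu.-integrable setT (EFin \o (fun x => g x * psi x)%R)) ->
  tempered_limit phi g.
Proof.
move=> ig psi Spsi; split; first exact: ig.
have mpsi := schwartz_measurable Spsi.
have [C C0 psiC] := schwartz_bounded Spsi.
have ipsi := schwartz_integrable Spsi.
have iphipsi n : mu.-integrable setT (EFin \o (fun x => phi n x * psi x)%R).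
  have := integrableZl measurableT C (schwartz_integrable (Sphi n)).
  apply: le_integrable => //.
    by apply/measurable_EFinP; apply: measurable_funM => //; exact: schwartz_measurable.
  by move=> x _; rewrite /= lee_fin !normrM mulrC (ger0_norm C0) ler_wpM2r.
have ipsi2 : mu.-integrable setT (EFin \o (fun x => psi x ^+ 2)%R).
  have := integrableZl measurableT C ipsi.
  apply: le_integrable => //; first by apply/measurable_EFinP; exact: measurable_funX.
  by move=> x _; rewrite /= lee_fin expr2 !normrM (ger0_norm C0) ler_wpM2r.
pose J := fine (\int[mu]_x (psi x ^+ 2)%:E).
have JE : \int[mu]_x (psi x ^+ 2)%:E = J%:E.
  by rewrite /J fineK//; exact: integrable_fin_num.
pose T n := \int[mu]_x (`|g x * psi x| * \1_(~` cutoff n) x)%:E.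
have mT n : measurable_fun setT (fun x => (`|g x * psi x| * \1_(~` cutoff n) x)%:E).
  apply/measurable_EFinP; apply: measurable_funM.
    by apply: measurableT_comp => //; exact: measurable_funM.
  by apply: measurable_indic; exact: measurable_cutoffC.
have T0 : T n @[n --> \oo] --> 0.
  have [|||||_ _ ] := @dominated_convergence _ _ _ mu setT measurableT
    (fun n x => (`|g x * psi x| * \1_(~` cutoff n) x)%:E) (cst 0)
    (fun x => (`|g x * psi x|)%:E).
  - exact: mT.
  - exact: measurable_cst.
  - apply/aeW => x _; apply: cvg_near_cst.
    by apply: filterS (cutoff_compl_near x) => n xn; rewrite indicE memNset// mulr0.
  - by have := integrable_abse (ig _ Spsi); apply: eq_integrable.
  - apply/aeW => x n _; rewrite /= lee_fin normrM normr_id ler_piMr//.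
    by rewrite indicE; case: (_ \in _); rewrite ?normr0 ?normr1.
  by rewrite integral0.
have le n : `|\int[mu]_x (phi n x * psi x) - \int[mu]_x (g x * psi x)|%:E <=
    (n.+1%:R^-1 * (1 + J))%:E + T n.
  have n0 : (0 < n.+1%:R :> R)%R by [].
  have ms : measurable_fun setT (fun x => ((phi n x - truncated n x) ^+ 2)%:E).
    by apply: measurable_sqdist; [exact: schwartz_measurable|exact: measurable_truncated].
  have mp2 : measurable_fun setT (fun x => (psi x ^+ 2)%:E).
    by apply/measurable_EFinP; exact: measurable_funX.
  have iD := integrable_subr (iphipsi n) (ig _ Spsi).
  rewrite -(RintegralB measurableT (iphipsi n) (ig _ Spsi)).
  apply: (@le_trans _ _ (\int[mu]_x `|phi n x * psi x - g x * psi x|%:E)).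
    rewrite -[leRHS]fineK; last first.
      by apply: integrable_fin_num => //; exact: integrable_abse iD.
    by rewrite lee_fin; exact: le_normr_Rintegral.
  apply: (@le_trans _ _ (\int[mu]_x (n.+1%:R%:E * ((phi n x - truncated n x) ^+ 2)%:E +
      n.+1%:R^-1%:E * (psi x ^+ 2)%:E + (`|g x * psi x| * \1_(~` cutoff n) x)%:E))).
    apply: ge0_le_integral => //.
    - apply/measurable_EFinP; apply: measurableT_comp => //.
      by apply/measurable_EFinP; exact: measurable_int iD.
    - apply: emeasurable_funD => //.
      by apply: emeasurable_funD; apply: emeasurable_funM.
    move=> x _; rewrite -!EFinM -!EFinD lee_fin.
    have -> : (phi n x * psi x - g x * psi x =
        (phi n x - truncated n x) * psi x - g x * psi x * \1_(~` cutoff n) x)%R.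
      rewrite /truncated/= !indicE in_setC; case: (_ \in _) => /=; ring.
    apply: (le_trans (ler_normB _ _)); apply: lerD; last first.
      rewrite normrM ler_wpM2l// indicE; by case: (_ \in _); rewrite ?normr0 ?normr1.
    rewrite normrM -[X in (_ <= _ * X + _)%R]real_normK ?num_real//.
    rewrite -[(psi x ^+ 2)%R]real_normK ?num_real//.
    set a := `|phi n x - _|%R; set b := `|psi x|%R.
    have a0 : (0 <= a)%R by exact: normr_ge0.
    have b0 : (0 <= b)%R by exact: normr_ge0.
    exact: mulr_le_sqrD.
  rewrite ge0_integralD//; last 2 first.
  - by move=> x _; rewrite adde_ge0 ?mule_ge0 ?lee_fin ?sqr_ge0 ?invr_ge0.
  - by apply: emeasurable_funD; apply: emeasurable_funM.
  rewrite leeD2r// ge0_integralD//; last 4 first.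
  - by move=> x _; rewrite mule_ge0 ?lee_fin ?sqr_ge0.
  - by apply: emeasurable_funM.
  - by move=> x _; rewrite mule_ge0 ?lee_fin ?sqr_ge0 ?invr_ge0.
  - by apply: emeasurable_funM.
  rewrite !ge0_integralZl//; last 2 first.
  - by move=> x _; rewrite lee_fin sqr_ge0.
  - by move=> x _; rewrite lee_fin sqr_ge0.
  rewrite JE -EFinM mulrDr mulr1 EFinD leeD2r//.
  apply: (@le_trans _ _ (n.+1%:R%:E * ((n.+1%:R^-1) ^+ 2)%:E)).
    by apply: lee_wpmul2l; [rewrite lee_fin ltW|exact: phi_near].
  rewrite -EFinM lee_fin le_eqVlt; apply/orP; left; apply/eqP.
  by field; rewrite gt_eqF.
apply/cvgrPdist_le => e e0.
have hJ : (0 <= J)%R by apply: fine_ge0; apply: integral_ge0 => x _; rewrite lee_fin sqr_ge0.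
have e1 : (0 < e / 2 / (1 + J))%R by rewrite !divr_gt0// ltr_wpDr.
have e2 : (0 < e / 2)%R by rewrite divr_gt0.
near=> n.
rewrite distrC -lee_fin; apply: (le_trans (le n)).
rewrite (_ : e = e / 2 + e / 2)%R; last by lra.
rewrite EFinD; apply: leeD.
  rewrite lee_fin -ler_pdivlMr ?ltr_wpDr//; apply: ltW.
  by near: n; exact: (near_infty_natSinv_lt (PosNum e1)).
by near: n; exact: cvg0_near_le.
Unshelve. all: end_near. Qed.

End class_G_Hm1.

Lemma class_G_in_Hm1 (R : realType) (d : nat) (p : R) (h : 'rV[R]_d -> R) :
  (0 < d)%N -> 1 < p -> class_G p h -> in_Hm1 (fun x => `|h x|).
Proof.
move=> d0 p1 Gh; have [[mh _] _] := Gh.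
have mg : measurable_fun setT (fun x => `|h x|) by exact: measurableT_comp.
have g0 x : 0 <= `|h x| by exact: normr_ge0.
have [phi phiP] : {phi : nat -> 'rV[R]_d -> R & forall n, schwartz (phi n) /\
    (sqdist (phi n) (truncated (fun x => `|h x|%R) n) <= ((n.+1%:R^-1) ^+ 2)%:E)%E}.
  apply: (@choice _ _ (fun n f => schwartz f /\
    (sqdist f (truncated (fun x => `|h x|%R) n) <= ((n.+1%:R^-1) ^+ 2)%:E)%E)) => n.
  have e0 : 0 < (n.+1%:R^-1) ^+ 2 :> R by rewrite exprn_gt0// invr_gt0.
  by have [f Sf hf] := approximable_truncated mg g0 n e0; exists f.
have S n : schwartz (phi n) by have [] := phiP n.
have D n := proj2 (phiP n).
exists phi; split => //.
  by apply: (truncated_Hm1_cauchy mg g0 S D); apply: (class_G_energy_lty d0 p1 _ Gh); rewrite invr_gt0.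
apply: (truncated_tempered_limit mg S D) => psi; exact: class_G_integrable_schwartz p1 Gh _.
Qed.

Theorem lemma4p1 (R : realType) (d : nat) (d_ge1 : (1 <= d)%N) :
  (forall (p : R) (h : 'rV[R]_d -> R), 1 < p -> class_G p h ->
     in_Hm1 (fun x => `|h x|)) /\
  (forall h : 'rV[R]_d -> R, (exists2 p : R, 1 < p & class_G p h) ->
     let f := convolution h (reflection h) in
     (exists2 lambda : R, 0 < lambda &
        (\int[lebesgue_rV d]_x (resolvent lambda x * `|f x|) < +oo)%E) /\
     (forall lambda : R, 0 < lambda ->
        (\int[lebesgue_rV d]_x (resolvent lambda x * `|f x|) < +oo)%E)).
Proof.
split=> [p h p1|h [p p1 Gh] f]; first exact: class_G_in_Hm1.
have foo l : 0 < l -> (\int[lebesgue_rV d]_x (resolvent l x * `|f x|) < +oo)%E.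
  by move=> l0; exact: resolvent_convolution_lty d_ge1 p1 l0 Gh.
by split; [exists 1 => //; exact: foo ltr01|exact: foo].
Qed.
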